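(* Let $f, g_1,\dots,g_m \in \mathbb{Z}[X_1,\dots,X_n]$ have degrees less than $d$ and coefficients of bit size at most $\tau$, let $g_0:=1$ and $S := \{x\in\mathbb{R}^n : g_1(x)\ge0,\dots,g_m(x)\ge0\}$. Assume $S$ is a basic compact semi-algebraic set with nonempty interior, included in $[-1,1]^n$, that $\mathcal{Q}(S)$ is archimedean, and that $f$ is positive over $S$ with $f^\star := \min_{x\in S} f(x) > 0$. Then there exists $D = 2k\in 2\mathbb{N}$ such that: (i) $f \in \mathcal{Q}_D(S)$ with a representation $f = f_D^\star + \sum_{j=0}^m \sigma_j g_j$ where $f_D^\star>0$ and $\sigma_j \in \Sigma[X]$ with $\deg(\sigma_j g_j)\le D$ for all $j=0,\dots,m$; (ii) $f \in \mathcal{Q}_D(S')$ with a representation $f = \sum_{j=0}^m \mathring{\sigma}_j g_j + \sum_{|\alpha|\le k} c_\alpha (1 - X^{2\alpha})$, where $\mathring{\sigma}_j \in \mathring{\Sigma}[X]$ with $\deg(\mathring{\sigma}_j g_j)\le D$ for all $j=0,\dots,m$ and $(c_\alpha)_{|\alpha|\le k}$ is a sequence of positive numbers; (iii) there exist a real $C_S>0$ depending on $S$ and $\varepsilon = \frac{1}{2^N}$ with positive $N\in\mathbb{N}$ such that $f - \varepsilon\sum_{|\alpha|\le k} X^{2\alpha} \in \mathcal{Q}_D(S')$ and $N \le 2^{C_S \tau d^{2n+2}}$.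
   Context: $\Sigma[X]$ is the cone of sums of squares in $\mathbb{R}[X]$ and $\mathring{\Sigma}[X]$ its interior. For a finite family $h_1,\dots,h_p$ defining $T=\{h_1\ge0,\dots,h_p\ge0\}$ and $h_0:=1$: $\mathcal{Q}(T) := \{\sum_{j} \sigma_j h_j : \sigma_j\in\Sigma[X]\}$ and, for $D\in\mathbb{N}$, the truncated quadratic module $\mathcal{Q}_D(T) := \{\sum_j \sigma_j h_j : \sigma_j\in\Sigma[X],\ \deg(\sigma_j h_j)\le D\}$. $\mathcal{Q}(S)$ is archimedean if $N-\sum_i X_i^2\in\mathcal{Q}(S)$ for some $N\in\mathbb{N}$. $f_D^\star := \sup\{b : f - b\in\mathcal{Q}_D(S)\}$. With $D=2k$, $S' := \{x\in S : 1 - x^{2\alpha}\ge 0 \ \forall \alpha\in\mathbb{N}^n,\ |\alpha|\le k\}$, described by the constraints $g_1,\dots,g_m$ together with $1-X^{2\alpha}$, $|\alpha|\le k$.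
   Formalization: The interior of Σ[X], which is empty in the full polynomial ring for n ≥ 1, is taken for each j as the interior of the cone of sums of squares of degree at most 2r_j in the polynomials of degree at most 2r_j, with 2r_j the largest even number at most D − deg g_j. *)

(* Defs.v *)
From mathcomp Require Import all_boot all_algebra.
From mathcomp Require Import reals.
From mathcomp Require Import mpoly.
From mathcomp Require Import exp.
Import GRing.Theory Num.Theory.

Set Implicit Arguments.
Unset Strict Implicit.
Unset Printing Implicit Defensive.

Local Open Scope ring_scope.

Section Defs.
Variables (R : realType) (n : nat).
Local Notation P := {mpoly R[n]}.

(* total degree; msize p = deg p + 1 for p <> 0, msize 0 = 0 *)
Definition pdeg (p : P) : nat := (msize p).-1.

Definition is_sos (p : P) : Prop :=
  exists s : seq P, p = \sum_(q <- s) q ^+ 2.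

(* sigma lies in the interior of the cone of SOS of degree <= 2r, the interior
   being taken in the finite-dimensional space R[X]_{<= 2r} (coefficient norm) *)
Definition sos_interior (r : nat) (sigma : P) : Prop :=
  (msize sigma <= (2 * r).+1)%N /\
  exists eps : R, 0 < eps /\
    forall p : P, (msize p <= (2 * r).+1)%N ->
      (forall mm, `|p@_mm| < eps) -> is_sos (sigma + p).

Definition int_coeffs_bits (tau : nat) (p : P) : Prop :=
  forall mm, p@_mm \is a Num.int /\ `|p@_mm| < 2%:R ^+ tau.

Variable m : nat.
Variable g : 'I_m -> P.

Definition inS (x : 'I_n -> R) : Prop := forall i, 0 <= (g i).@[x].

Definition Qmod (p : P) : Prop :=
  exists (s0 : P) (s : 'I_m -> P),
    is_sos s0 /\ (forall i, is_sos (s i)) /\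
    p = s0 + \sum_(i < m) s i * g i.

Definition QmodD (D : nat) (p : P) : Prop :=
  exists (s0 : P) (s : 'I_m -> P),
    is_sos s0 /\ (forall i, is_sos (s i)) /\
    (msize s0 <= D.+1)%N /\ (forall i, (msize (s i * g i) <= D.+1)%N) /\
    p = s0 + \sum_(i < m) s i * g i.

Definition archimedean : Prop :=
  exists N : nat, Qmod (N%:R - \sum_(i < n) 'X_i ^+ 2).

Definition fstarD (D : nat) (f : P) : R :=
  sup (fun b : R => QmodD D (f - b%:MP)).

Definition QmodD' (k D : nat) (p : P) : Prop :=
  exists (s0 : P) (s : 'I_m -> P) (t : 'X_{1..n < k.+1} -> P),
    is_sos s0 /\ (forall i, is_sos (s i)) /\ (forall a, is_sos (t a)) /\
    (msize s0 <= D.+1)%N /\ (forall i, (msize (s i * g i) <= D.+1)%N) /\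
    (forall a, (msize (t a * (1 - 'X_[a] ^+ 2)) <= D.+1)%N) /\
    p = s0 + \sum_(i < m) s i * g i
          + \sum_(a : 'X_{1..n < k.+1}) t a * (1 - 'X_[a] ^+ 2).

End Defs.

(* Main.v *)
(** Write [X = tau * d ^ (2n+2)]; implied constants depend on [g] only.

    Effective positivity. Let [G(x,s) = \sum_j (h_j(x) - s_j^2)^2], where the
    [h_j] are [-f], the [g_i] and [A - |x|^2]. As [f > 0] on [S], the polynomial
    [G] is positive and coercive, and its minimum [t0] is bounded below as
    follows. The perturbation [G + e \sum_i y_i^(E_i+1) / (E_i+1)] has a
    minimizer, where [y_i^(E_i) = - z * d_i G] with [z = 1/e]. These equations
    rewrite every monomial into the finite set of monomials with exponents
    [< E_i], so the values of [G] at such points are eigenvalues of a matrix over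
    Z[z]. When [z] goes to infinity, [t0] becomes a root of the leading
    coefficient in [z] of the characteristic polynomial, a nonzero integer
    polynomial of controlled height. Hence there is [c = 2^-Gamma], with
    [Gamma = O(X)], such that each point of a box has [f >= c] or some
    [g_i <= -c].

    Effective Putinar. Then [p = f - lambda * \sum_i (1 - g_i/F)^(2K) * g_i] is at
    least [c/2] on the box, and its Bernstein coefficients of degree [L] are
    nonnegative for [L] of size exponential in the data. The faces [M +- x_i] of
    the box lie in the quadratic module of the single polynomial
    [N - |x|^2], which is closed under products. So [f - c/4] is in Q_2k(g)
    with [log log k = O(X)].

    (i) The truncated quadratic module is closed: a bounded number of squares
    suffices, and the map sending the square roots to [\sum_j sigma_j * g_j] is
    homogeneous and vanishes only at [0] because [S] has interior. So the
    supremum defining [fstarD] is attained.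
    (ii) [\sum_(|a| <= k) X^2a] is interior, and subtracting a multiple of it is
    compensated by the constraints [1 - X^2a].
    (iii) It is enough that [2^-N] times the number of monomials of degree at most
    [k] be at most [c/4]. *)

Require Import Defs.
From mathcomp Require Import all_boot all_order perm all_algebra polyXY.
From mathcomp Require Import reals mpoly ssrcomplements exp.
From mathcomp Require Import boolp classical_sets topology normedtype derive.
From mathcomp Require Import ring lra zify.
Import Order.TTheory GRing.Theory Num.Theory.
Import numFieldNormedType.Exports.
Set Implicit Arguments.
Unset Strict Implicit.
Unset Printing Implicit Defensive.
Local Open Scope ring_scope.

(** * Polynomial functions: minima on boxes, first-order expansions *)

Section PolynomialFunctions.
Variables (R : realType) (I : eqType).

(** The index type is arbitrary because the extreme value theorem is used both on points of [R^n]
    and on vectors of coefficients of square roots. *)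
Inductive polyfun : ((I -> R) -> R) -> Prop :=
| polyfun_cst c : polyfun (fun=> c)
| polyfun_proj i : polyfun (fun x => x i)
| polyfunD f g : polyfun f -> polyfun g -> polyfun (fun x => f x + g x)
| polyfunM f g : polyfun f -> polyfun g -> polyfun (fun x => f x * g x).

Lemma polyfun_ext f g : f =1 g -> polyfun f -> polyfun g.
Proof. by move=> /funext ->. Qed.

Lemma polyfunN f : polyfun f -> polyfun (fun x => - f x).
Proof.
move=> hf; apply: (polyfun_ext (f := fun x => (-1) * f x)).
  by move=> x; rewrite mulN1r.
by apply: polyfunM => //; exact: polyfun_cst.
Qed.

Lemma polyfunX f k : polyfun f -> polyfun (fun x => f x ^+ k).
Proof.
move=> hf; elim: k => [|k IH].
  by apply: polyfun_ext (polyfun_cst 1) => x; rewrite expr0.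
by apply: polyfun_ext (polyfunM hf IH) => x; rewrite exprS.
Qed.

Lemma polyfun_sum (J : Type) (r : seq J) (P : pred J) F :
  (forall j, polyfun (F j)) -> polyfun (fun x => \sum_(j <- r | P j) F j x).
Proof.
move=> hF; elim: r => [|j r IH].
  by apply: polyfun_ext (polyfun_cst 0) => x; rewrite big_nil.
case Pj: (P j); last by apply: polyfun_ext IH => x; rewrite big_cons Pj.
by apply: polyfun_ext (polyfunD (hF j) IH) => x; rewrite big_cons Pj.
Qed.

Lemma polyfun_prod (J : Type) (r : seq J) (P : pred J) F :
  (forall j, polyfun (F j)) -> polyfun (fun x => \prod_(j <- r | P j) F j x).
Proof.
move=> hF; elim: r => [|j r IH].
  by apply: polyfun_ext (polyfun_cst 1) => x; rewrite big_nil.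
case Pj: (P j); last by apply: polyfun_ext IH => x; rewrite big_cons Pj.
by apply: polyfun_ext (polyfunM (hF j) IH) => x; rewrite big_cons Pj.
Qed.

Lemma continuous_add (T : topologicalType) (f g : T -> R) :
  continuous f -> continuous g -> continuous (fun x => f x + g x).
Proof. by move=> hf hg x; apply: cvgD; [exact: hf|exact: hg]. Qed.

Lemma continuous_mul (T : topologicalType) (f g : T -> R) :
  continuous f -> continuous g -> continuous (fun x => f x * g x).
Proof. by move=> hf hg x; apply: cvgM; [exact: hf|exact: hg]. Qed.

Lemma polyfun_continuous (f : (I -> R) -> R) : polyfun f ->
  continuous (f : prod_topology (fun _ : I => R) -> R).
Proof.
elim=> [c|i|{}f g _ hf _ hg|{}f g _ hf _ hg].
- move=> x; exact: cst_continuous.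
- move=> x; exact: (@proj_continuous I (fun=> R) i x).
- exact: (@continuous_add (prod_topology (fun _ : I => R)) f g hf hg).
- exact: (@continuous_mul (prod_topology (fun _ : I => R)) f g hf hg).
Qed.

(** The box is compact by Tychonoff and polynomial functions are continuous for the product
    topology. *)
Lemma polyfun_min (a b : I -> R) f : (forall i, a i <= b i) -> polyfun f ->
  exists x, (forall i, a i <= x i <= b i) /\
    forall y, (forall i, a i <= y i <= b i) -> f x <= f y.
Proof.
move=> hab hf.
have hc : compact ([set x | forall i, `[a i, b i]%classic (x i)]%classic
    : set (prod_topology (fun _ : I => R))).
  exact: (@tychonoff I (fun=> R) (fun i => `[a i, b i]%classic)
    (fun i => @segment_compact R (a i) (b i))).
have h0 : (([set x | forall i, `[a i, b i]%classic (x i)]%classic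
    : set (prod_topology (fun _ : I => R))) !=set0)%classic.
  by exists a => i /=; rewrite in_itv /= lexx hab.
have hf' := continuous_subspaceT (polyfun_continuous hf).
have [x /set_mem hx hmin] :=
  @compact_EVT_min (prod_topology (fun _ : I => R)) R f _ h0 hc (hf' _).
exists x; split=> [i|y hy].
  by have := hx i; rewrite /= in_itv.
by apply: hmin; apply/mem_set => i /=; rewrite in_itv /=; exact: hy.
Qed.

End PolynomialFunctions.

(** * Evaluation: Taylor expansion along a coordinate, vanishing on a cube *)

Section Evaluation.
Variables (R : realType) (n : nat).
Implicit Types (p q : {mpoly R[n]}) (x y : 'I_n -> R).

Lemma polyfun_meval p : polyfun (fun x => p.@[x]).
Proof.
apply: (@polyfun_ext _ _
  (fun x => \sum_(m <- msupp p) p@_m * \prod_i x i ^+ m i)).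
  by move=> x; rewrite mevalE.
apply: polyfun_sum => m; apply: polyfunM; first exact: polyfun_cst.
apply: polyfun_prod => i; apply: polyfunX; exact: polyfun_proj.
Qed.

Definition shift x (i : 'I_n) (s : R) : 'I_n -> R :=
  fun j => x j + (i == j)%:R * s.

Lemma mpoly_ring_ind (P : {mpoly R[n]} -> Prop) :
  (forall c, P c%:MP) -> (forall i, P 'X_i) ->
  (forall p q, P p -> P q -> P (p + q)) ->
  (forall p q, P p -> P q -> P (p * q)) -> forall p, P p.
Proof.
move=> hC hX hD hM.
have hX' m : P 'X_[m].
  rewrite mpolyXE_id; elim/big_ind: _ => //; first exact: (hC 1).
  move=> i _; elim: (m i) => [|k IH]; first by rewrite expr0; exact: (hC 1).
  by rewrite exprS; apply: hM.
elim/mpolyind => [|c m p _ _ IH]; first by have := hC 0; rewrite mpolyC0.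
by apply: hD => //; rewrite -mul_mpolyC; apply: hM.
Qed.

Lemma meval_shift p x i : exists r : {poly R}, forall s,
  p.@[shift x i s] = p.@[x] + s * p^`M(i).@[x] + s ^+ 2 * r.[s].
Proof.
elim/mpoly_ring_ind: p => [c|j|p q [r hr] [r' hr']|p q [r hr] [r' hr']].
- by exists 0 => s; rewrite mderivC !mevalC ?meval0 hornerC !mulr0 !addr0.
- exists 0 => s; rewrite mevalXU mderivX mevalZ mevalXU hornerC mulr0 addr0.
  rewrite /shift mnm1E eq_sym; case: eqP => [->|_]; last by rewrite !mul0r mulr0.
  have -> : (U_(i) - U_(i))%MM = 0%MM :> 'X_{1..n}.
    by apply/mnmP => k; rewrite mnmBE mnm0E subnn.
  by rewrite mpolyX0 meval1 !mul1r mulr1.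
- exists (r + r') => s; rewrite mderivD !mevalD hr hr' hornerD.
  ring.
- exists (p.@[x] *: r' + q.@[x] *: r + (p^`M(i).@[x] * q^`M(i).@[x])%:P
    + 'X * (p^`M(i).@[x] *: r' + q^`M(i).@[x] *: r + 'X * (r * r'))) => s.
  rewrite mderivM !(mevalD, mevalM) hr hr' !hornerE /=.
  ring.
Qed.

Lemma horner_bounded (r : {poly R}) rho : 0 <= rho ->
  exists B : R, 0 < B /\ forall s : R, `|s| <= rho -> `|r.[s]| <= B.
Proof.
move=> rho0; elim/poly_ind: r => [|r c [B [B0 hB]]].
  by exists 1; split=> // s _; rewrite hornerC normr0.
exists (B * rho + `|c| + 1); split.
  by rewrite ltr_wpDl // addr_ge0 // mulr_ge0 // ltW.
move=> s hs; rewrite hornerMXaddC; apply: le_trans (ler_normD _ _) _.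
rewrite -addrA lerD ?lerDl // normrM; apply: ler_pM => //; exact: hB.
Qed.

(** If [c] were nonzero, the step [s = - t * c] with a small [t > 0] would give the negative value
    [- t * c^2 * (1 - t * B)]. *)
Lemma small_linear_part (c B : R) (r : R) : 0 < r ->
  (forall s, `|s| <= r -> 0 <= s * c + s ^+ 2 * B) -> c = 0.
Proof.
move=> r0 h; apply/eqP; apply: contraT => c0.
(* Small enough for both [|t * c| <= r] and [t * B < 1]. *)
pose t := r / (`|c| + r * `|B| + 1).
have cp : 0 < `|c| by rewrite normr_gt0.
have rB : 0 <= r * `|B| by rewrite mulr_ge0 // ltW.
have Dp : 0 < `|c| + r * `|B| + 1 by lra.
have t0 : 0 < t by rewrite divr_gt0.
have /h : `| - (t * c)| <= r.
  rewrite normrN normrM gtr0_norm // /t mulrAC ler_pdivrMr // ler_pM2l //.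
  by rewrite -addrA lerDl addr_ge0.
have -> : - (t * c) * c + (- (t * c)) ^+ 2 * B = - (t * c ^+ 2) * (1 - t * B).
  by ring.
have tB : t * B < 1.
  apply: (@le_lt_trans _ _ (t * `|B|)); first by rewrite ler_pM2l // ler_norm.
  rewrite /t mulrAC ltr_pdivrMr // mul1r; lra.
rewrite leNgt => /negP[]; rewrite mulNr oppr_lt0 mulr_gt0 ?subr_gt0 //.
by rewrite mulr_gt0 // exprn_even_gt0.
Qed.

Lemma mderiv_min p x i (r : R) : 0 < r ->
  (forall s, `|s| <= r -> p.@[x] <= p.@[shift x i s]) -> p^`M(i).@[x] = 0.
Proof.
move=> r0 h; have [q hq] := meval_shift p x i.
have [B [B0 hB]] := horner_bounded q ler01.
apply: (@small_linear_part _ B (Num.min r 1)); first by rewrite lt_min r0 ltr01.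
move=> s; rewrite le_min => /andP[sr s1].
have := h s sr; rewrite hq -addrA lerDl => /le_trans; apply.
rewrite lerD2l ler_wpM2l ?sqr_ge0 //; exact: le_trans (ler_norm _) (hB _ s1).
Qed.

Lemma cube_shift x y i r : (forall j, `|y j - x j| < r) -> exists2 e : R, 0 < e &
  forall s : R, `|s| <= e -> forall j, `|shift y i s j - x j| < r.
Proof.
move=> hy; exists ((r - `|y i - x i|) / 2).
  by rewrite divr_gt0 // subr_gt0.
move=> s hs j; rewrite /shift; case: eqP => [<-|_]; last by rewrite mul0r addr0.
rewrite mul1r addrAC; apply: le_lt_trans (ler_normD _ _) _.
have := hy i; lra.
Qed.

(** Induction on the degree: every point of the cube is a local minimum of [p], so the partial
    derivatives vanish on the cube and are zero by induction; in characteristic zero [p] is then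
    constant. *)
Lemma mpoly_eq0_cube p x r : 0 < r ->
  (forall y, (forall i, `|y i - x i| < r) -> p.@[y] = 0) -> p = 0.
Proof.
move=> r0; have [k] := ubnP (msize p); elim: k p => // k IH p hk hp.
have [p1|p1] := leqP (msize p) 1.
  have := hp x; rewrite (msize1_polyC p1) mevalC => h.
  by rewrite h ?mpolyC0 // => i; rewrite subrr normr0.
have hd i : p^`M(i) = 0.
  apply: IH => [|y hy]; last first.
    have [e e0 he] := cube_shift i hy.
    apply: (mderiv_min e0) => s hs.
    by rewrite !hp //; exact: he.
  rewrite ltnS in hk; apply: leq_trans hk.
  rewrite msizeE big_seq; apply: leq_ltn_trans (_ : (msize p).-1 < _)%N.
    elim/big_ind: _ => // [a b|m]; first by rewrite geq_max => -> ->.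
    rewrite mcoeff_msupp mcoeff_deriv => h.
    have : (m + U_(i))%MM \in msupp p.
      by rewrite mcoeff_msupp; apply: contra h => /eqP ->; rewrite mul0rn.
    by move/msize_mdeg_lt; rewrite mdegD mdeg1 addn1; lia.
  by lia.
suff : (msize p <= 1)%N by rewrite leqNgt p1.
rewrite msizeE big_seq; elim/big_ind: _ => // [a b|m hm]; first by rewrite geq_max => -> ->.
rewrite ltnS leqn0 mdeg_eq0; apply: contraTT hm => m0.
have [i mi] : exists i, m i != 0%N.
  apply/existsP; apply: contraNT m0 => /existsPn h; apply/eqP/mnmP => i.
  by rewrite mnm0E; apply/eqP; rewrite -[_ == _]negbK h.
have := congr1 (mcoeff (m - U_(i))) (hd i).
rewrite mcoeff_deriv mcoeff0 submK ?lep1mP // => /eqP.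
by rewrite mulrn_eq0 /= mcoeff_eq0.
Qed.

End Evaluation.

(** * Norms of coefficients *)

Section PolyNorm.
Variables (R : realFieldType) (A : nzRingType) (nu : A -> R).

(** Stated over an abstract ring because [l1norm] is iterated: on polynomials in [z], then on
    characteristic polynomials over these. *)
Definition is_ring_norm := [/\ nu 0 = 0, nu 1 <= 1, forall a, nu (- a) = nu a,
  forall a b, nu (a + b) <= nu a + nu b & forall a b, nu (a * b) <= nu a * nu b].

Definition l1norm (p : {poly A}) : R := \sum_(i < size p) nu p`_i.

Hypothesis nuP : is_ring_norm.
Implicit Types (p q : {poly A}).

Lemma ring_norm_ge0 a : 0 <= nu a.
Proof.
have [h0 _ hN hD _] := nuP.
have := hD a (- a); rewrite subrr h0 hN; lra.
Qed.

Lemma l1norm_widen (N : nat) p : (size p <= N)%N ->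
  l1norm p = \sum_(i < N) nu p`_i.
Proof.
have [h0 _ _ _ _] := nuP.
move=> hN; rewrite /l1norm (big_ord_widen N (fun i => nu p`_i)) // big_mkcond /=.
apply: eq_bigr => i _; case: ltnP => // hi.
by rewrite nth_default.
Qed.

Lemma l1norm_coef p i : nu p`_i <= l1norm p.
Proof.
have [h0 _ _ _ _] := nuP.
have [hi|hi] := ltnP i (size p); last first.
  by rewrite nth_default // h0; apply: sumr_ge0 => *; exact: ring_norm_ge0.
rewrite /l1norm (bigD1 (Ordinal hi)) //= lerDl.
by apply: sumr_ge0 => *; exact: ring_norm_ge0.
Qed.

Lemma l1norm_cons p c : l1norm (p * 'X + c%:P) = l1norm p + nu c.
Proof.
have [h0 _ _ _ _] := nuP.
rewrite (@l1norm_widen (size p).+1 (p * 'X + c%:P)); last first.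
  by rewrite size_MXaddC; case: ifP.
rewrite big_ord_recl coefD coefMX coefC /= add0r addrC; congr (_ + _).
by apply: eq_bigr => i _; rewrite coefD coefMX coefC /= addr0.
Qed.

Lemma l1norm0 : l1norm 0 = 0.
Proof. by rewrite /l1norm size_poly0 big_ord0. Qed.

Lemma l1normC c : l1norm c%:P = nu c.
Proof. by rewrite -[c%:P]add0r -{1}(mul0r 'X) l1norm_cons l1norm0 add0r. Qed.

Lemma l1normMX p : l1norm (p * 'X) = l1norm p.
Proof.
have [h0 _ _ _ _] := nuP.
by rewrite -[p * 'X]addr0 -(polyC0 A) l1norm_cons h0 addr0.
Qed.

Lemma l1normX : l1norm 'X <= 1.
Proof. by rewrite -['X]mul1r l1normMX l1normC; case: nuP. Qed.

Lemma l1normD p q : l1norm (p + q) <= l1norm p + l1norm q.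
Proof.
have [h0 h1 hN hD hM] := nuP.
rewrite (@l1norm_widen (maxn (size p) (size q)) p) ?leq_maxl //.
rewrite (@l1norm_widen (maxn (size p) (size q)) q) ?leq_maxr //.
rewrite (@l1norm_widen (maxn (size p) (size q))) ?size_polyD //.
by rewrite -big_split; apply: ler_sum => i _; rewrite coefD.
Qed.

Lemma l1norm_scale_le (c : A) p : l1norm (c%:P * p) <= nu c * l1norm p.
Proof.
have [h0 h1 hN hD hM] := nuP.
rewrite (@l1norm_widen (size p)); last first.
  by rewrite mul_polyC; exact: size_scale_leq.
by rewrite /l1norm mulr_sumr; apply: ler_sum => i _; rewrite coefCM.
Qed.

End PolyNorm.

Lemma l1norm_ring_norm (R : realFieldType) (A : nzRingType) (nu : A -> R) :
  is_ring_norm nu -> is_ring_norm (l1norm nu).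
Proof.
move=> nuP; have [h0 h1 hN hD hM] := nuP; split.
- exact: l1norm0.
- by rewrite -polyC1 l1normC.
- move=> p; rewrite /l1norm size_polyN; apply: eq_bigr => i _; by rewrite coefN.
- exact: l1normD.
- move=> p q; elim/poly_ind: p => [|p c IH]; first by rewrite !(mul0r, l1norm0).
  rewrite l1norm_cons // mulrDl; apply: le_trans (l1normD nuP _ _) _.
  rewrite mulrDl lerD ?l1norm_scale_le //.
  by rewrite -mulrA -commr_polyX mulrA l1normMX.
Qed.

Section NormDet.
Variables (R : realFieldType) (A : comNzRingType) (nu : A -> R).
Hypothesis nuP : is_ring_norm nu.

Lemma ring_norm_sum (I : Type) (r : seq I) (P : pred I) (F : I -> A) :
  nu (\sum_(i <- r | P i) F i) <= \sum_(i <- r | P i) nu (F i).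
Proof.
have [h0 h1 hN hD hM] := nuP.
elim/big_ind2: _ => [|a b c d h h'|//]; first by rewrite h0.
exact: le_trans (hD _ _) (lerD h h').
Qed.

Lemma ring_norm_prod (I : Type) (r : seq I) (F : I -> A) :
  nu (\prod_(i <- r) F i) <= \prod_(i <- r) nu (F i).
Proof.
have [h0 h1 hN hD hM] := nuP; have h := ring_norm_ge0 nuP.
elim: r => [|i r IH]; first by rewrite !big_nil.
rewrite !big_cons; apply: le_trans (hM _ _) _.
by rewrite ler_wpM2l.
Qed.

(** Leibniz expansion into [r!] signed products of [r] entries. *)
Lemma ring_norm_det (r : nat) (M : 'M[A]_r) (b : R) :
  (forall i j, nu (M i j) <= b) -> nu (\det M) <= r`!%:R * b ^+ r.
Proof.
move=> hb; have [h0 h1 hN hD hM] := nuP; have hge := ring_norm_ge0 nuP.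
have -> : r`!%:R * b ^+ r = \sum_(s : 'S_r) b ^+ r.
  by rewrite sumr_const mulr_natl card_Sn.
apply: le_trans (ring_norm_sum _ _ _) _; apply: ler_sum => s _.
apply: (@le_trans _ _ (\prod_i nu (M i (s i)))).
  case: (odd_perm s); first rewrite expr1 mulN1r hN; rewrite ?expr0 ?mul1r;
  exact: ring_norm_prod.
rewrite -[in leRHS](card_ord r) -prodr_const; apply: ler_prod => i _.
by rewrite hge hb.
Qed.

End NormDet.

Lemma abs_ring_norm (R : realFieldType) : is_ring_norm (fun x : R => `|x|).
Proof.
by split=> *; rewrite ?normr0 ?normr1 ?normrN ?ler_normD ?normrM.
Qed.

(** * Coefficient norm of multivariate polynomials *)

Section MpolyNorm.
Variables (R : realFieldType) (n : nat).
Implicit Types (p q : {mpoly R[n]}).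

Definition mnorm p : R := \sum_(m <- msupp p) `|p@_m|.

Lemma mnorm_widen (k : nat) p : (msize p <= k)%N ->
  mnorm p = \sum_(m : 'X_{1..n < k}) `|p@_m|.
Proof.
pose I : subFinType (fun m : 'X_{1..n} => (mdeg m < k)%N) := 'X_{1..n < k}.
move=> hk; rewrite /mnorm (ssrcomplements.big_mksub I) //=; first last.
- by move=> m /msize_mdeg_lt /leq_trans; apply.
- exact: msupp_uniq.
by rewrite big_rmcond //= => m /memN_msupp_eq0 ->; rewrite normr0.
Qed.

Lemma mnorm_ge0 p : 0 <= mnorm p.
Proof. by apply: sumr_ge0. Qed.

Lemma mnormD p q : mnorm (p + q) <= mnorm p + mnorm q.
Proof.
pose k := maxn (msize p) (msize q).
rewrite (@mnorm_widen k p) ?leq_maxl // (@mnorm_widen k q) ?leq_maxr //.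
rewrite (@mnorm_widen k) ?msizeD_le // -big_split; apply: ler_sum => m _.
by rewrite mcoeffD ler_normD.
Qed.

Lemma mnorm0 : mnorm 0 = 0.
Proof. by rewrite /mnorm msupp0 big_nil. Qed.

Lemma mnorm_sum (I : Type) (r : seq I) (P : pred I) (F : I -> {mpoly R[n]}) :
  mnorm (\sum_(i <- r | P i) F i) <= \sum_(i <- r | P i) mnorm (F i).
Proof.
elim/big_ind2: _ => [|a b c d h h'|//]; first by rewrite mnorm0.
exact: le_trans (mnormD _ _) (lerD h h').
Qed.

Lemma mnormZX c (m : 'X_{1..n}) : mnorm (c *: 'X_[m]) = `|c|.
Proof.
have [->|c0] := eqVneq c 0; first by rewrite scale0r mnorm0 normr0.
by rewrite /mnorm msuppMCX // big_seq1 mcoeffZ mcoeffX eqxx mulr1.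
Qed.

Lemma mnormM p q : mnorm (p * q) <= mnorm p * mnorm q.
Proof.
rewrite mpolyME; apply: le_trans (mnorm_sum _ _ _) _.
rewrite big_allpairs [mnorm p]/mnorm [mnorm q]/mnorm mulr_suml; apply: ler_sum => m _.
rewrite mulr_sumr; apply: ler_sum => m' _ /=.
by rewrite mnormZX normrM.
Qed.

Lemma mnormX (m : 'X_{1..n}) : mnorm 'X_[m] = 1.
Proof. by rewrite -['X_[m]]scale1r mnormZX normr1. Qed.

Lemma mnormC c : mnorm c%:MP = `|c|.
Proof. by rewrite -[c%:MP]mulr1 mul_mpolyC -mpolyX0 mnormZX. Qed.

Lemma mnormZ c p : mnorm (c *: p) <= `|c| * mnorm p.
Proof. by rewrite -mul_mpolyC -mnormC mnormM. Qed.

Lemma mnormN p : mnorm (- p) = mnorm p.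
Proof.
apply/eqP; rewrite eq_le; apply/andP; split.
  by rewrite -scaleN1r; apply: le_trans (mnormZ _ _) _; rewrite normrN1 mul1r.
by rewrite -{1}[p]opprK -scaleN1r; apply: le_trans (mnormZ _ _) _; rewrite normrN1 mul1r.
Qed.

Lemma mnormXn p k : mnorm (p ^+ k) <= mnorm p ^+ k.
Proof.
elim: k => [|k IH]; first by rewrite !expr0 -mpolyC1 mnormC normr1.
rewrite !exprS; apply: le_trans (mnormM _ _) _.
by rewrite ler_wpM2l // mnorm_ge0.
Qed.

Lemma meval_bound p k rho (x : 'I_n -> R) : (msize p <= k.+1)%N -> 1 <= rho ->
  (forall i, `|x i| <= rho) -> `|p.@[x]| <= mnorm p * rho ^+ k.
Proof.
move=> hk h1 hx; rewrite mevalE /mnorm mulr_suml.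
apply: le_trans (ler_norm_sum _ _ _) _.
rewrite big_seq [leRHS]big_seq; apply: ler_sum => m hm.
rewrite normrM ler_wpM2l // normr_prod.
apply: (@le_trans _ _ (rho ^+ mdeg m)); last first.
  by rewrite ler_weXn2l //; move/msize_mdeg_lt: hm; lia.
rewrite mdegE expr_sum; apply: ler_prod => i _.
by rewrite normr_ge0 normrX lerXn2r // nnegrE; apply: le_trans (hx i).
Qed.

End MpolyNorm.

(** * Elimination of critical values *)

Section Reduction.
Variables (R : realType) (S : subringClosed R) (N : nat) (G : {mpoly R[N]}) (w E : 'I_N -> nat).
Variables (K : R) (W : nat).

Definition wdeg (m : 'X_{1..N}) : nat := (\sum_i w i * m i)%N.

Local Notation pn := (l1norm (fun x : R => `|x|)).

Hypothesis w_gt0 : forall i, (0 < w i)%N.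
Hypothesis E_gt0 : forall i, (0 < E i)%N.
Hypothesis G_int : forall m, G@_m \in S.
Hypothesis K_ge1 : 1 <= K.
Hypothesis dG_norm : forall i, mnorm (G^`M(i)) <= K.
Hypothesis dG_wdeg : forall i m, m \in msupp (G^`M(i)) -> (wdeg m < w i * E i)%N.
Hypothesis G_wdeg : forall m, m \in msupp G -> (wdeg m <= W)%N.

Definition basis := {dffun forall i : 'I_N, 'I_(E i)}.
Definition bmon (b : basis) : 'X_{1..N} := [multinom (b i : nat) | i < N].

Definition critical (z : R) (y : 'I_N -> R) :=
  forall i, y i ^+ E i = - z * (G^`M(i)).@[y].

(** The polynomials [v b] in [z] serve all critical points at once; the norm bound allows one factor
    [K] per unit of weight. *)
Definition reduces (m : 'X_{1..N}) (v : basis -> {poly R}) := [/\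
  forall b, v b \is a polyOver S,
  \sum_b pn (v b) <= K ^+ wdeg m &
  forall z y, critical z y ->
    'X_[m].@[y] = \sum_b (v b).[z] * 'X_[bmon b].@[y]].

Lemma wdegD m m' : wdeg (m + m')%MM = (wdeg m + wdeg m')%N.
Proof.
by rewrite /wdeg -big_split; apply: eq_bigr => i _; rewrite mnmDE mulnDr.
Qed.

Lemma meval_msupp (p : {mpoly R[N]}) (y : 'I_N -> R) :
  p.@[y] = \sum_(m <- msupp p) p@_m * 'X_[m].@[y].
Proof. by rewrite mevalE; apply: eq_bigr => m _; rewrite mevalX. Qed.

Lemma l1norm_lincomb (r : seq 'X_{1..N}) (c : 'X_{1..N} -> R)
    (V : 'X_{1..N} -> basis -> {poly R}) B :
  (forall m, m \in r -> \sum_b pn (V m b) <= B) ->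
  \sum_b pn (\sum_(m <- r) (c m)%:P * V m b) <= (\sum_(m <- r) `|c m|) * B.
Proof.
have nP := abs_ring_norm R; have nnP := l1norm_ring_norm nP.
move=> hV.
apply: (@le_trans _ _ (\sum_b \sum_(m <- r) `|c m| * pn (V m b))).
  apply: ler_sum => b _; apply: le_trans (ring_norm_sum nnP _ _ _) _.
  by apply: ler_sum => m _; exact: l1norm_scale_le.
rewrite exchange_big mulr_suml big_seq [leRHS]big_seq; apply: ler_sum => m hm /=.
by rewrite -mulr_sumr ler_wpM2l // hV.
Qed.

(** Strong induction on the weight. If some exponent reaches [E i], the factor [y_i^(E i)] is
    replaced by [- z * d_i G], which lowers the weight by at least one and multiplies the norm by at
    most [K]. *)
Lemma reduction m : exists v, reduces m v.
Proof.
have nP := abs_ring_norm R; have nnP := l1norm_ring_norm nP.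
have [k] := ubnP (wdeg m); elim: k m => // k IH m; rewrite ltnS => hm.
have [hb|] := boolP [forall i, (m i < E i)%N].
  have hb' i : (m i < E i)%N by exact: (forallP hb i).
  pose b0 : basis := [ffun i => Ordinal (hb' i)].
  have eb : bmon b0 = m by apply/mnmP => i; rewrite mnmE ffunE.
  exists (fun b => (b == b0)%:R); split.
  - by move=> b; rewrite rpred_nat.
  - rewrite (bigD1 b0) //= eqxx big1 => [|b /negPf ->]; last by rewrite l1norm0.
    by rewrite -polyC1 l1normC // normr1 addr0 exprn_ege1.
  - move=> z y _; rewrite (bigD1 b0) //= eqxx big1 => [|b /negPf ->].
      by rewrite -polyC1 hornerC mul1r addr0 eb.
    by rewrite horner0 mul0r.
rewrite negb_forall => /existsP [i]; rewrite -leqNgt => hi.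
pose m' := (m - U_(i) *+ E i)%MM.
have em : m = (U_(i) *+ E i + m')%MM.
  apply/mnmP => j; rewrite mnmDE mulmnE mnm1E mnmBE mulmnE mnm1E.
  by case: eqP => [<-|_]; rewrite ?mul1n ?mul0n ?subn0 // subnKC.
have wm : wdeg m = (w i * E i + wdeg m')%N.
  rewrite em wdegD; congr (_ + _)%N; rewrite /wdeg (bigD1 i) //= big1 => [|j].
    by rewrite mulmnE mnm1E eqxx mul1n addn0.
  by rewrite mulmnE mnm1E eq_sym => /negPf ->; rewrite mul0n muln0.
set dG := G^`M(i).
(* Outside the support the zero family is a dummy, so that a choice function on all [nu] exists. *)
have hV nu : exists v, nu \in msupp dG -> reduces (nu + m')%MM v.
  have [hnu|_] := boolP (nu \in msupp dG); last by exists (fun=> 0).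
  have [|v hv] := IH (nu + m')%MM; last by exists v.
  by have := dG_wdeg hnu; rewrite wdegD; lia.
have [V {}hV] := boolp.choice hV.
have dG_int nu : dG@_nu \in S by rewrite mcoeff_deriv rpredMn.
exists (fun b => (- (\sum_(nu <- msupp dG) (dG@_nu)%:P * V nu b)) * 'X); split.
- move=> b; rewrite rpredM ?polyOverX // rpredN big_seq; apply: rpred_sum => nu hnu.
  by rewrite rpredM ?polyOverC //; case: (hV nu hnu).
- under eq_bigr => b _ do rewrite l1normMX //.
  have hNn : forall a, pn (- a) = pn a by case: nnP.
  under eq_bigr => b _ do rewrite hNn.
  apply: (@le_trans _ _ (mnorm dG * K ^+ (wdeg m).-1)).
    apply: l1norm_lincomb => nu hnu.
    have [_ h _] := hV nu hnu; apply: le_trans h _.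
    by rewrite ler_weXn2l //; have := dG_wdeg hnu; rewrite wdegD; lia.
  have -> : wdeg m = (wdeg m).-1.+1.
    by have := w_gt0 i; have := E_gt0 i; lia.
  rewrite exprS ler_wpM2r ?exprn_ge0 //; first exact: le_trans K_ge1.
  exact: dG_norm.
- move=> z y hy; rewrite em mpolyXD mevalM -mpolyXn rmorphXn /= mevalXU hy.
  rewrite -/dG meval_msupp [- z * _]mulr_sumr mulr_suml.
  transitivity (\sum_(nu <- msupp dG) \sum_b
      (- z * dG@_nu) * ((V nu b).[z] * 'X_[bmon b].@[y])).
    rewrite big_seq [RHS]big_seq; apply: eq_bigr => nu hnu.
    have [_ _ /(_ z y hy) h] := hV nu hnu.
    by rewrite -mulr_sumr -h mpolyXD mevalM !mulrA.
  rewrite exchange_big; apply: eq_bigr => b _ /=.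
  rewrite hornerM hornerX hornerN horner_sum -sumrN !mulr_suml; apply: eq_bigr => nu _.
  by rewrite hornerM hornerC; ring.
Qed.

Definition basis_bound : nat := (\sum_i w i * (E i).-1)%N.

Lemma bmon_wdeg b : (wdeg (bmon b) <= basis_bound)%N.
Proof.
apply: leq_sum => i _; rewrite mnmE leq_mul2l; apply/orP; right.
by have := ltn_ord (b i); lia.
Qed.

(** The matrix is multiplication by [G] in terms of the reduced monomials: at a critical point their
    values form an eigenvector with eigenvalue [G.@[y]]. *)
Lemma critical_value_matrix : exists M : 'M[{poly R}]_#|{: basis}|, [/\
  forall i j, M i j \is a polyOver S,
  forall i j, pn (M i j) <= mnorm G * K ^+ (W + basis_bound) &
  forall z y, critical z y ->
    root (char_poly (map_mx (horner_eval z) M)) G.@[y]].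
Proof.
have nP := abs_ring_norm R; have nnP := l1norm_ring_norm nP.
have [V hV] := boolp.choice reduction.
pose Mb b b' := \sum_(nu <- msupp G) (G@_nu)%:P * V (nu + bmon b)%MM b'.
have hMb b b' : pn (Mb b b') <= mnorm G * K ^+ (W + basis_bound).
  apply: le_trans (_ : \sum_b'' pn (Mb b b'') <= _).
    rewrite (bigD1 b') //= lerDl; apply: sumr_ge0 => *; exact: ring_norm_ge0 nnP _.
  apply: l1norm_lincomb => nu hnu.
  have [_ h _] := hV (nu + bmon b)%MM; apply: le_trans h _.
  by rewrite ler_weXn2l // wdegD leq_add // ?G_wdeg ?bmon_wdeg.
(* Column [j] expands [G] times the [j]-th reduced monomial, because eigenvectors are rows. *)
exists (\matrix_(i, j) Mb (enum_val j) (enum_val i)); split.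
- move=> i j; rewrite mxE; apply: rpred_sum => nu _.
  by rewrite rpredM ?polyOverC //; case: (hV (nu + bmon (enum_val j))%MM).
- by move=> i j; rewrite mxE.
move=> z y hy; rewrite -eigenvalue_root_char; apply/eigenvalueP.
exists (\row_i 'X_[bmon (enum_val i)].@[y]).
  apply/rowP => j; rewrite !mxE.
  under eq_bigr => i _ do rewrite !mxE /horner_eval.
  rewrite -(big_enum_val (A := {: basis}) (fun b : basis =>
     'X_[bmon b].@[y] * (Mb (enum_val j) b).[z])) /=.
  rewrite meval_msupp mulr_suml.
  transitivity (\sum_(nu <- msupp G) \sum_(b : basis)
      G@_nu * ((V (nu + bmon (enum_val j))%MM b).[z] * 'X_[bmon b].@[y])).
    rewrite exchange_big; apply: eq_bigr => b _ /=.
    rewrite horner_sum mulr_sumr; apply: eq_bigr => nu _.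
    by rewrite hornerM hornerC; ring.
  apply: eq_bigr => nu _.
  have [_ _ /(_ z y hy) h] := hV (nu + bmon (enum_val j))%MM.
  by rewrite -mulr_sumr -h mpolyXD mevalM mulrA.
(* The monomial 1 is reduced, so the eigenvector has an entry 1. *)
pose b0 : basis := [ffun i => Ordinal (E_gt0 i)].
apply/eqP => /rowP /(_ (enum_rank b0)); rewrite !mxE enum_rankK.
have -> : bmon b0 = 0%MM by apply/mnmP => i; rewrite mnmE ffunE mnm0E.
by rewrite mpolyX0 meval1 => /eqP; rewrite oner_eq0.
Qed.

(** Leibniz bound for [det (X - M)]: its entries have norm at most one plus the bound on those of
    [M]. *)
Definition eliminant_height : R :=
  (#|{: basis}|)`!%:R * (1 + mnorm G * K ^+ (W + basis_bound)) ^+ #|{: basis}|.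

(* The first variable of the eliminant is [z], the second one the critical value. *)
Lemma critical_value_eliminant : exists Q : {poly {poly R}}, [/\
  Q != 0, forall i, Q`_i \is a polyOver S,
  forall i, pn Q`_i <= eliminant_height &
  forall z y, critical z y -> Q.[z%:P].[G.@[y]] = 0].
Proof.
have nP := abs_ring_norm R; have nnP := l1norm_ring_norm nP.
have nnnP := l1norm_ring_norm nnP.
have [M [MS Mn Mr]] := critical_value_matrix.
pose chi := char_poly M.
pose SS := GRing.SubringClosed.clone _ (polyOver_pred S) _.
have chiS : chi \is a polyOver SS.
  rewrite /chi /char_poly /determinant; apply: rpred_sum => s _.
  rewrite rpredM ?rpred_sign //; apply: rpred_prod => i _.
  rewrite !mxE rpredB ?polyOverC; first by [].
    by rewrite rpredMn // polyOverX.
  exact: MS.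
have chin : l1norm pn chi <= eliminant_height.
  apply: (ring_norm_det nnnP) => i j; rewrite !mxE.
  have [h0 h1 hN hD hM] := nnnP.
  apply: le_trans (hD _ _) _; rewrite hN l1normC // lerD //.
  case: (i == j); first by rewrite mulr1n l1normX.
  by rewrite mulr0n h0.
exists (swapXY chi); split.
- by rewrite swapXY_eq0 monic_neq0 // char_poly_monic.
- move=> i; apply/polyOverP => j; rewrite coef_swapXY.
  have /polyOverP/(_ j) := chiS; rewrite -/(_ \in _) => /polyOverP; exact.
- move=> i; apply: le_trans chin.
  rewrite (@l1norm_widen _ _ _ nP (size chi)); last first.
    by rewrite -{2}[chi]swapXYK -sizeYE max_size_coefXY.
  apply: ler_sum => j _; rewrite coef_swapXY.
  exact: (@l1norm_coef _ _ _ nP).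
- move=> z y hy; rewrite horner_swapXY /chi map_char_poly.
  by apply/eqP; apply: Mr.
Qed.

End Reduction.

(** * Lower bounds for minima of integer polynomials *)

Section EliminantLimit.
Variable R : realType.
Local Notation pn := (l1norm (fun x : R => `|x|)).

(** Multiplied by [e^Z], with [Z] the degree in [z], the equation [Q(1/e, t) = 0] bounds the leading
    coefficient at [t] by a multiple of [e]; moving from [t] to [t0] costs another multiple of
    [e]. *)
Lemma eliminant_limit (Q : {poly {poly R}}) (t0 C : R) : 0 <= C ->
  (forall e : R, 0 < e <= 1 ->
    exists t : R, t0 <= t <= t0 + e * C /\ Q.[(e^-1)%:P].[t] = 0) ->
  (lead_coef Q).[t0] = 0.
Proof.
move=> C0 hQ; have [->|Q0] := eqVneq Q 0; first by rewrite lead_coef0 horner0.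
pose Z := (size Q).-1; have sQ : size Q = Z.+1.
  by rewrite prednK // lt0n size_poly_eq0.
have r0 : 0 <= `|t0| + C by rewrite addr_ge0.
have [B hB] := boolp.choice (fun k => horner_bounded Q`_k r0).
(* Dividing by [X - t0] gives a Lipschitz estimate near [t0]. *)
have [q hq] : exists q, lead_coef Q - ((lead_coef Q).[t0])%:P = q * ('X - t0%:P).
  by apply/factor_theorem; rewrite /root !hornerE subrr.
have [B' [B'0 hB']] := horner_bounded q r0.
pose D := \sum_(k < Z) B k + B' * C.
have D0 : 0 <= D.
  apply: addr_ge0; last by rewrite mulr_ge0 // ltW.
  apply: sumr_ge0 => k _; by case: (hB k) => /ltW.
have key (e : R) : 0 < e <= 1 -> `|(lead_coef Q).[t0]| <= e * D.
  move=> he; have [t [/andP[t1 t2] ht]] := hQ e he.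
  have /andP[e0 e1] := he.
  have eC : e * C <= C by rewrite ler_piMl.
  have tr : `|t| <= `|t0| + C.
    have := ler_norm t0; have := ler_norm (- t0); rewrite normrN ler_norml; lra.
  have h1 : `|(lead_coef Q).[t0] - (lead_coef Q).[t]| <= e * (B' * C).
    have := congr1 (fun p => p.[t]) hq; rewrite !hornerE /= => h.
    have -> : e * B' * C = B' * (e * C) by ring.
    rewrite distrC h normrM; apply: ler_pM => //; first exact: hB'.
    by rewrite ler_norml; lra.
  have h2 : `|(lead_coef Q).[t]| <= e * \sum_(k < Z) B k.
    have : \sum_(k < Z.+1) (Q`_k).[t] * e ^+ (Z - k) = 0.
      transitivity (e ^+ Z * Q.[(e^-1)%:P].[t]); last by rewrite ht mulr0.
      rewrite [Q.[_]]horner_coef horner_sum mulr_sumr sQ; apply: eq_bigr => k _.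
      rewrite hornerM horner_exp hornerC mulrCA; congr (_ * _).
      rewrite exprVn -exprB ?unitfE ?gt_eqF // -ltnS; exact: ltn_ord.
    rewrite big_ord_recr /= subnn expr0 mulr1 => /eqP.
    rewrite addrC addr_eq0 /lead_coef -/Z => /eqP ->.
    rewrite normrN mulr_sumr; apply: le_trans (ler_norm_sum _ _ _) _.
    apply: ler_sum => k _; rewrite normrM mulrC; apply: ler_pM => //.
      rewrite normrX (ger0_norm (ltW e0)) -(@prednK (Z - k)) ?subn_gt0 //.
      by rewrite exprS ger_pMr // exprn_ile1 // ltW.
    by case: (hB k) => _; apply.
  rewrite mulrDr; have := ler_normD ((lead_coef Q).[t0] - (lead_coef Q).[t]) (lead_coef Q).[t].
  rewrite subrK; lra.
apply/eqP; rewrite -normr_le0 leNgt; apply/negP => a0.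
set a := `|_| in a0 key.
(* With this [e], [a <= e * D] contradicts [e * (2 * (D + 1)) <= a]. *)
pose e := Num.min 1 (a / (2 * (D + 1))).
have D1 : 0 < 2 * (D + 1) by lra.
have e0 : 0 < e by rewrite lt_min ltr01 divr_gt0.
have /key : 0 < e <= 1 by rewrite e0 ge_min lexx.
have : e * (2 * (D + 1)) <= a.
  by rewrite -ler_pdivlMr // ge_min lexx orbT.
nra.
Qed.

Lemma horner_le_l1norm (p : {poly R}) t : 0 <= t <= 1 -> `|p.[t]| <= pn p.
Proof.
move=> /andP[t0 t1]; rewrite horner_coef; apply: le_trans (ler_norm_sum _ _ _) _.
apply: ler_sum => i _; rewrite normrM ler_piMr // normrX ger0_norm //.
exact: exprn_ile1.
Qed.

(** Once powers of the variable are divided out, the constant coefficient is a nonzero integer [c],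
    and for [t < 1] the equation bounds [|c| >= 1] by [t] times the norm of the other
    coefficients. *)
Lemma int_poly_root_ge (p : {poly R}) t : p != 0 ->
  (forall i, p`_i \is a Num.int) -> 0 < t -> p.[t] = 0 -> 1 <= t * (pn p + 1).
Proof.
have nP := abs_ring_norm R; have nnP := l1norm_ring_norm nP.
move=> p0 pZ t0; have [t1 _|t1] := leP 1 t.
  have := ring_norm_ge0 nnP p; nra.
elim/poly_ind: p p0 pZ => [|p c IH]; first by rewrite eqxx.
move=> p0 pZ; rewrite hornerMXaddC l1norm_cons //.
have cZ : c \is a Num.int.
  by have := pZ 0%N; rewrite coefD coefMX coefC /= add0r.
have [c0|c0] := eqVneq c 0.
  rewrite c0 addr0 normr0 addr0 => /eqP; rewrite mulf_eq0 (gt_eqF t0) orbF => /eqP h.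
  apply: IH => //; first by apply: contraNneq p0 => ->; rewrite c0 mul0r addr0.
  by move=> i; have := pZ i.+1; rewrite coefD coefMX coefC /= addr0.
move/eqP; rewrite addrC addr_eq0 => /eqP hc.
have c1 : 1 <= `|c| by rewrite norm_intr_ge1.
have hp : `|c| <= t * pn p.
  rewrite hc normrN normrM mulrC (gtr0_norm t0) ler_pM2l //.
  by apply: horner_le_l1norm; rewrite !ltW.
have := normr_ge0 c; nra.
Qed.

End EliminantLimit.

(** * Lower bound for a positive minimum *)

Section MinimumGap.
Variables (R : realType) (N : nat) (G : {mpoly R[N]}) (w E : 'I_N -> nat).
Variables (K : R) (W : nat) (y0 : 'I_N -> R).

Hypothesis w_gt0 : forall i, (0 < w i)%N.
Hypothesis E_odd : forall i, odd (E i).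
Hypothesis G_int : forall m, G@_m \is a Num.int.
Hypothesis K_ge1 : 1 <= K.
Hypothesis dG_norm : forall i, mnorm (G^`M(i)) <= K.
Hypothesis dG_wdeg : forall i m, m \in msupp (G^`M(i)) -> (wdeg w m < w i * E i)%N.
Hypothesis G_wdeg : forall m, m \in msupp G -> (wdeg w m <= W)%N.
Hypothesis y0_min : forall y, G.@[y0] <= G.@[y].
Hypothesis y0_gt0 : 0 < G.@[y0].

Definition perturb (e : R) : {mpoly R[N]} :=
  G + \sum_i (e / (E i).+1%:R) *: 'X_i ^+ (E i).+1.

Lemma meval_perturb e y :
  (perturb e).@[y] = G.@[y] + \sum_i e / (E i).+1%:R * y i ^+ (E i).+1.
Proof.
rewrite mevalD; congr (_ + _); rewrite raddf_sum; apply: eq_bigr => i _ /=.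
by rewrite mevalZ rmorphXn /= mevalXU.
Qed.

Lemma mderiv_perturb e y i :
  (perturb e)^`M(i).@[y] = G^`M(i).@[y] + e * y i ^+ E i.
Proof.
rewrite mderivD mevalD; congr (_ + _).
rewrite (raddf_sum (mderiv i)) raddf_sum (bigD1 i) //= big1 ?addr0 => [|j ji].
  rewrite mderivZ mevalZ mpolyXn mderivX mevalZ mulmnE mnm1E eqxx mul1n.
  have -> : (U_(i) *+ (E i).+1 - U_(i) = U_(i) *+ E i)%MM.
    by rewrite mulmSr addmK.
  by rewrite -mpolyXn rmorphXn /= mevalXU mulrA divfK // pnatr_eq0.
rewrite mderivZ mevalZ mpolyXn mderivX mevalZ mulmnE mnm1E (negPf ji).
by rewrite mul0n mul0r mulr0.
Qed.

(** Outside the box of radius [rho] a single even power already exceeds the value at the origin,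
    while [G] is positive; so the minimum over the box is global. *)
Lemma perturb_min e : 0 < e ->
  exists y, forall y', (perturb e).@[y] <= (perturb e).@[y'].
Proof.
move=> e0; pose rho := 1 + \sum_i (E i).+1%:R * G.@[fun=> 0] / e.
have G0 : 0 < G.@[fun=> 0] by apply: lt_le_trans y0_gt0 (y0_min _).
have hs i : 0 <= (E i).+1%:R * G.@[fun=> 0] / e.
  by rewrite divr_ge0 ?mulr_ge0 ?ltW.
have r0 : 1 <= rho by rewrite lerDl sumr_ge0.
have [|y [_ hy]] := @polyfun_min R _ (fun=> - rho) (fun=> rho) _ _
  (polyfun_meval (perturb e)); first by move=> _; rewrite ge0_cp ?(le_trans ler01).
exists y => y'.
have [h|] := boolP [forall i, `|y' i| <= rho].
  by apply: hy => i; rewrite -ler_norml (forallP h).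
rewrite negb_forall => /existsP[i]; rewrite -ltNge => hi.
have even j : 0 <= y' j ^+ (E j).+1 by rewrite exprn_even_ge0 //= E_odd.
apply: (@le_trans _ _ (perturb e).@[fun=> 0]).
  by apply: hy => j; rewrite oppr_le0 andbb (le_trans ler01).
rewrite !meval_perturb [X in _ + X]big1 ?addr0 => [|j _]; last by rewrite expr0n mulr0.
rewrite (bigD1 i) //=; have hG := lt_le_trans y0_gt0 (y0_min y').
have hr : 0 <= \sum_(j | j != i) e / (E j).+1%:R * y' j ^+ (E j).+1.
  by apply: sumr_ge0 => j _; rewrite mulr_ge0 // divr_ge0 // ltW.
suff : G.@[fun=> 0] <= e / (E i).+1%:R * y' i ^+ (E i).+1.
  by move=> h; apply: (le_trans h); rewrite addrCA lerDl addr_ge0 ?(ltW hG).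
have hE : 0 < e / (E i).+1%:R by rewrite divr_gt0.
rewrite -ler_pdivrMl // invf_div mulrAC.
have hri : (E i).+1%:R * G.@[fun=> 0] / e <= rho.
  by rewrite /rho (bigD1 i) //= addrCA lerDl addr_ge0 // sumr_ge0.
apply: (le_trans hri); apply: (le_trans (ltW hi)).
have -> : y' i ^+ (E i).+1 = `|y' i| ^+ (E i).+1.
  by rewrite -normrX ger0_norm.
by rewrite -[leLHS]expr1 ler_weXn2l // ltW // (le_lt_trans r0).
Qed.

(** The minimizer [y] of the perturbation is critical, and [G(y)] is at most the perturbed value at
    [y], hence at most the one at [y0]. *)
Lemma perturbed_critical_point e : 0 < e -> exists2 y, critical G E e^-1 y &
  G.@[y] <= G.@[y0] + e * \sum_i y0 i ^+ (E i).+1.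
Proof.
move=> e0; have [y hy] := perturb_min e0.
exists y.
  move=> i; have := mderiv_min (p := perturb e) (x := y) (i := i) ltr01 (fun s _ => hy _).
  by rewrite mderiv_perturb => h; apply: (mulfI (lt0r_neq0 e0));
    rewrite mulrA mulrN divff ?lt0r_neq0 // mulN1r; lra.
have even (z : 'I_N -> R) j : 0 <= z j ^+ (E j).+1 by rewrite exprn_even_ge0 //= E_odd.
have := hy y0; rewrite !meval_perturb => h.
apply: le_trans (_ : G.@[y] + \sum_i e / (E i).+1%:R * y i ^+ (E i).+1 <= _).
  by rewrite lerDl sumr_ge0 // => i _; rewrite mulr_ge0 // divr_ge0 // ltW.
apply: le_trans h _; rewrite lerD2l mulr_sumr; apply: ler_sum => i _.
by rewrite ler_wpM2r // ler_pdivrMr // ler_pMr // ler1n.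
Qed.

(** As [e] tends to 0 the critical values tend to [G.@[y0]], which is therefore a root of the
    leading coefficient in [z] of the eliminant; the bound on positive roots of integer polynomials
    concludes. *)
Lemma minimum_gap : 1 <= G.@[y0] * (eliminant_height G w E K W + 1).
Proof.
have nP := abs_ring_norm R; have nnP := l1norm_ring_norm nP.
have E_gt0 i : (0 < E i)%N by have := E_odd i; case: (E i).
have [Q [Q0 QZ Qn Qz]] := critical_value_eliminant
  (S := GRing.SubringClosed.clone _ (@Num.int_num_subdef R) _)
  w_gt0 E_gt0 G_int K_ge1 dG_norm dG_wdeg G_wdeg.
have hl : (lead_coef Q).[G.@[y0]] = 0.
  apply: (@eliminant_limit _ Q _ (\sum_i y0 i ^+ (E i).+1)).
    by apply: sumr_ge0 => i _; rewrite exprn_even_ge0 //= E_odd.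
  move=> e /andP[e0 _]; have [y hy hyG] := perturbed_critical_point e0.
  by exists G.@[y]; rewrite y0_min hyG Qz.
apply: (@le_trans _ _ (G.@[y0] * (l1norm (fun x : R => `|x|) (lead_coef Q) + 1))).
  apply: int_poly_root_ge => //; first by rewrite lead_coef_eq0.
  by move=> i; have /polyOverP := QZ (size Q).-1; apply.
by rewrite ler_pM2l // lerD2r Qn.
Qed.

End MinimumGap.

(** * Infeasible systems and slack variables *)

Section SlackVariables.
Variables (R : realType) (n J d : nat) (h : 'I_J -> {mpoly R[n]}).
Variables (B A : R) (j0 : 'I_J).

(* With these weights [G] has weight at most [4 d], which is less than the weight
   of each [y_k ^ E_k]: this makes the rewriting of monomials terminate. The
   exponents of the slack variables do not depend on [d], so the number of
   reduced monomials is only [O(d ^ n)]. *)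
Definition slack_weight (k : 'I_(n + J)) : nat :=
  match split k with inl _ => 1 | inr _ => d end.
Definition slack_exponent (k : 'I_(n + J)) : nat :=
  match split k with inl _ => (4 * d).+1 | inr _ => 5 end.

Local Notation w := slack_weight.
Local Notation E := slack_exponent.
Implicit Types (m : 'X_{1..n}) (p : {mpoly R[n]}) (q : {mpoly R[n + J]}).

Definition mnm_embed m : 'X_{1..n + J} :=
  [multinom match split k with inl i => m i | inr _ => 0%N end | k < n + J].

Definition embed p : {mpoly R[n + J]} :=
  \sum_(m <- msupp p) p@_m *: 'X_[mnm_embed m].

(** It has a zero exactly when the system [h_j >= 0] has a solution. *)
Definition slack_poly : {mpoly R[n + J]} :=
  \sum_j (embed (h j) - 'X_(rshift n j) ^+ 2) ^+ 2.

Local Notation G := slack_poly.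

Lemma split_lshift (i : 'I_n) : split (lshift J i) = inl i.
Proof. exact: (unsplitK (inl i)). Qed.

Lemma split_rshift (j : 'I_J) : split (rshift n j) = inr j.
Proof. exact: (unsplitK (inr j)). Qed.

Lemma meval_embed p y : (embed p).@[y] = p.@[fun i => y (lshift J i)].
Proof.
rewrite raddf_sum mevalE; apply: eq_bigr => m _ /=.
rewrite mevalZ mevalX big_split_ord /= [X in _ * (_ * X)]big1 => [|j _].
  by rewrite mulr1; congr (_ * _); apply: eq_bigr => i _; rewrite mnmE split_lshift.
by rewrite mnmE split_rshift expr0.
Qed.

Lemma meval_slack_poly y : G.@[y] =
  \sum_j ((h j).@[fun i => y (lshift J i)] - y (rshift n j) ^+ 2) ^+ 2.
Proof.
rewrite raddf_sum; apply: eq_bigr => j _ /=.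
by rewrite rmorphXn /= mevalB meval_embed rmorphXn /= mevalXU.
Qed.

Definition int_coeffs k (p : {mpoly R[k]}) := forall a, p@_a \is a Num.int.

Lemma int_coeffsM k (p q : {mpoly R[k]}) :
  int_coeffs p -> int_coeffs q -> int_coeffs (p * q).
Proof.
by move=> hp hq m; rewrite mcoeffM rpred_sum // => i _; rewrite rpredM ?hp ?hq.
Qed.

Lemma int_coeffs_embed p : int_coeffs p -> int_coeffs (embed p).
Proof.
move=> hp m; rewrite raddf_sum rpred_sum // => m' _ /=.
by rewrite mcoeffZ mcoeffX rpredM ?hp // rpred_nat.
Qed.

Lemma int_coeffs_slack : (forall j, int_coeffs (h j)) -> int_coeffs G.
Proof.
move=> hh m; rewrite raddf_sum rpred_sum // => j _ /=.
have hX : int_coeffs (embed (h j) - 'X_(rshift n j) ^+ 2).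
  move=> m'; rewrite mcoeffB rpredB ?int_coeffs_embed //.
  by rewrite mpolyXn mcoeffX rpred_nat.
by rewrite expr2; exact: int_coeffsM.
Qed.

Lemma mnorm_slack : (forall j, mnorm (h j) <= B) -> mnorm G <= J%:R * (B + 1) ^+ 2.
Proof.
move=> hB; apply: le_trans (mnorm_sum _ _ _) _.
rewrite mulr_natl -[in leRHS](card_ord J) -sumr_const; apply: ler_sum => j _.
apply: le_trans (mnormXn _ _) _; rewrite lerXn2r ?nnegrE ?mnorm_ge0 //.
  by rewrite addr_ge0 // (le_trans (mnorm_ge0 (h j))).
apply: le_trans (mnormD _ _) _; rewrite mnormN mpolyXn mnormX lerD2r.
apply: le_trans (mnorm_sum _ _ _) _; apply: le_trans (hB j).
by rewrite [leRHS]/mnorm; apply: ler_sum => m _; rewrite mnormZX.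
Qed.

Definition weight_le k q := forall a, a \in msupp q -> (wdeg w a <= k)%N.

Lemma weight_leD k q q' : weight_le k q -> weight_le k q' -> weight_le k (q + q').
Proof. by move=> hq hq' m /msuppD_le; rewrite mem_cat => /orP[/hq|/hq']. Qed.

Lemma weight_leN k q : weight_le k q -> weight_le k (- q).
Proof. by move=> hq m; rewrite (perm_mem (msuppN q)) => /hq. Qed.

Lemma weight_leM k k' q q' :
  weight_le k q -> weight_le k' q' -> weight_le (k + k') (q * q').
Proof.
move=> hq hq' m /msuppM_le /allpairsP[[m1 m2] /= [h1 h2 ->]].
by rewrite wdegD leq_add ?hq ?hq'.
Qed.

Lemma weight_le_sum k (I : Type) (r : seq I) (F : I -> {mpoly R[n + J]}) :
  (forall i, weight_le k (F i)) -> weight_le k (\sum_(i <- r) F i).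
Proof.
move=> hF; elim/big_ind: _ => // [m|p q]; first by rewrite msupp0.
exact: weight_leD.
Qed.

Lemma wdeg_embed m : wdeg w (mnm_embed m) = mdeg m.
Proof.
rewrite /wdeg mdegE big_split_ord /= [X in (_ + X)%N]big1 => [|j _].
  rewrite addn0; apply: eq_bigr => i _.
  by rewrite mnmE /w split_lshift mul1n.
by rewrite mnmE split_rshift muln0.
Qed.

Hypothesis d_gt0 : (0 < d)%N.
Hypothesis h_deg : forall j, (msize (h j) <= d.+1)%N.

Lemma weight_slack : weight_le (4 * d) G.
Proof.
have -> : (4 * d = 2 * d + 2 * d)%N by lia.
apply: weight_le_sum => j; rewrite expr2.
suff hj : weight_le (2 * d) (embed (h j) - 'X_(rshift n j) ^+ 2).
  exact: weight_leM.
apply: weight_leD; last first.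
  apply: weight_leN => m; rewrite mpolyXn msuppX inE => /eqP ->.
  rewrite /wdeg (bigD1 (rshift n j)) //= big1 => [|k /negPf hk].
    by rewrite mulmnE mnm1E eqxx /w split_rshift; lia.
  by rewrite mulmnE mnm1E eq_sym hk muln0.
move=> m; rewrite /embed => /msupp_sum_le /flatten_mapP [m' hm'].
move/msuppZ_le; rewrite msuppX inE => /eqP ->; rewrite wdeg_embed.
have : m' \in msupp (h j) by move: hm'; rewrite mem_filter.
by move/msize_mdeg_lt; have := h_deg j; lia.
Qed.

Lemma slack_weight_gt0 k : (0 < w k)%N.
Proof. by rewrite /w; case: split. Qed.

Lemma slack_exponent_odd k : odd (E k).
Proof. by rewrite /E; case: split => //= _; rewrite oddM. Qed.

Lemma slack_exponent_dominates k : (4 * d < w k * E k)%N.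
Proof. by rewrite /w /E; case: split => _; lia. Qed.

Lemma mcoeff_leq_wdeg k (m : 'X_{1..n + J}) : (m k <= wdeg w m)%N.
Proof.
rewrite /wdeg (bigD1 k) //=; apply: leq_trans (leq_addr _ _).
by rewrite leq_pmull // slack_weight_gt0.
Qed.

Lemma weight_deriv k : weight_le (4 * d) (G^`M(k)).
Proof.
move=> m; rewrite mcoeff_msupp mcoeff_deriv => hm.
have : (m + U_(k))%MM \in msupp G.
  by rewrite mcoeff_msupp; apply: contra hm => /eqP ->; rewrite mul0rn.
by move/weight_slack; rewrite wdegD; lia.
Qed.

(** An exponent is at most the weight of its monomial, hence at most [4 * d]. *)
Lemma mnorm_deriv k : mnorm (G^`M(k)) <= (4 * d)%:R * mnorm G.
Proof.
rewrite [G in G^`M(k)]mpolyE (raddf_sum (mderiv k)).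
apply: le_trans (mnorm_sum _ _ _) _.
rewrite /(mnorm G) mulr_sumr big_seq [leRHS]big_seq; apply: ler_sum => m hm /=.
rewrite mderivZ mderivX scalerA mnormZX normrM mulrC normr_nat ler_wpM2r //.
by rewrite ler_nat; apply: leq_trans (mcoeff_leq_wdeg k m) (weight_slack hm).
Qed.

Lemma card_slack_basis : #|{: basis E}| = ((4 * d).+1 ^ n * 5 ^ J)%N.
Proof.
rewrite card_dep_ffun /=.
rewrite (_ : foldr _ _ _ = \prod_k E k)%N.
  rewrite big_split_ord /= -[n in RHS]card_ord -[J in RHS]card_ord -!prod_nat_const.
  congr (_ * _)%N; apply: eq_bigr => i _; by rewrite /E ?split_lshift ?split_rshift.
rewrite -big_enum /= /image_mem; elim: (enum _) => [|k s IH] /=; first by rewrite big_nil.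
by rewrite big_cons IH card_ord.
Qed.

Lemma slack_basis_bound : basis_bound w E = (4 * d * (n + J))%N.
Proof.
rewrite /basis_bound big_split_ord /=.
under eq_bigr => i _ do rewrite /w /E split_lshift.
under [X in (_ + X)%N]eq_bigr => i _ do rewrite /w /E split_rshift.
by rewrite !sum_nat_const !card_ord /=; lia.
Qed.

(** Plays the role of [K]: it bounds the norms of [slack_poly] and of its partial derivatives. *)
Definition gap_constant : R := (4 * d * J)%:R * (B + 1) ^+ 2.
Definition gap_rank : nat := ((4 * d).+1 ^ n * 5 ^ J)%N.
(** Bound for [eliminant_height] with total weight [4 d + 4 d (n + J)]; one more power of
    [gap_constant] absorbs the norm of [slack_poly]. *)
Definition gap_height : R :=
  gap_rank`!%:R * (1 + gap_constant ^+ (4 * d * (n + J).+1).+1) ^+ gap_rank.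

Hypothesis h_int : forall j, int_coeffs (h j).
Hypothesis h_norm : forall j, mnorm (h j) <= B.
Hypothesis h_coercive : forall x, (h j0).@[x] = A - \sum_i x i ^+ 2.
Hypothesis h_infeasible : forall x, exists j, (h j).@[x] < 0.

(** Coercivity: a large [x] makes [h j0 = A - |x|^2] very negative and the slack only lowers it
    further; when [x] stays bounded, so do the [h j], and a large slack dominates. Hence the minimum
    over a large box is global. *)
Lemma slack_poly_min : exists y0, forall y, G.@[y0] <= G.@[y].
Proof.
pose G0 := G.@[fun=> 0].
have G_ge0 y : 0 <= G.@[y].
  by rewrite meval_slack_poly sumr_ge0 // => j _; rewrite sqr_ge0.
have G_ge y j : G0 + 1 <=
    `|(h j).@[fun i => y (lshift J i)] - y (rshift n j) ^+ 2| -> G0 <= G.@[y].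
  move=> hj; rewrite meval_slack_poly (bigD1 j) //=; apply: ler_wpDr.
    by rewrite sumr_ge0 // => i _; rewrite sqr_ge0.
  rewrite -real_normK ?num_real //; have := G_ge0 (fun=> 0); rewrite -/G0; nra.
pose rho1 : R := `|A| + G0 + 2.
have hG0 : 0 <= G0 := G_ge0 _.
have r1 : 1 <= rho1 by have := normr_ge0 A; rewrite /rho1; lra.
pose b := \sum_j mnorm (h j) * rho1 ^+ msize (h j).
have hb j (x : 'I_n -> R) : (forall i, `|x i| <= rho1) -> `|(h j).@[x]| <= b.
  move=> hx; apply: le_trans (meval_bound (leqnSn _) r1 hx) _.
  rewrite /b (bigD1 j) //= lerDl sumr_ge0 // => i _.
  by rewrite mulr_ge0 ?mnorm_ge0 // exprn_ge0 // (le_trans ler01).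
have b0 : 0 <= b.
  apply: le_trans (normr_ge0 _) (hb j0 (fun=> 0) _) => i.
  by rewrite normr0 (le_trans ler01).
pose rho2 : R := rho1 + b + G0 + 1.
have r2 : 0 <= rho2 by rewrite /rho2; lra.
have [|y0 [_ hy0]] := @polyfun_min R _ (fun=> - rho2) (fun=> rho2) _ _
  (polyfun_meval G); first by move=> _; rewrite ge0_cp.
exists y0 => y; have [hy|] := boolP [forall k, `|y k| <= rho2].
  by apply: hy0 => k; rewrite -ler_norml (forallP hy).
rewrite negb_forall => /existsP[k]; rewrite -ltNge => hk.
apply: (@le_trans _ _ G0); first by apply: hy0 => i; rewrite oppr_le0 andbb.
have sq (t r : R) : 1 <= r -> r < `|t| -> r <= t ^+ 2.
  move=> h1 h2; rewrite -real_normK ?num_real //; nra.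
have [hx|] := boolP [forall i, `|y (lshift J i)| <= rho1]; last first.
  rewrite negb_forall => /existsP[i]; rewrite -ltNge => /(sq _ _ r1) hi.
  apply: (G_ge y j0); rewrite h_coercive (bigD1 i) //=.
  have hs : 0 <= \sum_(i0 < n | i0 != i) y (lshift J i0) ^+ 2.
    by apply: sumr_ge0 => i0 _; rewrite sqr_ge0.
  rewrite -normrN; apply: le_trans (ler_norm _).
  have := ler_norm A; have := sqr_ge0 (y (rshift n j0)); rewrite /rho1 in hi; lra.
case: (split_ordP k) hk => [i ->|j -> hk].
  by have := forallP hx i; rewrite /rho2; lra.
have {}hk : rho2 <= y (rshift n j) ^+ 2 by apply: sq => //; rewrite /rho2; lra.
apply: (G_ge y j); rewrite -normrN; apply: le_trans (ler_norm _).
have := hb j _ (fun i => forallP hx i); have := ler_norm ((h j).@[fun i => y (lshift J i)]).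
by rewrite /rho2 in hk; lra.
Qed.

(** Infeasibility makes the minimum of [slack_poly] positive, so [minimum_gap] applies; the best
    slacks at [x] leave exactly the negative parts of the [h j]. *)
Theorem infeasible_gap x :
  1 <= (gap_height + 1) * \sum_j Num.min ((h j).@[x]) 0 ^+ 2.
Proof.
have [y0 hy0] := slack_poly_min.
have B0 : 0 <= B := le_trans (mnorm_ge0 _) (h_norm j0).
have J0 : (0 < J)%N by case: (J) j0 => [[]|].
have hK : mnorm G <= gap_constant.
  apply: le_trans (mnorm_slack h_norm) _.
  rewrite ler_wpM2r ?sqr_ge0 // ler_nat; nia.
have K1 : 1 <= gap_constant.
  rewrite /gap_constant; apply: (@le_trans _ _ (1 * 1)); first by rewrite mulr1.
  apply: ler_pM => //; first by rewrite ler1n; nia.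
  by rewrite exprn_ege1 // lerDr.
have dK i : mnorm (G^`M(i)) <= gap_constant.
  apply: le_trans (mnorm_deriv i) _.
  rewrite /gap_constant (natrM _ (4 * d)%N J) -mulrA ler_wpM2l //; exact: mnorm_slack.
have pos : 0 < G.@[y0].
  rewrite meval_slack_poly; have [j hj] := h_infeasible (fun i => y0 (lshift J i)).
  rewrite (bigD1 j) //=; apply: ltr_wpDr.
    by rewrite sumr_ge0 // => i _; rewrite sqr_ge0.
  rewrite exprn_even_gt0 //= subr_eq0; apply/eqP => e.
  by have := sqr_ge0 (y0 (rshift n j)); rewrite -e leNgt hj.
have := minimum_gap slack_weight_gt0 slack_exponent_odd (int_coeffs_slack h_int)
  K1 dK (fun i a ha => leq_ltn_trans (weight_deriv ha) (slack_exponent_dominates i))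
  weight_slack hy0 pos.
rewrite /eliminant_height card_slack_basis -/gap_rank slack_basis_bound.
move/le_trans; apply; rewrite mulrC.
(* Here [s_j^2 = max h_j 0], so that [h_j - s_j^2 = min h_j 0]. *)
pose y k := match split k with inl i => x i
  | inr j => Num.sqrt (Num.max ((h j).@[x]) 0) end.
have hy : G.@[y] = \sum_j Num.min ((h j).@[x]) 0 ^+ 2.
  rewrite meval_slack_poly; apply: eq_bigr => j _; congr (_ ^+ 2).
  rewrite {2}/y split_rshift sqr_sqrtr ?le_max ?lexx ?orbT //.
  rewrite (meval_eq (v2 := x)) => [|i]; last by rewrite /y split_lshift.
  by case: leP; rewrite ?subr0 ?subrr.
apply: ler_pM.
- rewrite addr_ge0 // mulr_ge0 // exprn_ge0 // addr_ge0 // mulr_ge0 ?mnorm_ge0 //.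
  by rewrite exprn_ge0 // (le_trans ler01).
- exact: ltW.
- rewrite lerD2r /gap_height ler_wpM2l //; apply: lerXn2r; rewrite ?nnegrE.
  + by rewrite addr_ge0 // mulr_ge0 ?mnorm_ge0 // exprn_ge0 // (le_trans ler01).
  + by rewrite addr_ge0 // exprn_ge0 // (le_trans ler01).
  rewrite lerD2l exprS mulnS; apply: ler_pM => //; first exact: mnorm_ge0.
  by rewrite exprn_ge0 // (le_trans ler01).
by rewrite -hy hy0.
Qed.

End SlackVariables.

(** * Sums of squares and Bernstein certificates *)

Section SumsOfSquares.
Variables (R : realType) (n : nat).
Implicit Types (p q s : {mpoly R[n]}).

Lemma mpoly_eval_inj p q : (forall x, p.@[x] = q.@[x]) -> p = q.
Proof.
move=> h; apply/eqP; rewrite -subr_eq0; apply/eqP.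
apply: (@mpoly_eq0_cube _ _ _ (fun=> 0) 1) => // y _.
by rewrite mevalB h subrr.
Qed.

Lemma msizeM_bound a b p q : (msize p <= a.+1)%N -> (msize q <= b.+1)%N ->
  (msize (p * q) <= (a + b).+1)%N.
Proof.
move=> hp hq; have [->|p0] := eqVneq p 0; first by rewrite mul0r msize0.
have [->|q0] := eqVneq q 0; first by rewrite mulr0 msize0.
by rewrite msizeM //; move: (msize p) (msize q) hp hq; lia.
Qed.

Lemma msizeD_bound a p q : (msize p <= a)%N -> (msize q <= a)%N ->
  (msize (p + q) <= a)%N.
Proof. by move=> hp hq; apply: leq_trans (msizeD_le _ _) _; rewrite geq_max hp. Qed.

Lemma msize_sum_bound a (I : Type) (r : seq I) (P : pred I) (F : I -> {mpoly R[n]}) :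
  (forall i, P i -> msize (F i) <= a)%N -> (msize (\sum_(i <- r | P i) F i) <= a)%N.
Proof.
move=> h; elim/big_ind: _ => // [|p q]; first by rewrite msize0.
exact: msizeD_bound.
Qed.

Lemma msizeX_bound a p k : (msize p <= a.+1)%N -> (msize (p ^+ k) <= (k * a).+1)%N.
Proof.
move=> hp; elim: k => [|k IH]; first by rewrite expr0 msize1.
by rewrite exprS mulSn msizeM_bound.
Qed.

Lemma msizeC_le (c : R) : (msize (c%:MP : {mpoly R[n]}) <= 1)%N.
Proof. by rewrite msizeC; case: (c != 0). Qed.

Lemma sos0 : is_sos (0 : {mpoly R[n]}).
Proof. by exists [::]; rewrite big_nil. Qed.

Lemma sos_sqr p : is_sos (p ^+ 2).
Proof. by exists [:: p]; rewrite big_seq1. Qed.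

Lemma sosD p q : is_sos p -> is_sos q -> is_sos (p + q).
Proof. by move=> [s ->] [t ->]; exists (s ++ t); rewrite big_cat. Qed.

Lemma sos_sum (I : Type) (r : seq I) (P : pred I) (F : I -> {mpoly R[n]}) :
  (forall i, P i -> is_sos (F i)) -> is_sos (\sum_(i <- r | P i) F i).
Proof. by move=> h; elim/big_ind: _ => //; [exact: sos0|exact: sosD]. Qed.

Lemma sosM p q : is_sos p -> is_sos q -> is_sos (p * q).
Proof.
move=> [s ->] [t ->]; exists [seq u * v | u <- s, v <- t].
rewrite big_allpairs_dep mulr_suml; apply: eq_bigr => u _.
by rewrite mulr_sumr; apply: eq_bigr => v _; rewrite exprMn.
Qed.

Lemma sosC (c : R) : 0 <= c -> is_sos (c%:MP : {mpoly R[n]}).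
Proof.
move=> c0; have -> : c%:MP = (Num.sqrt c)%:MP ^+ 2 :> {mpoly R[n]}.
  by rewrite -rmorphXn /= sqr_sqrtr.
exact: sos_sqr.
Qed.

Lemma sosZ c p : 0 <= c -> is_sos p -> is_sos (c *: p).
Proof. by move=> c0 hp; rewrite -mul_mpolyC; apply: sosM => //; exact: sosC. Qed.

Lemma sos_ge0 p x : is_sos p -> 0 <= p.@[x].
Proof.
move=> [s ->]; rewrite raddf_sum sumr_ge0 // => q _ /=.
by rewrite rmorphXn sqr_ge0.
Qed.

Variable h : {mpoly R[n]}.
Hypothesis h_deg : (msize h <= 3)%N.

(* The quadratic module of a single [h] is closed under products, because
   [h ^+ 2] is a square. *)
Definition in_preorder (D : nat) p := exists s0 s1, [/\ is_sos s0, is_sos s1,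
  (msize s0 <= D.+1)%N, (msize s1 <= D.+1)%N & p = s0 + s1 * h].

Lemma in_preorder_le D D' p : (D <= D')%N -> in_preorder D p -> in_preorder D' p.
Proof.
move=> hD [s0 [s1 [? ? h0 h1 ->]]]; exists s0, s1; split=> //.
  exact: leq_trans h0 _.
exact: leq_trans h1 _.
Qed.

Lemma in_preorder_sos D p : is_sos p -> (msize p <= D.+1)%N -> in_preorder D p.
Proof.
by move=> sp hp; exists p, 0; split; rewrite ?msize0 ?mul0r ?addr0 //; exact: sos0.
Qed.

Lemma in_preorderD D p q : in_preorder D p -> in_preorder D q -> in_preorder D (p + q).
Proof.
move=> [s0 [s1 [? ? ? ? ->]]] [t0 [t1 [? ? ? ? ->]]].
exists (s0 + t0), (s1 + t1); split; [exact: sosD|exact: sosD| | |].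
- exact: msizeD_bound.
- exact: msizeD_bound.
- by rewrite mulrDl addrACA.
Qed.

Lemma in_preorder_sum D (I : Type) (r : seq I) (P : pred I) (F : I -> {mpoly R[n]}) :
  (forall i, P i -> in_preorder D (F i)) -> in_preorder D (\sum_(i <- r | P i) F i).
Proof.
move=> hF; elim/big_ind: _ => //; last exact: in_preorderD.
by apply: in_preorder_sos; [exact: sos0|rewrite msize0].
Qed.

(** The [4] pays for [h^2], which goes into the sum-of-squares part. *)
Lemma in_preorderM D D' p q : in_preorder D p -> in_preorder D' q ->
  in_preorder (D + D' + 4) (p * q).
Proof.
move=> [s0 [s1 [s0s s1s h0 h1 ->]]] [t0 [t1 [t0s t1s k0 k1 ->]]].
exists (s0 * t0 + s1 * t1 * h ^+ 2), (s0 * t1 + s1 * t0); split.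
- by apply: sosD; [|apply: sosM; [|exact: sos_sqr]]; apply: sosM.
- by apply: sosD; apply: sosM.
- apply: msizeD_bound; first by apply: leq_trans (msizeM_bound h0 k0) _; lia.
  exact: msizeM_bound (msizeM_bound h1 k1) (msizeX_bound 2 h_deg).
- apply: msizeD_bound; first by apply: leq_trans (msizeM_bound h0 k1) _; lia.
  by apply: leq_trans (msizeM_bound h1 k0) _; lia.
- ring.
Qed.

Lemma in_preorderZ D c p : 0 <= c -> in_preorder D p -> in_preorder D (c *: p).
Proof.
move=> c0 [s0 [s1 [? ? h0 h1 ->]]]; exists (c *: s0), (c *: s1).
split; [exact: sosZ|exact: sosZ| | |by rewrite scalerDr scalerAl].
  exact: leq_trans (msizeZ_le _ _) h0.
exact: leq_trans (msizeZ_le _ _) h1.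
Qed.

Lemma in_preorder_exp D p k : in_preorder D p -> in_preorder (k * (D + 4)) (p ^+ k).
Proof.
move=> hp; elim: k => [|k IH].
  by rewrite expr0; apply: in_preorder_sos; rewrite ?msize1 // -(expr1n _ 2); exact: sos_sqr.
rewrite exprS; apply: in_preorder_le (in_preorderM hp IH); lia.
Qed.

Lemma in_preorder_prod D (I : Type) (r : seq I) (F : I -> {mpoly R[n]}) :
  (forall i, in_preorder D (F i)) ->
  in_preorder (size r * (D + 4)) (\prod_(i <- r) F i).
Proof.
move=> hF; elim: r => [|i r IH].
  by rewrite big_nil; apply: in_preorder_sos; rewrite ?msize1 // -(expr1n _ 2); exact: sos_sqr.
rewrite big_cons /= mulSn; apply: in_preorder_le (in_preorderM (hF i) IH); lia.
Qed.

End SumsOfSquares.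

(** * Bernstein expansions in one variable *)

Section Bernstein.
Variable R : realFieldType.

Definition bernstein_factor (L j i : nat) : R := (j - i)%:R / (L - i)%:R.

(** Equals [C(j, a) / C(L, a)] for [a <= L]; the truncated subtraction makes it vanish for
    [j < a]. *)
Definition bernstein_ratio (L a j : nat) : R := \prod_(i < a) bernstein_factor L j i.

(** The case [a = 0] is the binomial formula; each further factor [u] raises [L] and [j] by one,
    with [C(L, j) = C(L+1, j+1) * (j+1) / (L+1)]. *)
Lemma exp_bernstein (u v : R) L a : u + v = 1 -> (a <= L)%N ->
  u ^+ a = \sum_(j < L.+1)
    bernstein_ratio L a j * ('C(L, j)%:R * (u ^+ j * v ^+ (L - j))).
Proof.
move=> uv; elim: a L => [|a IH] L aL.
  transitivity ((v + u) ^+ L); first by rewrite addrC uv expr1n.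
  rewrite exprDn; apply: eq_bigr => j _.
  by rewrite /bernstein_ratio big_ord0 mul1r mulr_natl mulrC.
case: L aL => // L aL; rewrite exprS (IH L) // [RHS]big_ord_recl /=.
have -> : bernstein_ratio L.+1 a.+1 0 = 0.
  by rewrite /bernstein_ratio big_ord_recl /bernstein_factor sub0n !mul0r.
rewrite mul0r add0r mulr_sumr.
apply: eq_bigr => j _; rewrite /bump /= add1n subSS.
have -> : bernstein_ratio L.+1 a.+1 j.+1 =
    (j.+1%:R / L.+1%:R) * bernstein_ratio L a j.
  by rewrite /bernstein_ratio big_ord_recl {1}/bernstein_factor !subn0.
have hC : 'C(L, j)%:R = 'C(L.+1, j.+1)%:R * (j.+1%:R / L.+1%:R) :> R.
  rewrite mulrA -natrM mulnC -mul_bin_diag natrM mulrAC divff ?mul1r //.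
  by rewrite pnatr_eq0.
rewrite hC exprS; ring.
Qed.

(** Telescoping: one factor is exchanged at a time. *)
Lemma prod_sub_bound (I : Type) (r : seq I) (x y : I -> R) :
  (forall i, 0 <= x i <= 1) -> (forall i, 0 <= y i <= 1) ->
  `|\prod_(i <- r) x i - \prod_(i <- r) y i| <= \sum_(i <- r) `|x i - y i|.
Proof.
move=> hx hy; elim: r => [|i r IH]; first by rewrite !big_nil subrr normr0.
rewrite !big_cons.
have -> : x i * \prod_(j <- r) x j - y i * \prod_(j <- r) y j =
    (x i - y i) * \prod_(j <- r) x j + y i * (\prod_(j <- r) x j - \prod_(j <- r) y j).
  by ring.
apply: le_trans (ler_normD _ _) _; rewrite !normrM; apply: lerD.
  rewrite ler_piMr // normr_prod; apply: le_trans (_ : \prod_(j <- r) 1 <= _); last by rewrite big1.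
  apply: ler_prod => j _; rewrite normr_ge0 ger0_norm; by case/andP: (hx j).
apply: le_trans IH; rewrite ler_piMl // ger0_norm; by case/andP: (hy i).
Qed.

Lemma bernstein_factor_itv (L i j : nat) : (i < L)%N -> (j <= L)%N ->
  0 <= bernstein_factor L j i <= 1.
Proof.
rewrite /bernstein_factor.
move=> iL jL; have Li : (0 : R) < (L - i)%:R by rewrite ltr0n subn_gt0.
by rewrite divr_ge0 // ler_pdivrMr // mul1r ler_nat leq_sub2r.
Qed.

Lemma bernstein_ratio_itv L a j : (a <= L)%N -> (j <= L)%N ->
  0 <= bernstein_ratio L a j <= 1.
Proof.
move=> aL jL; apply/andP; split.
  by apply: prodr_ge0 => i _; rewrite /bernstein_factor divr_ge0.
apply: le_trans (_ : \prod_(i < a) 1 <= _); last by rewrite big1.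
by apply: ler_prod => i _; apply: bernstein_factor_itv; rewrite ?(leq_trans (ltn_ord i)).
Qed.

(** Each of the [a] factors [(j - i) / (L - i)] lies within [i / L <= a / L] of [j / L]. *)
Lemma bernstein_ratio_approx L a j : (a <= L)%N -> (j <= L)%N -> (0 < L)%N ->
  `|bernstein_ratio L a j - (j%:R / L%:R) ^+ a| <= (a ^ 2)%:R / L%:R.
Proof.
move=> aL jL L0; have L0' : 0 < L%:R :> R by rewrite ltr0n.
pose t : R := j%:R / L%:R.
have -> : (j%:R / L%:R) ^+ a = \prod_(i < a) t by rewrite prodr_const card_ord.
rewrite /bernstein_ratio.
have hx (i : 'I_a) : 0 <= bernstein_factor L j i <= 1.
  by apply: bernstein_factor_itv; rewrite ?(leq_trans (ltn_ord i)).
have hy (i : 'I_a) : 0 <= t <= 1.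
  by rewrite /t divr_ge0 // ler_pdivrMr // mul1r ler_nat.
apply: le_trans (prod_sub_bound _ hx hy) _.
apply: le_trans (_ : \sum_(i < a) a%:R / L%:R <= _); last first.
  by rewrite sumr_const card_ord -mulnn natrM -mulrA [leRHS]mulr_natl.
apply: ler_sum => i _; have iL : (i < L)%N := leq_trans (ltn_ord i) aL.
have Li : 0 < (L - i)%:R :> R by rewrite ltr0n subn_gt0.
have ha : i%:R / L%:R <= a%:R / L%:R :> R.
  by rewrite ler_pM2r ?invr_gt0 // ler_nat ltnW.
have hj : 0 <= j%:R / L%:R :> R by rewrite divr_ge0.
rewrite /t /bernstein_factor ler_norml {hx hy}; have [ij|ji] := leqP i j; last first.
  have -> : (j - i = 0)%N by apply/eqP; rewrite subn_eq0 ltnW.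
  have : j%:R / L%:R <= i%:R / L%:R :> R.
    by rewrite ler_pM2r ?invr_gt0 // ler_nat ltnW.
  rewrite mul0r; lra.
have h1 : (j - i)%:R / L%:R <= (j - i)%:R / (L - i)%:R :> R.
  by rewrite ler_wpM2l // lef_pV2 ?posrE // ler_nat leq_subr.
have h2 : (j - i)%:R / (L - i)%:R <= j%:R / L%:R :> R.
  rewrite ler_pdivrMr // mulrAC ler_pdivlMr // -!natrM ler_nat.
  by rewrite mulnBl mulnBr leq_sub2l // mulnC leq_mul2l jL orbT.
have h3 : (j - i)%:R / L%:R = j%:R / L%:R - i%:R / L%:R :> R.
  by rewrite natrB // mulrBl.
lra.
Qed.

End Bernstein.

Section AffineSubstitution.
Variables (R : realFieldType) (n k : nat).

Lemma msize_comp_affine (p : {mpoly R[n]}) (lq : n.-tuple {mpoly R[k]}) D :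
  (forall i, msize (tnth lq i) <= 2)%N -> (msize p <= D.+1)%N ->
  (msize (p \mPo lq) <= D.+1)%N.
Proof.
move=> hq hp; rewrite comp_mpolyE big_seq.
have hX (q : {mpoly R[k]}) e : (msize q <= 2)%N -> (msize (q ^+ e) <= e.+1)%N.
  move=> hq2; elim: e => [|e IH]; first by rewrite expr0 msize1.
  rewrite exprS; have [->|q0] := eqVneq q 0; first by rewrite mul0r msize0.
  have [->|qe] := eqVneq (q ^+ e) 0; first by rewrite mulr0 msize0.
  by rewrite msizeM //; move: (msize q) (msize (q ^+ e)) hq2 IH; lia.
elim/big_ind: _ => [|a b ha hb|m hm]; first by rewrite msize0.
  by apply: leq_trans (msizeD_le _ _) _; rewrite geq_max ha.
apply: leq_trans (msizeZ_le _ _) _.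
have : (mdeg m < D.+1)%N by apply: leq_trans (msize_mdeg_lt hm) hp.
apply: leq_trans; rewrite mdegE.
elim/big_ind2: _ => [|a a' b b' ha hb|i _]; [by rewrite msize1| |exact: hX].
have [->|a0] := eqVneq a 0; first by rewrite mul0r msize0.
have [->|b0] := eqVneq b 0; first by rewrite mulr0 msize0.
by rewrite msizeM //; move: (msize a) (msize b) ha hb; lia.
Qed.

Lemma mnorm_comp_affine (p : {mpoly R[n]}) (lq : n.-tuple {mpoly R[k]}) D kappa :
  1 <= kappa -> (forall i, mnorm (tnth lq i) <= kappa) -> (msize p <= D.+1)%N ->
  mnorm (p \mPo lq) <= mnorm p * kappa ^+ D.
Proof.
move=> k1 hq hp; rewrite comp_mpolyE; apply: le_trans (mnorm_sum _ _ _) _.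
rewrite [mnorm p]/mnorm mulr_suml big_seq [leRHS]big_seq; apply: ler_sum => m hm.
apply: le_trans (mnormZ _ _) _; rewrite ler_wpM2l //.
have hm' : (mdeg m <= D)%N by rewrite -ltnS; apply: leq_trans (msize_mdeg_lt hm) hp.
apply: (@le_trans _ _ (kappa ^+ mdeg m)); last by rewrite ler_weXn2l.
rewrite mdegE expr_sum.
have k0 : 0 <= kappa := le_trans ler01 k1.
suff : mnorm (\prod_i tnth lq i ^+ m i) <= \prod_i kappa ^+ m i /\
   0 <= \prod_(i < n) kappa ^+ m i by case.
elim/big_ind2: _ => [|a a' b b' [ha ha'] [hb hb']|i _].
- by rewrite -mpolyC1 mnormC normr1.
- split; last exact: mulr_ge0.
  by apply: le_trans (mnormM _ _) _; apply: ler_pM; rewrite ?mnorm_ge0.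
split; last exact: exprn_ge0.
by apply: le_trans (mnormXn _ _) _; rewrite lerXn2r ?nnegrE ?mnorm_ge0.
Qed.

End AffineSubstitution.

(** * Certificates of positivity on a box *)

Section BoxCertificate.
Variables (R : realType) (n N : nat).

Definition ball_poly : {mpoly R[n]} := N%:R - \sum_(i < n) 'X_i ^+ 2.
Definition box_radius : R := N.+1%:R / 2.

Local Notation M := box_radius.
Local Notation T := (in_preorder ball_poly).

Lemma box_radius_gt0 : 0 < M.
Proof. by rewrite divr_gt0. Qed.

Lemma msize_ball_poly : (msize ball_poly <= 3)%N.
Proof.
apply: msizeD_bound; first by rewrite -mpolyC_nat (leq_trans (msizeC_le _ _)).
rewrite msizeN; apply: msize_sum_bound => i _.
by rewrite mpolyXn msizeX mdegMn mdeg1.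
Qed.

Lemma meval_ball_poly x : ball_poly.@[x] = N%:R - \sum_i x i ^+ 2.
Proof.
rewrite mevalB -mpolyC_nat mevalC; congr (_ - _); rewrite raddf_sum.
by apply: eq_bigr => i _ /=; rewrite rmorphXn /= mevalXU.
Qed.

(* [2 (M + s x_i) = (x_i + s)^2 + \sum_(j != i) x_j^2 + (N - |x|^2)] for
   [s = 1] and [s = -1]. *)
Lemma box_face_in_preorder (s : R) i : s ^+ 2 = 1 -> T 2 (M%:MP + s *: 'X_i).
Proof.
move=> s2.
exists (2^-1 *: (('X_i + s%:MP) ^+ 2 + \sum_(j | j != i) 'X_j ^+ 2)), (2^-1)%:MP.
have hX j : (msize ('X_j : {mpoly R[n]}) <= 2)%N by rewrite msizeX mdeg1.
split.
- apply: sosZ; rewrite ?invr_ge0 //; apply: sosD; first exact: sos_sqr.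
  by apply: sos_sum => j _; exact: sos_sqr.
- by apply: sosC; rewrite invr_ge0.
- apply: leq_trans (msizeZ_le _ _) _; apply: msizeD_bound.
    apply: (@msizeX_bound _ _ 1 _ 2); apply: msizeD_bound => //.
    by rewrite (leq_trans (msizeC_le _ _)).
  by apply: msize_sum_bound => j _; apply: (@msizeX_bound _ _ 1 _ 2).
- by rewrite (leq_trans (msizeC_le _ _)).
apply: mpoly_eval_inj => x.
rewrite !mevalD mevalC !mevalZ mevalM mevalC meval_ball_poly !mevalD.
rewrite rmorphXn /= !mevalD mevalC mevalXU raddf_sum /= [X in N%:R - X](bigD1 i) //=.
under eq_bigr => j _ do rewrite rmorphXn /= mevalXU.
have -> : (x i + s) ^+ 2 = x i ^+ 2 + 2 * s * x i + 1.
  by rewrite -[X in _ = _ + X]s2; ring.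
rewrite /M -natr1; by set S := \sum_(_ | _) _; field.
Qed.

Hypothesis N_gt0 : (0 < N)%N.

(** Scaled so that two opposite faces add up to 1, as the Bernstein basis requires. *)
Definition lower_face i : {mpoly R[n]} := (2 * M)^-1 *: (M%:MP + 1 *: 'X_i).
Definition upper_face i : {mpoly R[n]} := (2 * M)^-1 *: (M%:MP + (-1) *: 'X_i).

Definition bernstein_poly L (b : {ffun 'I_n -> 'I_L.+1}) : {mpoly R[n]} :=
  \prod_i ('C(L, b i)%:R *: (lower_face i ^+ b i * upper_face i ^+ (L - b i))).

Lemma bernstein_in_preorder L (b : {ffun 'I_n -> 'I_L.+1}) :
  T (n * (6 * L + 8)) (bernstein_poly b).
Proof.
have hM : 0 <= (2 * M)^-1 by rewrite invr_ge0 mulr_ge0 // ltW // box_radius_gt0.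
have := @in_preorder_prod R n ball_poly msize_ball_poly (6 * L + 4) 'I_n (index_enum _)
  (fun i => 'C(L, b i)%:R *: (lower_face i ^+ b i * upper_face i ^+ (L - b i))).
have -> : (size (index_enum 'I_n) * (6 * L + 4 + 4) = n * (6 * L + 8))%N.
  by rewrite /index_enum -enumT size_enum_ord -addnA.
apply=> i; apply: in_preorderZ => //.
have hb : (b i <= L)%N by rewrite -ltnS.
have -> : (6 * L + 4 = b i * (2 + 4) + (L - b i) * (2 + 4) + 4)%N.
  by move: (nat_of_ord (b i)) hb => c; lia.
apply: (in_preorderM msize_ball_poly); apply: (in_preorder_exp msize_ball_poly);
  apply: in_preorderZ => //; apply: box_face_in_preorder.
  by rewrite expr1n.
by rewrite sqrrN expr1n.
Qed.

(** After transport to the unit cube, the Bernstein coefficients differ from the values at the grid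
    points by at most [mnorm q * D^2 / L <= c]; these values are at least [c], so the coefficients
    are nonnegative. *)
Lemma box_certificate (p : {mpoly R[n]}) D L c : (msize p <= D.+1)%N ->
  (forall x, (forall i, `|x i| <= M) -> c <= p.@[x]) -> (D <= L)%N -> (0 < L)%N ->
  mnorm p * (3 * M) ^+ D * (D ^ 2)%:R <= c * L%:R ->
  T (n * (6 * L + 8)) p.
Proof.
move=> hD hp DL L0 hL; have M0 := box_radius_gt0.
have M1 : 1 <= M by rewrite /M ler_pdivlMr // mul1r ler_nat.
have L0' : 0 < L%:R :> R by rewrite ltr0n.
(* Maps [[0, 1]^n] onto the box; the norm [2 M + M] of a coordinate explains the factor
   [(3 M)^D]. *)
pose lq := [tuple (2 * M) *: ('X_i : {mpoly R[n]}) - M%:MP | i < n].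
pose q := p \mPo lq.
have q_eval y : q.@[y] = p.@[fun i => 2 * M * y i - M].
  rewrite comp_mpoly_meval; apply: meval_eq => i.
  by rewrite tnth_mktuple mevalB mevalZ mevalXU mevalC.
have q_deg : (msize q <= D.+1)%N.
  apply: msize_comp_affine => // i; rewrite tnth_mktuple; apply: msizeD_bound.
    by apply: leq_trans (msizeZ_le _ _) _; rewrite msizeX mdeg1.
  by rewrite msizeN (leq_trans (msizeC_le _ _)).
have q_norm : mnorm q <= mnorm p * (3 * M) ^+ D.
  apply: mnorm_comp_affine => // [|i]; first by lra.
  rewrite tnth_mktuple; apply: le_trans (mnormD _ _) _.
  rewrite mnormN mnormC mnormZX !ger0_norm; lra.
pose coef (b : {ffun 'I_n -> 'I_L.+1}) :=
  \sum_(m <- msupp q) q@_m * \prod_i bernstein_ratio R L (m i) (b i).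
have degm m i : m \in msupp q -> (m i <= D)%N.
  move/msize_mdeg_lt => h; have : (mdeg m <= D)%N by lia.
  by apply: leq_trans; rewrite mdegE (bigD1 i) //= leq_addr.
have hb (b : {ffun 'I_n -> 'I_L.+1}) i : (b i <= L)%N by rewrite -ltnS.
have coef_ge0 b : 0 <= coef b.
  pose y i : R := (b i)%:R / L%:R.
  have hc : c <= q.@[y].
    rewrite q_eval; apply: hp => i; rewrite ler_norml.
    have : 0 <= y i <= 1.
      by rewrite /y divr_ge0 // ler_pdivrMr // mul1r ler_nat hb.
    by move: (y i) => t /andP[]; clear -M0; nra.
  have : `|coef b - q.@[y]| <= c; last by rewrite ler_norml; lra.
  rewrite mevalE /coef -sumrB; apply: le_trans (ler_norm_sum _ _ _) _.
  apply: le_trans (_ : \sum_(m <- msupp q) `|q@_m| * ((D ^ 2)%:R / L%:R) <= _); last first.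
    rewrite -mulr_suml mulrA ler_pdivrMr //; apply: le_trans hL.
    by rewrite ler_wpM2r.
  rewrite big_seq [leRHS]big_seq; apply: ler_sum => m hm.
  rewrite -mulrBr normrM ler_wpM2l //.
  have y01 i : 0 <= y i <= 1.
    by rewrite /y divr_ge0 // ler_pdivrMr // mul1r ler_nat hb.
  apply: le_trans (prod_sub_bound _ _ _) _.
  - by move=> i; apply: bernstein_ratio_itv; rewrite ?hb // (leq_trans (degm m i hm)).
  - by move=> i; have /andP[a1 a2] := y01 i; rewrite exprn_ge0 //= exprn_ile1.
  apply: le_trans (_ : \sum_i (m i ^ 2)%:R / L%:R <= _).
    apply: ler_sum => i _; apply: bernstein_ratio_approx => //.
    by rewrite (leq_trans (degm m i hm)).
  rewrite -mulr_suml ler_pM2r ?invr_gt0 // -natr_sum ler_nat.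
  have hmD : (mdeg m <= D)%N by have := msize_mdeg_lt hm; lia.
  (* [sum_i m_i^2 <= (sum_i m_i)^2 <= D^2]. *)
  apply: leq_trans (_ : (\sum_i m i * mdeg m <= _)%N).
    apply: leq_sum => i _; rewrite -mulnn leq_mul2l; apply/orP; right.
    by rewrite mdegE (bigD1 i) //= leq_addr.
  by rewrite -big_distrl -mdegE /= -mulnn leq_mul.
have -> : p = \sum_b coef b *: bernstein_poly b.
  apply: mpoly_eval_inj => x.
  pose u i : R := (2 * M)^-1 * (M + x i); pose v i : R := (2 * M)^-1 * (M - x i).
  have uv i : u i + v i = 1 by rewrite /u /v; field; rewrite gt_eqF.
  have ul i : (lower_face i).@[x] = u i.
    by rewrite mevalZ mevalD mevalC mevalZ mevalXU mul1r.
  have vl i : (upper_face i).@[x] = v i.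
    by rewrite mevalZ mevalD mevalC mevalZ mevalXU mulN1r.
  transitivity q.@[u].
    rewrite q_eval; apply: meval_eq => i; rewrite /u; field; by rewrite gt_eqF.
  rewrite mevalE.
  transitivity (\sum_(m <- msupp q) \sum_(b : {ffun 'I_n -> 'I_L.+1})
     q@_m * \prod_i (bernstein_ratio R L (m i) (b i) *
        ('C(L, b i)%:R * (u i ^+ b i * v i ^+ (L - b i))))).
    rewrite big_seq [RHS]big_seq; apply: eq_bigr => m hm; rewrite -mulr_sumr.
    congr (_ * _).
    (* The product over [i] of the one-variable expansions is distributed over the multi-indices
       [b]. *)
    rewrite -(bigA_distr_bigA (fun i (j : 'I_L.+1) => bernstein_ratio R L (m i) j *
        ('C(L, j)%:R * (u i ^+ j * v i ^+ (L - j))))) /=.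
    apply: eq_bigr => i _; apply: exp_bernstein => //.
    by rewrite (leq_trans (degm m i hm)).
  rewrite exchange_big raddf_sum; apply: eq_bigr => b _ /=.
  rewrite mevalZ /coef mulr_suml; apply: eq_bigr => m _.
  rewrite big_split /= mulrA; congr (_ * _); rewrite /bernstein_poly rmorph_prod.
  by apply: eq_bigr => i _; rewrite /= mevalZ mevalM !rmorphXn /= ul vl.
apply: in_preorder_sum => b _; apply: in_preorderZ => //.
exact: bernstein_in_preorder.
Qed.

End BoxCertificate.

(** * Growth of the bounds *)

Section Growth.
Variable n : nat.
Implicit Types (q u : nat -> nat -> nat) (d t : nat).

Definition scale d t : nat := (t * d ^ (2 * n + 2))%N.

(** A calculus of growth: [O(X)], [2^O(X)] and [2^(2^O(X))] for [X = scale d t]. Positive [d] and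
    [t] give [X >= 1], so that constants count as [O(X)]. *)
Definition linearly_bounded q :=
  exists C, forall d t, (0 < d)%N -> (0 < t)%N -> (q d t <= C * scale d t)%N.
Definition exp_bounded q :=
  exists C, forall d t, (0 < d)%N -> (0 < t)%N -> (q d t <= 2 ^ (C * scale d t))%N.
Definition dexp_bounded q := exists2 u, exp_bounded u &
  forall d t, (0 < d)%N -> (0 < t)%N -> (q d t <= 2 ^ u d t)%N.

Lemma scale_gt0 d t : (0 < d)%N -> (0 < t)%N -> (0 < scale d t)%N.
Proof. by move=> d0 t0; rewrite muln_gt0 t0 expn_gt0 d0. Qed.

Lemma linear_le q u : (forall d t, (0 < d)%N -> (0 < t)%N -> (q d t <= u d t)%N) ->
  linearly_bounded u -> linearly_bounded q.
Proof.
move=> h [C hC]; exists C => d t d0 t0; exact: leq_trans (h d t d0 t0) (hC d t d0 t0).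
Qed.

Lemma linear_monomial i : (i <= 2 * n + 2)%N ->
  linearly_bounded (fun d t => t * d ^ i)%N.
Proof.
by move=> hi; exists 1%N => d t d0 t0; rewrite mul1n leq_mul2l leq_pexp2l // orbT.
Qed.

Lemma linear_add q u : linearly_bounded q -> linearly_bounded u ->
  linearly_bounded (fun d t => q d t + u d t)%N.
Proof.
move=> [C hC] [C' hC']; exists (C + C')%N => d t d0 t0.
by rewrite mulnDl leq_add ?hC ?hC'.
Qed.

Lemma linear_mulc c q : linearly_bounded q -> linearly_bounded (fun d t => c * q d t)%N.
Proof.
move=> [C hC]; exists (c * C)%N => d t d0 t0.
by rewrite -mulnA leq_mul2l hC // orbT.
Qed.

Lemma linear_const c : linearly_bounded (fun _ _ => c).
Proof.
exists c => d t d0 t0; by rewrite leq_pmulr // scale_gt0.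
Qed.

Lemma exp_of_linear q : linearly_bounded q -> exp_bounded (fun d t => 2 ^ q d t)%N.
Proof. by move=> [C hC]; exists C => d t d0 t0; rewrite leq_pexp2l // hC. Qed.

Lemma exp_le q u : (forall d t, (0 < d)%N -> (0 < t)%N -> (q d t <= u d t)%N) ->
  exp_bounded u -> exp_bounded q.
Proof.
move=> h [C hC]; exists C => d t d0 t0; exact: leq_trans (h d t d0 t0) (hC d t d0 t0).
Qed.

Lemma linear_exp q : linearly_bounded q -> exp_bounded q.
Proof.
move=> /exp_of_linear; apply: exp_le => d t _ _; exact: ltnW (ltn_expl _ _).
Qed.

Lemma exp_const c : exp_bounded (fun _ _ => c).
Proof. exact: linear_exp (linear_const c). Qed.

Lemma exp_mul q u : exp_bounded q -> exp_bounded u ->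
  exp_bounded (fun d t => q d t * u d t)%N.
Proof.
move=> [C hC] [C' hC']; exists (C + C')%N => d t d0 t0.
by rewrite mulnDl expnD leq_mul ?hC ?hC'.
Qed.

Lemma exp_succ q : exp_bounded q -> exp_bounded (fun d t => (q d t).+1).
Proof.
move=> [C hC]; exists C.+1 => d t d0 t0.
rewrite mulSn expnD; apply: leq_trans (_ : 2 ^ (C * scale d t) + 1 <= _)%N.
  by rewrite addn1 ltnS hC.
have h1 : (2 <= 2 ^ scale d t)%N by rewrite -{1}(expn1 2) leq_pexp2l // scale_gt0.
have h2 : (0 < 2 ^ (C * scale d t))%N by rewrite expn_gt0.
move: h1 h2; move: (2 ^ scale d t)%N (2 ^ (C * scale d t))%N => a b; nia.
Qed.

Lemma exp_add q u : exp_bounded q -> exp_bounded u ->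
  exp_bounded (fun d t => q d t + u d t)%N.
Proof.
move=> /exp_succ hq /exp_succ hu; apply: exp_le (exp_mul hq hu) => d t _ _; nia.
Qed.

Lemma exp_dexp q : exp_bounded q -> dexp_bounded q.
Proof. by move=> hq; exists q => // d t _ _; exact: ltnW (ltn_expl _ _). Qed.

Lemma dexp_mul q u : dexp_bounded q -> dexp_bounded u ->
  dexp_bounded (fun d t => q d t * u d t)%N.
Proof.
move=> [v hv hq] [v' hv' hu]; exists (fun d t => v d t + v' d t)%N.
  exact: exp_add.
by move=> d t d0 t0; rewrite expnD leq_mul ?hq ?hu.
Qed.

Lemma dexp_add q u : dexp_bounded q -> dexp_bounded u ->
  dexp_bounded (fun d t => q d t + u d t)%N.
Proof.
move=> [v hv hq] [v' hv' hu]; exists (fun d t => v d t + v' d t + 1)%N.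
  apply: exp_add (exp_const _); exact: exp_add.
move=> d t d0 t0; apply: leq_trans (leq_add (hq d t d0 t0) (hu d t d0 t0)) _.
rewrite !expnD expn1.
have h1 : (0 < 2 ^ v d t)%N by rewrite expn_gt0.
have h2 : (0 < 2 ^ v' d t)%N by rewrite expn_gt0.
by move: h1 h2; move: (2 ^ v d t)%N (2 ^ v' d t)%N => a b; nia.
Qed.

(** As [(2^v)^u = 2^(v * u)], an exponent of size [2^O(X)] keeps the bound doubly exponential. *)
Lemma dexp_pow q u : dexp_bounded q -> exp_bounded u ->
  dexp_bounded (fun d t => q d t ^ u d t)%N.
Proof.
move=> [v hv hq] hu; exists (fun d t => v d t * u d t)%N; first exact: exp_mul.
by move=> d t d0 t0; rewrite expnM; case: (u d t) => // e; rewrite leq_exp2r ?hq.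
Qed.

End Growth.

(** * An effective Positivstellensatz *)

Lemma card_bmultinom n d : (#|{: 'X_{1..n < d}}| <= d ^ n)%N.
Proof.
have hb (b : 'X_{1..n < d}) i : (b i < d)%N.
  by apply: leq_ltn_trans (bmdeg b); rewrite mdegE (bigD1 i) //= leq_addr.
pose F (b : 'X_{1..n < d}) : {ffun 'I_n -> 'I_d} := [ffun i => Ordinal (hb b i)].
have injF : injective F.
  move=> b b' /ffunP h; apply/val_inj/mnmP => i.
  by have := h i; rewrite !ffunE => /(congr1 val).
by have := leq_card F injF; rewrite card_ffun !card_ord.
Qed.

Lemma mnorm_int_bits (R : realType) n d tau (p : {mpoly R[n]}) :
  (msize p <= d)%N -> int_coeffs_bits tau p -> mnorm p <= (d ^ n * 2 ^ tau)%:R.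
Proof.
move=> hd hp; rewrite (mnorm_widen hd).
apply: (@le_trans _ _ (\sum_(m : 'X_{1..n < d}) 2 ^+ tau)).
  by apply: ler_sum => m _; have [_ /ltW] := hp m.
rewrite sumr_const -[leLHS]mulr_natl natrM (natrX _ 2) ler_wpM2r ?exprn_ge0 //.
by rewrite ler_nat card_bmultinom.
Qed.

Lemma fact_le_exp2 r : (r`! <= 2 ^ (r * r))%N.
Proof.
elim: r => // r IH; rewrite factS.
apply: (@leq_trans (2 ^ r.+1 * 2 ^ (r * r))%N).
  by rewrite leq_mul // ltnW // ltn_expl.
by rewrite -expnD leq_pexp2l // mulSn mulnS; lia.
Qed.

(** * Size of the positivity gap *)

Section GapSize.
Variables (n m A d t : nat).

(** [m + 2] counts the [g_i], [- f] and the ball constraint; [d.+1] leaves room for the degree 2 of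
    the latter even if [d = 1]. *)
Definition gap_rank_of : nat := gap_rank n (m + 2) d.+1.
Definition gap_bits : nat := (4 * d.+1 * (m + 2) + 2 * (n * d + t + (A + n).+1))%N.
(** Obtained from [r! <= 2^(r * r)] and [1 + 2^a <= 2^(a + 1)]. *)
Definition gap_height_bits : nat :=
  (gap_rank_of * gap_rank_of +
   (gap_bits * (4 * d.+1 * (n + (m + 2)).+1).+1).+1 * gap_rank_of)%N.
(** Chosen so that [(2^h + 1) * (m + 1) < 2^(2 * gap_exponent)] for [h = gap_height_bits]. *)
Definition gap_exponent : nat := (gap_height_bits + m + 2)%N.
Definition coeff_bound : nat := (d ^ n * 2 ^ t)%N.

Hypothesis d_gt0 : (0 < d)%N.

Lemma coeff_bound_le : (coeff_bound + (A + n).+1 <= 2 ^ (n * d + t + (A + n).+1))%N.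
Proof.
rewrite /coeff_bound !expnD.
have h1 : (d ^ n <= 2 ^ (n * d))%N.
  rewrite mulnC expnM; case: (n) => // e; by rewrite leq_exp2r // ltnW // ltn_expl.
have h2 := ltn_expl (A + n).+1 (isT : 1 < 2)%N.
have h3 : (0 < 2 ^ (n * d))%N by rewrite expn_gt0.
have h4 : (0 < 2 ^ t)%N by rewrite expn_gt0.
have h5 : (d ^ n * 2 ^ t <= 2 ^ (n * d) * 2 ^ t)%N by rewrite leq_mul2r h1 orbT.
move: h2 h5; have : (0 < 2 ^ (n * d) * 2 ^ t)%N by rewrite muln_gt0 h3 h4.
by move: (d ^ n * 2 ^ t)%N (2 ^ (n * d) * 2 ^ t)%N (2 ^ (A + n).+1)%N => a b c; nia.
Qed.

Lemma gap_height_le (R : realType) :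
  gap_height n (m + 2) d.+1 (coeff_bound + A + n)%:R <= (2 ^ gap_height_bits)%:R :> R.
Proof.
rewrite /gap_height -/gap_rank_of /gap_constant.
set K := (4 * d.+1 * (m + 2))%:R * _ ^+ 2.
have K0 : 0 <= K by rewrite mulr_ge0 // sqr_ge0.
have hK : K <= (2 ^ gap_bits)%:R.
  rewrite /K natr1 -natrX -natrM ler_nat.
  rewrite /gap_bits expnD leq_mul //; first exact: ltnW (ltn_expl _ _).
  rewrite mulnC expnM leq_exp2r //; apply: leq_trans coeff_bound_le.
  by rewrite -addnA addnS.
rewrite /gap_height_bits expnD natrM; apply: ler_pM => //.
- by rewrite exprn_ge0 // addr_ge0 // exprn_ge0.
- by rewrite ler_nat fact_le_exp2.
rewrite expnM natrX lerXn2r ?nnegrE //; first by rewrite addr_ge0 // exprn_ge0.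
rewrite expnS mul2n -addnn natrD; apply: lerD.
  by rewrite ler1n expn_gt0.
by rewrite expnM natrX lerXn2r ?nnegrE.
Qed.

End GapSize.

Section PositivityGap.
Variables (R : realType) (n m N d t : nat) (g : 'I_m -> {mpoly R[n]}).
Variable f : {mpoly R[n]}.

(** Bounds [|x|^2] on the box, so the ball constraint holds there. *)
Let A := (n * N.+1 ^ 2)%N.

(** The system [g_i >= 0], [- f >= 0], [A - |x|^2 >= 0], infeasible when [f] is positive on [S]; the
    last constraint provides coercivity. *)
Definition penalty_family (j : 'I_(m + 2)) : {mpoly R[n]} :=
  match split j with
  | inl i => g i
  | inr j => if j == ord0 then - f else ball_poly R n A
  end.

Definition box x := forall i : 'I_n, `|x i : R| <= box_radius R N.

Hypothesis d_gt0 : (0 < d)%N.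
Hypothesis g_deg : forall i, (msize (g i) <= d)%N.
Hypothesis g_bits : forall i, int_coeffs_bits t (g i).
Hypothesis f_deg : (msize f <= d)%N.
Hypothesis f_bits : int_coeffs_bits t f.
Hypothesis f_pos : forall x, inS g x -> 0 < f.@[x].

Definition gap : R := 2 ^- gap_exponent n m A d t.

Lemma gap_gt0 : 0 < gap.
Proof. by rewrite invr_gt0 exprn_gt0. Qed.

Lemma mnorm_ball_poly : mnorm (ball_poly R n A) <= (A + n)%:R.
Proof.
apply: le_trans (mnormD _ _) _; rewrite mnormN natrD; apply: lerD.
  by rewrite -mpolyC_nat mnormC ger0_norm.
apply: le_trans (mnorm_sum _ _ _) _.
under eq_bigr => i _ do rewrite mpolyXn mnormX.
by rewrite sumr_const card_ord.
Qed.

Lemma penalty_family_deg j : (msize (penalty_family j) <= d.+2)%N.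
Proof.
rewrite /penalty_family; case: split => [i|k].
  exact: leqW (leqW (g_deg i)).
case: ifP => _; first by rewrite msizeN; exact: leqW (leqW f_deg).
by apply: leq_trans (msize_ball_poly _ _ _) _.
Qed.

Lemma int_coeffs_ball_poly : int_coeffs (ball_poly R n A).
Proof.
move=> a; rewrite mcoeffB -mpolyC_nat mcoeffC rpredB ?rpredM ?rpred_nat //.
rewrite raddf_sum rpred_sum // => i _ /=.
by rewrite mpolyXn mcoeffX rpred_nat.
Qed.

Lemma penalty_family_int j : int_coeffs (penalty_family j).
Proof.
rewrite /penalty_family; case: split => [i a|k]; first by case: (g_bits i a).
case: ifP => _; last exact: int_coeffs_ball_poly.
by move=> a; rewrite mcoeffN rpredN; case: (f_bits a).
Qed.

Lemma penalty_family_norm j :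
  mnorm (penalty_family j) <= (coeff_bound n d t + A + n)%:R.
Proof.
have cb (p : {mpoly R[n]}) : (msize p <= d)%N -> int_coeffs_bits t p ->
    mnorm p <= (coeff_bound n d t + A + n)%:R :> R.
  move=> h1 h2; apply: le_trans (mnorm_int_bits h1 h2) _.
  by rewrite ler_nat -/(coeff_bound n d t) -addnA leq_addr.
rewrite /penalty_family; case: split => [i|k]; first exact: cb.
case: ifP => _; first by rewrite mnormN cb.
by apply: le_trans mnorm_ball_poly _; rewrite ler_nat -addnA leq_addl.
Qed.

(** Otherwise all negative parts of the system at [x] are at most [gap], the one of the ball
    constraint being zero on the box; the sum of their squares, at most [(m + 1) * gap^2], then
    contradicts [infeasible_gap]. *)
Lemma positivity_gap x : box x -> gap <= f.@[x] \/ exists i, (g i).@[x] <= - gap.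
Proof.
move=> hx; have c0 := gap_gt0.
have [|hf] := leP gap f.@[x]; first by left.
right; apply: boolp.contrapT => /boolp.forallNP hg.
have {}hg i : - gap < (g i).@[x] by rewrite ltNge; apply/negP; exact: hg.
have hball y : (penalty_family (rshift m (lift ord0 ord0))).@[y] =
    A%:R - \sum_i y i ^+ 2.
  by rewrite /penalty_family split_rshift meval_ball_poly.
have hinf y : exists j, (penalty_family j).@[y] < 0.
  have [/f_pos fy|/boolp.existsNP[i /negP hi]] := boolp.pselect (inS g y).
    exists (rshift m ord0); rewrite /penalty_family split_rshift eqxx mevalN.
    by rewrite oppr_lt0.
  by exists (lshift 2 i); rewrite /penalty_family split_lshift ltNge.
have := infeasible_gap (ltn0Sn d) penalty_family_deg penalty_family_int
  penalty_family_norm hball hinf x.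
apply/negP; rewrite -ltNge.
set S := \sum_j _; have S_le : S <= m.+1%:R * gap ^+ 2.
  rewrite /S big_split_ord /= !big_ord_recl big_ord0 /= addr0.
  have sq (a : R) : - gap < a -> Num.min a 0 ^+ 2 <= gap ^+ 2.
    move=> ha; rewrite minEle; case: (leP a 0) => ha0; last by rewrite expr0n sqr_ge0.
    by rewrite -sqrrN lerXn2r ?nnegrE ?oppr_ge0 ?(ltW c0) // lerNl ltW.
  rewrite -natr1 mulrDl mul1r; apply: lerD.
    rewrite mulr_natl -[m in leRHS]card_ord -sumr_const; apply: ler_sum => i _.
    by rewrite /penalty_family split_lshift sq.
  rewrite /penalty_family !split_rshift eqxx /= -[leRHS]addr0; apply: lerD.
    by apply: sq; rewrite mevalN ltrN2.
  rewrite meval_ball_poly minEle; case: ifP => [|_]; last by rewrite expr0n.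
  move=> hb; suff : 0 <= A%:R - \sum_i x i ^+ 2.
    by move=> h0; rewrite (le_anti (introT andP (conj hb h0))) expr0n.
  rewrite subr_ge0 /A natrM mulr_natl -[n in leRHS]card_ord -sumr_const.
  apply: ler_sum => i _; rewrite natrX -[leLHS]real_normK ?num_real //.
  rewrite lerXn2r ?nnegrE //; apply: le_trans (hx i) _.
  by rewrite /box_radius ler_pdivrMr // ler_peMr // ler1n.
set H := gap_height _ _ _ _.
have HB : H <= (2 ^ gap_height_bits n m A d t)%:R by exact: gap_height_le.
have H0 : 0 <= H + 1.
  rewrite addr_ge0 // mulr_ge0 // exprn_ge0 // addr_ge0 // exprn_ge0 //.
  by rewrite mulr_ge0 // sqr_ge0.
apply: (@le_lt_trans _ _ ((H + 1) * (m.+1%:R * gap ^+ 2))).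
  by rewrite ler_wpM2l.
rewrite mulrA /gap -exprVn -exprM exprVn ltr_pdivrMr ?exprn_gt0 // mul1r.
apply: (@le_lt_trans _ _ ((2 ^ gap_height_bits n m A d t).+1%:R * m.+1%:R)).
  by rewrite ler_wpM2r // -natr1 lerD2r.
rewrite -natrM -natrX ltr_nat /gap_exponent.
set h := gap_height_bits _ _ _ _ _.
have h1 : (0 < 2 ^ h)%N by rewrite expn_gt0.
have h2 := ltn_expl m.+1 (isT : 1 < 2)%N.
have -> : ((h + m + 2) * 2 = h + m.+1 + (h + m.+1.+2))%N by lia.
rewrite [(2 ^ (_ + (h + _)))%N]expnD (expnD 2 h m.+1).
have h3 : (2 <= 2 ^ (h + m.+3))%N.
  by rewrite -{1}(expn1 2) leq_pexp2l //; lia.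
move: h1 h2 h3; move: (2 ^ h)%N (2 ^ m.+1)%N (2 ^ (h + m.+3))%N => a b c a0 hb hc.
apply: (@leq_ltn_trans (a * c * m.+1)%N).
  by rewrite leq_mul2r; apply/orP; right; nia.
by rewrite [(a * b * c)%N]mulnAC ltn_pmul2l // muln_gt0 a0; lia.
Qed.

End PositivityGap.

(** Follows from [(1 - u)^k * (1 + k * u) <= 1], whose left side does not increase with [k]. *)
Lemma decay_bound (R : realFieldType) (u : R) k : 0 <= u <= 1 ->
  u * (1 - u) ^+ k * k%:R <= 1.
Proof.
move=> /andP[u0 u1]; have v0 : 0 <= 1 - u by rewrite subr_ge0.
suff h : (1 - u) ^+ k * (1 + k%:R * u) <= 1.
  by apply: le_trans h; have := exprn_ge0 k v0; lra.
elim: k => [|k IH]; first by rewrite expr0 mul0r addr0 mulr1.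
apply: le_trans IH; rewrite exprSr -mulrA ler_wpM2l ?exprn_ge0 // -natr1.
have : 0 <= k%:R * u ^+ 2 + u ^+ 2 by rewrite addr_ge0 ?mulr_ge0 ?sqr_ge0.
by nra.
Qed.

Lemma QmodD_add (R : realType) n m (g : 'I_m -> {mpoly R[n]}) D p q :
  QmodD g D p -> QmodD g D q -> QmodD g D (p + q).
Proof.
move=> [s0 [s [? [? [? [? ->]]]]]] [t0 [t [? [? [? [? ->]]]]]].
exists (s0 + t0), (fun i => s i + t i); split; first exact: sosD.
split; first by move=> i; exact: sosD.
split; first exact: msizeD_bound.
split; first by move=> i; rewrite mulrDl; exact: msizeD_bound.
rewrite addrACA; congr (_ + _); rewrite -big_split; apply: eq_bigr => i _ /=.
by rewrite mulrDl.
Qed.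

Lemma QmodD_le (R : realType) n m (g : 'I_m -> {mpoly R[n]}) D D' p :
  (D <= D')%N -> QmodD g D p -> QmodD g D' p.
Proof.
move=> hD [s0 [s [? [? [h0 [h1 ->]]]]]]; exists s0, s; do 2!split=> //.
split; first exact: leq_trans h0 _.
by split=> // i; exact: leq_trans (h1 i) _.
Qed.

Lemma QmodD_lincomb (R : realType) n m (g s : 'I_m -> {mpoly R[n]}) D :
  (forall i, is_sos (s i)) -> (forall i, (msize (s i * g i) <= D.+1)%N) ->
  QmodD g D (\sum_i s i * g i).
Proof.
move=> hs hD; exists 0, s; split; first exact: sos0.
by rewrite msize0 add0r.
Qed.

(** Substituting one fixed representation of [h] raises the degree by a constant independent of
    [p]. *)
Lemma preorder_sub_Qmod (R : realType) n m (g : 'I_m -> {mpoly R[n]}) h :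
  Qmod g h -> exists D0, forall D p, in_preorder h D p -> QmodD g (D + D0) p.
Proof.
move=> [e0 [e [e0s [es eh]]]].
exists (msize e0 + \sum_i msize (e i * g i)%R)%N.
move=> D p [s0 [s1 [s0s s1s d0 d1 ->]]].
exists (s0 + s1 * e0), (fun i => s1 * e i); split; first by apply: sosD => //; exact: sosM.
split; first by move=> i; exact: sosM.
split.
  apply: msizeD_bound; first by apply: leq_trans d0 _; rewrite ltnS leq_addr.
  apply: leq_trans (msizeM_bound d1 (leqnSn _)) _; lia.
split.
  move=> i; rewrite -mulrA; apply: leq_trans (msizeM_bound d1 (leqnSn _)) _.
  by rewrite ltnS leq_add2l (bigD1 i) //= addnCA leq_addr.
rewrite eh mulrDr -addrA mulr_sumr; congr (_ + (_ + _)).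
by apply: eq_bigr => i _; rewrite mulrA.
Qed.

(** * Effective Putinar representation *)

Section EffectivePutinar.
Variables (n m N D0 d t : nat).

Definition value_bound : nat := (coeff_bound n d t * N.+1 ^ d)%N.
Definition pos_exponent : nat := gap_exponent n m (n * N.+1 ^ 2) d t.
(** The weight times the gap is [F + 1], where [F = value_bound] bounds [|f|] and [|g_i|] on the
    box: a constraint violated by the gap outweighs [f]. *)
Definition penalty_weight : nat := (2 ^ pos_exponent * value_bound.+1)%N.
(** Large enough for [m * lam * F / (2 * K) <= c / 2], so that satisfied constraints cost little. *)
Definition penalty_power : nat :=
  (m * penalty_weight * value_bound * 2 ^ pos_exponent + 1)%N.
Definition penalized_degree : nat := (penalty_power * 2 * d + d)%N.
Definition penalized_norm : nat := (coeff_bound n d t +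
  m * (penalty_weight * (1 + coeff_bound n d t) ^ (penalty_power * 2) *
       coeff_bound n d t) + 1)%N.
(** Meets the condition of [box_certificate] for the lower bound [c / 4], whence the factor
    [4 * 2^pos_exponent]; the last summands make it positive and at least the degree. *)
Definition bernstein_degree : nat := (penalized_norm * (3 * N.+1) ^ penalized_degree *
  penalized_degree ^ 2 * (4 * 2 ^ pos_exponent) + penalized_degree + 1)%N.
Definition putinar_degree : nat :=
  (n * (6 * bernstein_degree + 8) + D0 + penalized_degree + d)%N.

Variables (R : realType) (g : 'I_m -> {mpoly R[n]}) (f : {mpoly R[n]}).
Hypothesis N_gt0 : (0 < N)%N.
Hypothesis preorder_sub : forall D p,
  in_preorder (ball_poly R n N) D p -> QmodD g (D + D0) p.
Hypothesis d_gt0 : (0 < d)%N.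
Hypothesis g_deg : forall i, (msize (g i) <= d)%N.
Hypothesis g_bits : forall i, int_coeffs_bits t (g i).
Hypothesis f_deg : (msize f <= d)%N.
Hypothesis f_bits : int_coeffs_bits t f.
Hypothesis f_pos : forall x, inS g x -> 0 < f.@[x].

Let F : R := value_bound%:R.
Let c : R := 2 ^- pos_exponent.
Let lam : R := penalty_weight%:R.
Let K := penalty_power.
Implicit Types (p : {mpoly R[n]}) (x : 'I_n -> R).

(** An even power, hence a sum of squares: it is at least [lam] where [g i <= 0], and for a large
    [K] its product with [g i] is small where [0 <= g i <= F]. *)
Definition penalty i : {mpoly R[n]} := lam *: ((1 - F^-1 *: g i) ^+ K) ^+ 2.
Definition penalized : {mpoly R[n]} := f - \sum_i penalty i * g i.

Lemma coeff_bound_gt0 : (0 < coeff_bound n d t)%N.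
Proof. by rewrite muln_gt0 !expn_gt0 d_gt0. Qed.

Lemma value_bound_ge1 : 1 <= F.
Proof. by rewrite ler1n muln_gt0 coeff_bound_gt0 expn_gt0. Qed.

Lemma c_itv : 0 < c <= 1.
Proof.
by rewrite invr_gt0 exprn_gt0 //= invf_le1 ?exprn_gt0 // exprn_ege1 // ler1n.
Qed.

Lemma box_value p x : (msize p <= d)%N -> int_coeffs_bits t p -> box N x ->
  `|p.@[x]| <= F.
Proof.
move=> hd hp hx; apply: le_trans (@meval_bound _ _ _ d N.+1%:R x _ _ _) _.
- exact: leqW.
- by rewrite ler1n.
- move=> i; apply: le_trans (hx i) _.
  by rewrite /box_radius ler_pdivrMr // ler_peMr // ler1n.
rewrite /F natrM natrX ler_wpM2r ?exprn_ge0 //; exact: mnorm_int_bits.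
Qed.

Lemma penalty_eval i x :
  (penalty i * g i).@[x] = lam * ((1 - (g i).@[x] / F) ^+ (K * 2) * (g i).@[x]).
Proof.
rewrite mevalM mevalZ -exprM rmorphXn /= mevalB meval1 mevalZ mulrA.
by rewrite [F^-1 * _]mulrC.
Qed.

(** For [g i >= 0] this is [decay_bound] at [u = g_i / F] with exponent [2 K]; otherwise the left
    side is nonpositive. *)
Lemma penalty_le i x : box N x -> (penalty i * g i).@[x] <= lam * F / (2 * K%:R).
Proof.
move=> hx; have F1 := value_bound_ge1; have F0 := lt_le_trans ltr01 F1.
have K0 : 0 < 2 * K%:R :> R by rewrite mulr_gt0 // ltr0n /K /penalty_power addn1.
have l0 : 0 <= lam by [].
rewrite penalty_eval -mulrA ler_wpM2l //.
have := box_value (g_deg i) (g_bits i) hx; rewrite ler_norml => /andP[_ gF].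
have [g0|g0] := leP 0 (g i).@[x]; last first.
  apply: (@le_trans _ _ 0); last by rewrite divr_ge0 // ltW.
  rewrite mulr_ge0_le0 ?(ltW g0) // mulnC exprM exprn_ge0 // sqr_ge0 //.
pose u := (g i).@[x] / F.
have hu : 0 <= u <= 1 by rewrite divr_ge0 ?(ltW F0) //= ler_pdivrMr // mul1r.
have := decay_bound (K * 2) hu; rewrite natrM => h.
rewrite ler_pdivlMr // -/u.
have -> : (g i).@[x] = u * F by rewrite /u divfK // gt_eqF.
have -> : (1 - u) ^+ (K * 2) * (u * F) * (2 * K%:R) =
  F * (u * (1 - u) ^+ (K * 2) * (K%:R * 2)) by ring.
by rewrite -[leRHS]mulr1 ler_wpM2l // ltW.
Qed.

Lemma penalty_sum_small : m%:R * (lam * F / (2 * K%:R)) <= c / 2.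
Proof.
have K0 : 0 < K%:R :> R by rewrite ltr0n /K /penalty_power addn1.
have h : m%:R * lam * F <= c * K%:R.
  rewrite /c [leRHS]mulrC ler_pdivlMr ?exprn_gt0 // -natrX -!natrM ler_nat.
  by rewrite /K /penalty_power leq_addr.
by rewrite !mulrA ler_pdivrMr ?mulr_gt0 // mulrA divfK ?pnatr_eq0.
Qed.

(** If [f >= c], the penalties remove at most [c / 2]. If some [g i <= - c], its term adds at least
    [F + 1], which compensates [f >= - F] and leaves [1 - c / 2 >= c / 2] after the other
    penalties. *)
Lemma penalized_ge x : box N x -> c / 2 <= penalized.@[x].
Proof.
move=> hx; have /andP[c0 c1] := c_itv; have F1 := value_bound_ge1.
have hm := penalty_sum_small; set e := lam * F / _ in hm.
have he i : (penalty i * g i).@[x] <= e by exact: penalty_le.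
have e0 : 0 <= e by rewrite divr_ge0 // mulr_ge0.
rewrite /penalized mevalB (raddf_sum (meval x)) /=.
have [hf|[i hi]] := positivity_gap (N := N) d_gt0 g_deg g_bits f_deg f_bits f_pos hx.
  have : \sum_i (penalty i * g i).@[x] <= m%:R * e.
    rewrite mulr_natl -[m in leRHS]card_ord -sumr_const.
    by apply: ler_sum => i _; exact: he.
  move=> hS; have hcf : c <= f.@[x] := hf. lra.
have hs : \sum_(j | j != i) (penalty j * g j).@[x] <= m%:R * e.
  rewrite mulr_natl -[m in leRHS]card_ord -sumr_const big_mkcond /=.
  by apply: ler_sum => j _; case: ifP => // _; exact: he.
have hi' : (penalty i * g i).@[x] <= - (F + 1).
  rewrite penalty_eval.
  have hw : lam * c = F + 1.
    rewrite /lam /penalty_weight natrM natrX mulrAC divff ?expf_neq0 ?pnatr_eq0 //.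
    by rewrite mul1r natr1.
  have gi : (g i).@[x] <= - c := hi.
  rewrite -hw -[leRHS]mulrN ler_wpM2l //; apply: le_trans gi.
  have g0 : (g i).@[x] <= 0 by apply: le_trans hi _; rewrite oppr_le0 ltW.
  rewrite -[leRHS]mul1r ler_wnM2r // exprn_ege1 // lerDl oppr_ge0.
  by rewrite pmulr_lle0 // invr_gt0 (lt_le_trans ltr01).
have := box_value f_deg f_bits hx; rewrite ler_norml => /andP[fF _].
by rewrite (bigD1 i) //=; lra.
Qed.

Lemma penalty_deg i : (msize (penalty i * g i) <= penalized_degree.+1)%N.
Proof.
rewrite /penalized_degree; apply: msizeM_bound; last exact: leqW.
apply: leq_trans (msizeZ_le _ _) _; rewrite -exprM.
apply: msizeX_bound; apply: msizeD_bound; first by rewrite msize1.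
by rewrite msizeN; apply: leq_trans (msizeZ_le _ _) (leqW (g_deg i)).
Qed.

Lemma penalized_deg : (msize penalized <= penalized_degree.+1)%N.
Proof.
apply: msizeD_bound.
  by apply: leq_trans f_deg _; rewrite /penalized_degree; lia.
by rewrite msizeN; apply: msize_sum_bound => i _; exact: penalty_deg.
Qed.

Lemma mnorm_penalized (e : R) : 0 <= e <= 1 ->
  mnorm (penalized - e%:MP) <= penalized_norm%:R.
Proof.
move=> /andP[e0 e1]; rewrite /penalized_norm !natrD.
apply: le_trans (mnormD _ _) _; rewrite mnormN mnormC (ger0_norm e0) lerD //.
apply: le_trans (mnormD _ _) _; rewrite mnormN lerD ?mnorm_int_bits //.
apply: le_trans (mnorm_sum _ _ _) _.
rewrite natrM mulr_natl -[in leRHS](card_ord m) -sumr_const; apply: ler_sum => i _.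
apply: le_trans (mnormM _ _) _; rewrite natrM.
have hg : mnorm (g i) <= (coeff_bound n d t)%:R by exact: mnorm_int_bits.
apply: ler_pM; rewrite ?mnorm_ge0 //.
apply: le_trans (mnormZ _ _) _; rewrite natrM ger0_norm // ler_wpM2l //.
rewrite -exprM; apply: le_trans (mnormXn _ _) _.
rewrite natrX lerXn2r ?nnegrE ?mnorm_ge0 // natrD.
apply: le_trans (mnormD _ _) _; rewrite mnormN -mpolyC1 mnormC normr1 lerD2l.
apply: le_trans (mnormZ _ _) _; apply: le_trans hg.
rewrite ler_piMl ?mnorm_ge0 // ger0_norm ?invr_ge0 //.
by rewrite invf_le1 ?value_bound_ge1 // (lt_le_trans ltr01) ?value_bound_ge1.
Qed.

(** [f - c / 4] is [penalized - c / 4], which is at least [c / 4] on the box and so has a box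
    certificate, plus the penalties, which are in the module by construction. *)
Theorem effective_putinar :
  QmodD g putinar_degree (f - (2 ^- (pos_exponent + 2))%:MP).
Proof.
have /andP[c0 c1] := c_itv; pose e : R := 2 ^- (pos_exponent + 2).
have ec : e = c / 4 by rewrite /e exprD invfM; congr (_ * _); rewrite -natrX.
have -> : f - e%:MP = (penalized - e%:MP) + \sum_i penalty i * g i.
  by rewrite /penalized addrAC subrK.
apply: QmodD_add; last first.
  apply: QmodD_lincomb => i.
    by apply: sosZ => //; exact: sos_sqr.
  by apply: leq_trans (penalty_deg i) _; rewrite /putinar_degree; lia.
apply: (@QmodD_le _ _ _ _ (n * (6 * bernstein_degree + 8) + D0)%N).
  by rewrite /putinar_degree -addnA leq_addr.
apply: preorder_sub.
apply: (@box_certificate _ _ _ N_gt0 _ penalized_degree _ e).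
- apply: msizeD_bound; first exact: penalized_deg.
  by rewrite msizeN; apply: leq_trans (msizeC_le _ _) _.
- move=> x hx; rewrite mevalB mevalC ec; have := penalized_ge hx; lra.
- by rewrite /bernstein_degree; lia.
- by rewrite /bernstein_degree addn1.
have he : 0 <= e <= 1 by rewrite ec; lra.
rewrite /bernstein_degree -addnA natrD.
apply: (@le_trans _ _ (penalized_norm%:R * (3 * N.+1%:R) ^+ penalized_degree *
  (penalized_degree ^ 2)%:R)).
  rewrite ler_wpM2r //; apply: ler_pM; rewrite ?mnorm_ge0 ?mnorm_penalized //.
    by rewrite exprn_ge0 // mulr_ge0 // ltW // box_radius_gt0.
  have M0 : 0 <= 3 * box_radius R N by rewrite mulr_ge0 // ltW // box_radius_gt0.
  apply: lerXn2r; rewrite ?nnegrE ?(mulr_ge0 _ (ler0n _ _)) //.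
  by rewrite ler_pM2l // /box_radius ler_pdivrMr // ler_peMr // ler1n.
rewrite mulrDr; apply: ler_wpDr; first by rewrite mulr_ge0 //; case/andP: he.
rewrite [in leRHS]natrM mulrCA.
have -> : e * (4 * 2 ^ pos_exponent)%:R = 1.
  by rewrite ec natrM natrX mulrA divfK ?pnatr_eq0 // /c mulVf ?expf_neq0 ?pnatr_eq0.
by rewrite mulr1 !natrM natrX natrM.
Qed.

End EffectivePutinar.

(** * Growth of the gap exponent and of the Putinar degree *)

Section PutinarGrowth.
Variables (n m : nat).

(** The dominant terms are the square of the rank [O(d^n)], from the factorial, and the product of
    the rank with the bit size [O(t d)] and the weight [O(d)]; both are [O(t * d^(2n+2))]. *)
Lemma linear_gap_exponent A : linearly_bounded n (gap_exponent n m A).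
Proof.
(* The [9] comes from [4 (d + 1) + 1 <= 9 d]; likewise the bit size is at most [ck * t * d] and the
   power at most [ce * d]. *)
pose cr := (9 ^ n * 5 ^ (m + 2))%N.
pose ck := (8 * (m + 2) + 2 * (n + 1 + (A + n).+1))%N.
pose ce := (8 * (n + (m + 2)).+1 + 1)%N.
apply: (@linear_le _ _ (fun d t => cr ^ 2 * (t * d ^ (2 * n)) +
  (ck * ce + 1) * cr * (t * d ^ (n + 2)) + (m + 2))%N); last first.
  apply: linear_add (linear_const _ _); apply: linear_add; apply: linear_mulc;
    apply: linear_monomial; lia.
move=> d t d0 t0; rewrite /gap_exponent -addnA leq_add2r /gap_height_bits.
set r := gap_rank_of _ _ _; set k := gap_bits _ _ _ _ _; set e := (4 * d.+1 * (n + (m + 2)).+1).+1.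
have hr : (r <= cr * d ^ n)%N.
  rewrite /r /gap_rank_of /gap_rank /cr mulnAC leq_mul2r; apply/orP; right.
  by rewrite -expnMn; case: (n) => // n'; rewrite leq_exp2r //; lia.
have hd : (d <= t * d)%N by rewrite leq_pmull.
have ht : (t <= t * d)%N by rewrite leq_pmulr.
have hk : (k <= ck * (t * d))%N.
  rewrite /k /gap_bits /ck; move: (t * d)%N hd ht => p hd ht.
  have h1 : (4 * d.+1 * (m + 2) <= 8 * (m + 2) * p)%N.
    by rewrite [leqRHS]mulnAC leq_mul2r; apply/orP; right; lia.
  have h2 : (n * d <= n * p)%N by rewrite leq_mul2l hd orbT.
  have h3 : ((A + n).+1 <= (A + n).+1 * p)%N by rewrite leq_pmulr //; lia.
  rewrite mulnDl leq_add // -mulnA leq_mul2l /=; move: h2 h3.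
  by rewrite !mulnDl mul1n; lia.
have he : (e <= ce * d)%N.
  rewrite /e /ce mulnDl mul1n -addn1 leq_add //.
  by rewrite [leqRHS]mulnAC leq_mul2r; apply/orP; right; lia.
have hd2 : (0 < d ^ n)%N by rewrite expn_gt0 d0.
apply: leq_add.
  apply: (@leq_trans (cr ^ 2 * d ^ (2 * n))%N).
    by rewrite (mulnC 2 n) expnM -expnMn -mulnn leq_mul.
  by rewrite leq_mul2l leq_pmull ?orbT.
apply: (@leq_trans ((ck * ce * (t * d ^ 2)).+1 * (cr * d ^ n))%N).
  apply: leq_mul => //; rewrite ltnS; apply: leq_trans (leq_mul hk he) _.
  by apply: eq_leq; rewrite -mulnn; clearbody ck ce; lia.
apply: (@leq_trans ((ck * ce + 1) * (t * d ^ 2) * (cr * d ^ n))%N).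
  by rewrite leq_mul2r mulnDl mul1n -addn1 leq_add2l muln_gt0 t0 expn_gt0 d0 orbT.
by rewrite addnC expnD; apply: eq_leq; move: (d ^ 2)%N (d ^ n)%N => a b; lia.
Qed.

End PutinarGrowth.

Section PutinarDegreeGrowth.
Variables (n m N D0 : nat).

Lemma exp_coeff_bound : exp_bounded n (coeff_bound n).
Proof.
apply: exp_mul; last first.
  apply: exp_of_linear; apply: (@linear_le _ _ (fun d t => t * d ^ 0)%N).
    by move=> d t _ _; rewrite expn0 muln1.
  exact: linear_monomial.
apply: linear_exp; apply: (@linear_le _ _ (fun d t => t * d ^ n)%N).
  by move=> d t _ t0; rewrite leq_pmull.
by apply: linear_monomial; lia.
Qed.

Lemma linear_degree : linearly_bounded n (fun d _ => d).
Proof.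
apply: (@linear_le _ _ (fun d t => t * d ^ 1)%N).
  by move=> d t _ t0; rewrite expn1 leq_pmull.
by apply: linear_monomial; lia.
Qed.

Lemma exp_pow_linear c q : linearly_bounded n q -> exp_bounded n (fun d t => c ^ q d t)%N.
Proof.
move=> hq; apply: (@exp_le _ _ (fun d t => 2 ^ (c * q d t))%N).
  move=> d t _ _; rewrite expnM; case: (q d t) => // e.
  by rewrite leq_exp2r // ltnW // ltn_expl.
by apply: exp_of_linear; exact: linear_mulc.
Qed.

Lemma linear_pos_exponent : linearly_bounded n (pos_exponent n m N).
Proof. exact: linear_gap_exponent. Qed.

Lemma exp_value_bound : exp_bounded n (value_bound n N).
Proof. exact: exp_mul exp_coeff_bound (exp_pow_linear _ linear_degree). Qed.

Lemma exp_penalty_weight : exp_bounded n (penalty_weight n m N).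
Proof.
apply: exp_mul; first exact: exp_of_linear linear_pos_exponent.
exact: exp_succ exp_value_bound.
Qed.

Lemma exp_penalty_power : exp_bounded n (penalty_power n m N).
Proof.
apply: exp_add (exp_const _ _); apply: exp_mul; last exact: exp_of_linear linear_pos_exponent.
apply: exp_mul exp_value_bound; apply: exp_mul exp_penalty_weight; exact: exp_const.
Qed.

Lemma exp_penalized_degree : exp_bounded n (penalized_degree n m N).
Proof.
have hd := linear_exp linear_degree.
apply: (exp_add _ hd); apply: (exp_mul _ hd).
exact: exp_mul exp_penalty_power (exp_const _ _).
Qed.

(** The only doubly exponential contribution is the power [2 K], whose exponent is singly
    exponential. *)
Lemma dexp_penalized_norm : dexp_bounded n (penalized_norm n m N).
Proof.
have hc := exp_dexp exp_coeff_bound.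
apply: dexp_add; last exact: exp_dexp (exp_const _ _).
apply: dexp_add => //; apply: dexp_mul; first exact: exp_dexp (exp_const _ _).
apply: dexp_mul => //; apply: dexp_mul; first exact: exp_dexp exp_penalty_weight.
apply: dexp_pow; first exact: dexp_add (exp_dexp (exp_const _ _)) hc.
exact: exp_mul exp_penalty_power (exp_const _ _).
Qed.

Lemma dexp_bernstein_degree : dexp_bounded n (bernstein_degree n m N).
Proof.
have cst c := exp_dexp (exp_const n c).
apply: dexp_add => //; apply: dexp_add; last exact: exp_dexp exp_penalized_degree.
apply: dexp_mul.
  apply: dexp_mul; last exact: dexp_pow (exp_dexp exp_penalized_degree) (exp_const _ _).
  apply: dexp_mul dexp_penalized_norm _.
  exact: dexp_pow (cst _) exp_penalized_degree.
apply: dexp_mul => //; apply: exp_dexp; exact: exp_of_linear linear_pos_exponent.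
Qed.

Lemma dexp_putinar_degree : dexp_bounded n (putinar_degree n m N D0).
Proof.
have cst c := exp_dexp (exp_const n c).
apply: dexp_add; last exact: exp_dexp (linear_exp linear_degree).
apply: dexp_add; last exact: exp_dexp exp_penalized_degree.
apply: dexp_add => //; apply: dexp_mul => //; apply: dexp_add => //.
exact: dexp_mul (cst _) dexp_bernstein_degree.
Qed.

End PutinarDegreeGrowth.

(** * Closedness of the truncated quadratic module *)

Section FewSquares.
Variables (R : realType) (n k : nat).
Implicit Types (p q : {mpoly R[n]}) (A : pred 'X_{1..n}).

Definition supp_in A p := forall mu, p@_mu != 0 -> A mu.

Lemma supp_in0 A : supp_in A 0.
Proof. by move=> mu; rewrite mcoeff0 eqxx. Qed.

Lemma supp_inD A p q : supp_in A p -> supp_in A q -> supp_in A (p + q).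
Proof.
move=> hp hq mu; rewrite mcoeffD; have [->|/hp //] := eqVneq p@_mu 0.
by rewrite add0r; exact: hq.
Qed.

Lemma supp_inZ A c p : supp_in A p -> supp_in A (c *: p).
Proof.
by move=> hp mu; rewrite mcoeffZ mulf_eq0 negb_or => /andP[_]; exact: hp.
Qed.

Lemma max_mlead (s : seq {mpoly R[n]}) : (forall q, q \in s -> q = 0) \/
  exists p, [/\ p \in s, p != 0 & forall q, q \in s -> (mlead q <= mlead p)%O].
Proof.
elim: s => [|r s IH]; first by left.
have [->|r0] := eqVneq r 0.
  case: IH => [h|[p [ps p0 hp]]]; [left|right; exists p].
    by move=> q; rewrite inE => /orP[/eqP|/h].
  split=> //; first by rewrite inE ps orbT.
  by move=> q; rewrite inE => /orP[/eqP ->|/hp //]; rewrite mlead0 le0m.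
right; case: IH => [h|[p [ps p0 hp]]].
  exists r; split=> // [|q]; first by rewrite inE eqxx.
  by rewrite inE => /orP[/eqP ->|/h ->]; rewrite ?mlead0 ?le0m.
have [pr|rp] := leP (mlead p) (mlead r).
  exists r; split=> // [|q]; first by rewrite inE eqxx.
  by rewrite inE => /orP[/eqP ->|/hp /le_trans]; [|apply].
exists p; split=> // [|q]; first by rewrite inE ps orbT.
by rewrite inE => /orP[/eqP ->|/hp //]; exact: ltW.
Qed.

(* The leading coefficients of the squares cannot cancel. *)
Lemma sos_supp (s : seq {mpoly R[n]}) q mu : q \in s -> q@_mu != 0 ->
  (2 * mdeg mu < msize (\sum_(q <- s) q ^+ 2)%R)%N.
Proof.
move=> qs qmu; set sigma := \sum_(_ <- _) _.
have [/(_ q qs) q0|[p [ps p0 hp]]] := max_mlead s.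
  by rewrite q0 mcoeff0 eqxx in qmu.
pose M := mlead p; have pM : p@_M != 0 by rewrite mleadc_eq0.
have hc : sigma@_(M + M) = \sum_(q <- s) q@_M ^+ 2.
  rewrite raddf_sum big_seq [RHS]big_seq; apply: eq_bigr => r rs /=.
  by rewrite expr2 mleadcMW ?hp.
have : sigma@_(M + M) != 0.
  rewrite hc gt_eqF // (big_rem p) //=; apply: ltr_wpDr.
    by rewrite sumr_ge0 // => r _; rewrite sqr_ge0.
  by rewrite exprn_even_gt0.
rewrite -mcoeff_msupp => /msize_mdeg_lt; rewrite mdegD.
have : (mdeg mu <= mdeg M)%N.
  apply: lemc_mdeg; apply: le_trans (hp q qs).
  by apply: msupp_le_mlead; rewrite mcoeff_msupp.
by lia.
Qed.

(* If [q_l = \sum_i a_i q_i] then [q_l] is absorbed by [q_i + b a_i q_l], since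
   [(1 + b a a^T)^2 = 1 + a a^T] for [b = 1 / (1 + sqrt (1 + |a|^2))]. *)
Lemma drop_square A L (q : 'I_L.+1 -> {mpoly R[n]}) (c : 'I_L.+1 -> R) l :
  (forall i, supp_in A (q i)) -> c l != 0 -> \sum_i c i *: q i = 0 ->
  exists q' : 'I_L -> {mpoly R[n]}, (forall i, supp_in A (q' i)) /\
    \sum_i q i ^+ 2 = \sum_i q' i ^+ 2.
Proof.
move=> qA cl hq; pose a (i : 'I_L) := - (c (lift l i) / c l).
have ql : q l = \sum_i a i *: q (lift l i).
  move/eqP: hq; rewrite (bigD1_ord l) //= addr_eq0 => /eqP hq.
  rewrite -[LHS]scale1r -(mulVf cl) -scalerA hq scalerN scaler_sumr -sumrN.
  by apply: eq_bigr => i _; rewrite scalerA -scaleNr mulrC.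
pose s := \sum_i a i ^+ 2.
have s0 : 0 <= s by apply: sumr_ge0 => i _; rewrite sqr_ge0.
pose r := Num.sqrt (1 + s).
have r0 : 0 <= r := sqrtr_ge0 _.
have r2 : r ^+ 2 = 1 + s by rewrite sqr_sqrtr // addr_ge0.
pose b := (1 + r)^-1.
have hb : 2 * b + b ^+ 2 * s = 1.
  have -> : s = r ^+ 2 - 1 by rewrite r2; ring.
  by rewrite /b; field; rewrite gt_eqF //; lra.
exists (fun i => q (lift l i) + (b * a i) *: q l); split.
  by move=> i; apply: supp_inD => //; exact: supp_inZ.
rewrite (bigD1_ord l) //=.
under [RHS]eq_bigr => i _ do rewrite sqrrD.
rewrite !big_split /= -addrA addrC; congr (_ + _).
have -> : \sum_i q (lift l i) * ((b * a i) *: q l) = b *: q l ^+ 2.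
  rewrite expr2 {2}ql mulr_suml scaler_sumr; apply: eq_bigr => i _.
  by rewrite -scalerAr -scalerAl scalerA.
have -> : \sum_i ((b * a i) *: q l) ^+ 2 = (b ^+ 2 * s) *: q l ^+ 2.
  rewrite mulr_sumr scaler_suml; apply: eq_bigr => i _.
  by rewrite exprZn exprMn.
by rewrite -!scalerDl -mulr2n -mulr_natl hb scale1r.
Qed.

Local Notation T := #|{: 'X_{1..n < k.+1}}|.

(** More than [T] polynomials in a space of dimension [T] are linearly dependent, so [drop_square]
    removes one; induction on their number. *)
Lemma few_squares A L (q : 'I_L -> {mpoly R[n]}) :
  (forall i, supp_in A (q i)) -> (forall i, (msize (q i) <= k.+1)%N) ->
  exists q' : 'I_T -> {mpoly R[n]},
    (forall i, supp_in A (q' i)) /\ \sum_i q i ^+ 2 = \sum_i q' i ^+ 2.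
Proof.
(* The degree bound is put into the support condition, which [drop_square] preserves. *)
pose A' := [pred mu | A mu & (mdeg mu <= k)%N].
move=> qA qk.
suff [q' [q'A q'E]] : exists q' : 'I_T -> {mpoly R[n]},
    (forall i, supp_in A' (q' i)) /\ \sum_i q i ^+ 2 = \sum_i q' i ^+ 2.
  by exists q'; split=> // i mu /q'A /andP[].
have {qA qk} qA i : supp_in A' (q i).
  move=> mu h; apply/andP; split; [exact: qA h|have := qk i].
  by rewrite -mcoeff_msupp in h; move/msize_mdeg_lt: h; move: (msize _); lia.
elim: L q qA => [|L IH] q qA.
  exists (fun=> 0); split; first by move=> i; exact: supp_in0.
  by rewrite big_ord0 big1 // => i _; rewrite expr0n.
have [LT|TL] := leqP L.+1 T.
  (* Short families are padded with zeros. *)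
  pose q' (i : 'I_T) := if insub (val i) is Some j then q j else 0.
  exists q'; split; first by move=> i; rewrite /q'; case: insub => [j|]; [|exact: supp_in0].
  pose F (i : nat) := if insub i is Some j then q j ^+ 2 else 0.
  transitivity (\sum_(i < T) F i).
    rewrite [RHS](bigID (fun i : 'I_T => (i < L.+1)%N)) /=.
    rewrite [X in _ + X]big1 => [|i]; last by rewrite /F; case: insubP => // j ->.
    rewrite addr0 -(big_ord_widen T F LT); apply: eq_bigr => i _.
    by rewrite /F valK.
  by apply: eq_bigr => i _; rewrite /F /q'; case: insub => //; rewrite expr0n.
(* A nonzero vector in the left kernel of the coefficient matrix is a linear dependence. *)
pose C := \matrix_(i < L.+1, j < T) (q i)@_(enum_val j : 'X_{1..n < k.+1}).
have : kermx C != 0.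
  rewrite -mxrank_eq0 mxrank_ker subn_eq0 -ltnNge.
  exact: leq_ltn_trans (rank_leq_col C) TL.
case/rowV0Pn => c /sub_kermxP cC c0.
have [l cl] : exists l, c 0 l != 0.
  apply/existsP; apply: contraNT c0 => /existsPn h; apply/eqP/rowP => l.
  by rewrite mxE; apply/eqP; rewrite -[_ == _]negbK h.
have [|q' [q'A ->]] := @drop_square A' L q (fun i => c 0 i) l qA cl; last exact: IH.
apply/mpolyP => mu; rewrite mcoeff0 raddf_sum /=.
under eq_bigr => i _ do rewrite mcoeffZ.
have [hmu|hmu] := ltnP (mdeg mu) k.+1; last first.
  rewrite big1 // => i _; have [->|/qA] := eqVneq (q i)@_mu 0; first by rewrite mulr0.
  by move=> /andP[_]; rewrite leqNgt hmu.
move/rowP/(_ (enum_rank (BMultinom hmu))): cC; rewrite !mxE => h.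
rewrite -[RHS]h; apply: eq_bigr => i _; by rewrite mxE enum_rankK.
Qed.

End FewSquares.

(** * Coercivity of the map from square roots to the module *)

Section Closedness.
Variables (R : realType) (n m k : nat) (g : 'I_m -> {mpoly R[n]}).
Variables (x0 : 'I_n -> R) (r : R).
Hypothesis r_gt0 : 0 < r.
Hypothesis cube_in_S : forall y : 'I_n -> R, (forall i, `|y i - x0 i| < r) -> inS g y.

(** Treats the free sum of squares as the multiplier of [g_0 = 1]. *)
Definition with_unit (j : 'I_m.+1) : {mpoly R[n]} := oapp g 1 (unlift ord0 j).
Local Notation h := with_unit.
Local Notation T := #|{: 'X_{1..n < k.+1}}|.
Local Notation V := ('I_m.+1 * 'I_T * 'X_{1..n < k.+1})%type.
Implicit Types (v : V -> R) (j : 'I_m.+1) (t : 'I_T).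

(* The degree condition under which [q ^ 2 * h j] has degree at most [2 k]. *)
Definition allowed j (mu : 'X_{1..n}) :=
  (h j != 0) && (2 * mdeg mu + pdeg (h j) <= k.*2)%N.

Definition square_root v j t : {mpoly R[n]} :=
  \sum_(mu : 'X_{1..n < k.+1} | allowed j mu) v (j, t, mu) *: 'X_[mu].

Definition gram_sum v : {mpoly R[n]} :=
  \sum_j (\sum_t square_root v j t ^+ 2) * h j.

Definition gram_norm v : R :=
  \sum_(nu : 'X_{1..n < k.*2.+1}) (gram_sum v)@_nu ^+ 2.

Definition coef_polyfun (P : (V -> R) -> {mpoly R[n]}) :=
  forall nu, polyfun (fun v => (P v)@_nu).

Lemma coef_polyfunM P Q : coef_polyfun P -> coef_polyfun Q ->
  coef_polyfun (fun v => P v * Q v).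
Proof.
move=> hP hQ nu; apply: (@polyfun_ext _ _ (fun v =>
  \sum_(a : 'X_{1..n < (mdeg nu).+1, (mdeg nu).+1} | nu == (a.1 + a.2)%MM)
    (P v)@_a.1 * (Q v)@_a.2)).
  by move=> v; rewrite mcoeffM.
by apply: polyfun_sum => a; apply: polyfunM; [exact: hP|exact: hQ].
Qed.

Lemma coef_polyfun_sum (I : Type) (s : seq I) (P : pred I) F :
  (forall i, coef_polyfun (F i)) -> coef_polyfun (fun v => \sum_(i <- s | P i) F i v).
Proof.
move=> hF nu; apply: (@polyfun_ext _ _ (fun v => \sum_(i <- s | P i) (F i v)@_nu)).
  by move=> v; rewrite raddf_sum.
by apply: polyfun_sum => i; exact: hF.
Qed.

Lemma coef_polyfun_gram_sum : coef_polyfun gram_sum.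
Proof.
apply: coef_polyfun_sum => j; apply: coef_polyfunM; last first.
  by move=> nu; exact: polyfun_cst.
apply: coef_polyfun_sum => t.
have hs : coef_polyfun (fun v => square_root v j t).
  apply: coef_polyfun_sum => mu nu.
  apply: (@polyfun_ext _ _ (fun v => v (j, t, mu) * ('X_[mu] : {mpoly R[n]})@_nu)).
    by move=> v; rewrite mcoeffZ.
  by apply: polyfunM; [exact: polyfun_proj|exact: polyfun_cst].
by move=> nu; apply: polyfun_ext (coef_polyfunM hs hs nu) => v; rewrite expr2.
Qed.

Lemma polyfun_gram_norm : polyfun gram_norm.
Proof.
by apply: polyfun_sum => nu; apply: polyfunX; exact: coef_polyfun_gram_sum.
Qed.

Lemma square_root_coef v j t (mu : 'X_{1..n < k.+1}) : allowed j mu ->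
  (square_root v j t)@_mu = v (j, t, mu).
Proof.
move=> hmu; rewrite raddf_sum (bigD1 mu) //= mcoeffZ mcoeffX eqxx mulr1.
rewrite big1 ?addr0 // => nu /andP[_ nm]; rewrite mcoeffZ mcoeffX.
by rewrite (negPf (_ : (nu : 'X_{1..n}) != mu)) ?mulr0 // -bmeqP.
Qed.

Lemma square_root_supp v j t : supp_in (allowed j) (square_root v j t).
Proof.
move=> mu; rewrite raddf_sum /=; apply: contraR => hmu; apply/eqP; apply: big1 => nu hnu.
rewrite mcoeffZ mcoeffX; case: eqP => [e|]; last by rewrite mulr0.
by rewrite -e hnu in hmu.
Qed.

Lemma square_deg v j t : (msize (square_root v j t ^+ 2 * h j) <= k.*2.+1)%N.
Proof.
have [hj|hj] := leqP (pdeg (h j)) k.*2; last first.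
  have -> : square_root v j t = 0; last by rewrite expr0n mul0r msize0.
  apply/mpolyP => mu; rewrite mcoeff0; apply/eqP; apply: contraT => /square_root_supp.
  by rewrite /allowed => /andP[_]; lia.
have -> : k.*2.+1 = ((k.*2 - pdeg (h j)) + pdeg (h j)).+1 by rewrite subnK.
apply: msizeM_bound; last by rewrite /pdeg; move: (msize (h j)); lia.
have hs : (msize (square_root v j t) <= ((k.*2 - pdeg (h j))./2).+1)%N.
  rewrite msizeE big_seq; elim/big_ind: _ => // [a b|mu]; first by rewrite geq_max => ->.
  rewrite mcoeff_msupp => /square_root_supp /andP[_].
  by move: (k.*2) hj => K hj; lia.
apply: leq_trans (msizeX_bound 2 hs) _; rewrite ltnS.
by move: (k.*2 - _)%N => a; lia.
Qed.

Lemma gram_sum_deg v : (msize (gram_sum v) <= k.*2.+1)%N.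
Proof.
apply: msize_sum_bound => j _; rewrite mulr_suml.
by apply: msize_sum_bound => t _; exact: square_deg.
Qed.

Lemma with_unit_ge0 j y : (forall i, `|y i - x0 i| < r) -> 0 <= (h j).@[y].
Proof.
move=> /cube_in_S hy; rewrite /h; case: unliftP => [i _|_] /=; first exact: hy.
by rewrite meval1.
Qed.

Lemma gram_norm0 v : gram_norm v = 0 -> gram_sum v = 0.
Proof.
move=> hv; rewrite (mpolywE (gram_sum_deg v)) big1 // => nu _.
have := psumr_eq0P (fun (i : 'X_{1..n < k.*2.+1}) _ => sqr_ge0 ((gram_sum v)@_i)) hv.
by move=> /(_ nu isT) /eqP; rewrite sqrf_eq0 => /eqP ->; rewrite scale0r.
Qed.

(** On the cube inside [S] all terms are nonnegative, so each of them vanishes there; thus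
    [square_root v j t * h j] is zero on a cube, hence zero, while [h j] is not. *)
Lemma gram_sum_inj v j t (mu : 'X_{1..n < k.+1}) : gram_sum v = 0 ->
  allowed j mu -> v (j, t, mu) = 0.
Proof.
move=> hv hmu; rewrite -square_root_coef //.
suff : square_root v j t * h j = 0.
  move/eqP; rewrite mulf_eq0; case/andP: hmu => /negPf -> _; rewrite orbF => /eqP ->.
  by rewrite mcoeff0.
apply: (mpoly_eq0_cube r_gt0) => y hy.
have h0 j' : 0 <= ((\sum_t square_root v j' t ^+ 2) * h j').@[y].
  rewrite mevalM mulr_ge0 ?with_unit_ge0 //; apply: sos_ge0.
  by apply: sos_sum => t' _; exact: sos_sqr.
have : (gram_sum v).@[y] = 0 by rewrite hv meval0.
rewrite /gram_sum (raddf_sum (meval y)) /= => /(psumr_eq0P (fun j' _ => h0 j')).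
move=> /(_ j isT); rewrite mevalM (raddf_sum (meval y)) /= mulr_suml.
have h1 t' : 0 <= (square_root v j t' ^+ 2).@[y] * (h j).@[y].
  by rewrite mulr_ge0 ?with_unit_ge0 //; apply: sos_ge0; exact: sos_sqr.
move=> /(psumr_eq0P (fun t' _ => h1 t')) /(_ t isT) /eqP.
rewrite rmorphXn /= mulf_eq0 sqrf_eq0 -mulf_eq0 => /eqP.
by rewrite mevalM.
Qed.

Lemma gram_sumZ a v : gram_sum (fun i => a * v i) = a ^+ 2 *: gram_sum v.
Proof.
rewrite /gram_sum scaler_sumr; apply: eq_bigr => j _.
rewrite scalerAl; congr (_ * _); rewrite scaler_sumr; apply: eq_bigr => t _.
rewrite -exprZn; congr (_ ^+ 2); rewrite /square_root scaler_sumr.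
by apply: eq_bigr => mu _; rewrite scalerA.
Qed.

Lemma gram_normZ a v : gram_norm (fun i => a * v i) = a ^+ 4 * gram_norm v.
Proof.
rewrite /gram_norm mulr_sumr; apply: eq_bigr => nu _.
by rewrite gram_sumZ mcoeffZ exprMn -exprM.
Qed.

Definition allowed_var (c : V) := allowed c.1.1 c.2.

(** [kappa] is the minimum over the face [v c = 1] of the cube [[-1, 1]^V]; the value 0 would force
    [v c = 0] by [gram_sum_inj]. *)
Lemma face_min (c : V) : exists kappa : R, 0 < kappa /\ (allowed_var c ->
  forall v, v c = 1 -> (forall i, `|v i| <= 1) -> kappa <= gram_norm v).
Proof.
have [hc|hc] := boolP (allowed_var c); last by exists 1; split.
have [|v [hv vmin]] := @polyfun_min R V (fun i => if i == c then 1 else -1)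
  (fun=> 1) _ _ polyfun_gram_norm.
  by move=> i; case: ifP => _; rewrite ?lexx // ge0_cp.
exists (gram_norm v); split; last first.
  move=> _ u uc hu; apply: vmin => i; case: eqP => [->|_]; first by rewrite uc lexx.
  by rewrite -ler_norml.
have n0 : 0 <= gram_norm v by apply: sumr_ge0 => nu _; rewrite sqr_ge0.
rewrite lt_neqAle n0 andbT eq_sym; apply/eqP => /gram_norm0 hg.
have vc : v c = 1 by apply/eqP; rewrite eq_le; have := hv c; rewrite eqxx andbC.
move: c hc vc {vmin hv} => [[j t] mu] hc vc.
by have := gram_sum_inj t hg hc; rewrite vc => /eqP; rewrite oner_eq0.
Qed.

Lemma gram_coercive : exists rho : R -> R, forall B, 0 <= B -> 0 <= rho B /\
  forall v, (forall c, ~~ allowed_var c -> v c = 0) -> gram_norm v <= B ->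
  forall i, `|v i| <= rho B.
Proof.
have [kappa hk] := boolp.choice face_min.
have k0 c : 0 < kappa c by case: (hk c).
exists (fun B => 1 + \sum_c B / kappa c) => B B0.
have s0 : 0 <= \sum_c B / kappa c by apply: sumr_ge0 => c _; rewrite divr_ge0 // ltW.
split; first by rewrite addr_ge0.
move=> v hv hB i.
have [c _ hmax] := arg_maxP (fun c => `|v c|) (isT : predT i).
apply: le_trans (hmax i isT) _.
have [->|vc] := eqVneq (v c) 0; first by rewrite normr0 addr_ge0.
have hc : allowed_var c by apply: contraNT vc => /hv ->.
have [_ /(_ hc (fun i => (v c)^-1 * v i))] := hk c.
rewrite mulVf // => /(_ erefl) hf.
have {}hf : kappa c <= (v c)^-1 ^+ 4 * gram_norm v.
  rewrite -gram_normZ; apply: hf => i'.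
  by rewrite normrM normfV ler_pdivrMl ?normr_gt0 // mulr1; exact: hmax.
have h4 : `|v c| ^+ 4 * kappa c <= B.
  apply: le_trans hB; have -> : `|v c| ^+ 4 = v c ^+ 4.
    by rewrite -normrX ger0_norm // exprn_even_ge0.
  by rewrite mulrC -ler_pdivlMr ?exprn_even_gt0 // mulrC -exprVn.
have h5 : `|v c| ^+ 4 <= B / kappa c by rewrite ler_pdivlMr.
apply: (@le_trans _ _ (1 + B / kappa c)); last first.
  by rewrite lerD2l (bigD1 c) //= lerDl; apply: sumr_ge0 => c' _; rewrite divr_ge0 // ltW.
have [h1|h1] := leP `|v c| 1; first by rewrite ler_wpDr // (le_trans _ h5) // exprn_ge0.
apply: le_trans (_ : `|v c| ^+ 4 <= _); first by rewrite ler_eXnr // ltW.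
by apply: le_trans h5 _; rewrite lerDr.
Qed.

(** By [sos_supp] the degree of a sum of squares bounds that of each root, so the roots have allowed
    monomials; [few_squares] then reduces their number to [T]. *)
Lemma allowed_squares j s : is_sos s -> (msize (s * h j) <= k.*2.+1)%N ->
  exists q : 'I_T -> {mpoly R[n]}, (forall t, supp_in (allowed j) (q t)) /\
    s * h j = (\sum_t q t ^+ 2) * h j.
Proof.
have [hj|hj] := eqVneq (h j) 0.
  exists (fun=> 0); split; first by move=> t; exact: supp_in0.
  by rewrite hj !mulr0.
move=> [l ->] hd; set s' := \sum_(_ <- _) _ in hd *.
have hl (i : 'I_(size l)) mu : (tnth (in_tuple l) i)@_mu != 0 -> allowed j mu.
  move=> hmu; have hs : (2 * mdeg mu < msize s')%N.
    exact: sos_supp (mem_tnth i (in_tuple l)) hmu.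
  rewrite /allowed hj /=; have s0 : s' != 0 by rewrite -msize_poly_eq0 -lt0n (leq_ltn_trans _ hs).
  move: hs hd; rewrite msizeM // /pdeg.
  have : (0 < msize (h j))%N by rewrite lt0n msize_poly_eq0.
  by move: (msize s') (msize (h j)) (k.*2) => a b c; lia.
have hsz (i : 'I_(size l)) : (msize (tnth (in_tuple l) i) <= k.+1)%N.
  rewrite msizeE big_seq; elim/big_ind: _ => // [a b|mu]; first by rewrite geq_max => ->.
  rewrite mcoeff_msupp => /hl /andP[_ hm].
  by have hk : (mdeg mu < k.+1)%N by lia.
have [q [qA qE]] := few_squares hl hsz.
exists q; split=> //; congr (_ * _); rewrite -qE /s'.
by rewrite (big_tnth _ _ l).
Qed.

Lemma QmodD_gram_sum p : QmodD g k.*2 p ->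
  exists v, (forall c, ~~ allowed_var c -> v c = 0) /\ gram_sum v = p.
Proof.
move=> [s0 [s [s0s [ss [d0 [ds ->]]]]]].
pose sigma j := oapp s s0 (unlift ord0 j).
have sq j : exists q : 'I_T -> {mpoly R[n]}, (forall t, supp_in (allowed j) (q t)) /\
    sigma j * h j = (\sum_t q t ^+ 2) * h j.
  apply: allowed_squares; rewrite /sigma /h; case: unliftP => [i _|_] //=.
  by rewrite mulr1.
have [q hq] := boolp.choice sq.
pose v (c : V) := if allowed_var c then (q c.1.1 c.1.2)@_c.2 else 0.
exists v; split; first by move=> c /negPf; rewrite /v => ->.
have vq j t : square_root v j t = q j t.
  apply/mpolyP => mu; have [hmu|hmu] := boolP (allowed j mu); last first.
    have [->|/(proj1 (hq j))] := eqVneq (q j t)@_mu 0; last by rewrite (negPf hmu).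
    have [//|/square_root_supp] := eqVneq (square_root v j t)@_mu 0.
    by rewrite (negPf hmu).
  have kmu : (mdeg mu < k.+1)%N by case/andP: hmu => _; lia.
  rewrite -[mu]/(val (BMultinom kmu)) (square_root_coef v t (mu := BMultinom kmu)) //.
  by rewrite /v /allowed_var /= hmu.
rewrite /gram_sum.
transitivity (\sum_j sigma j * h j).
  apply: eq_bigr => j _; rewrite (proj2 (hq j)); congr (_ * _).
  by apply: eq_bigr => t _; rewrite vq.
rewrite big_ord_recl /sigma /h unlift_none /= mulr1; congr (_ + _).
by apply: eq_bigr => i _; rewrite liftK.
Qed.

(** By coercivity one compact box contains representing vectors of [f - b] for all admissible [b]
    near [b0]. The distance from [gram_sum v] to [f - b0] attains its minimum on this box, and the
    minimum is 0. *)
Lemma QmodD_closed f b0 :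
  (forall e, 0 < e -> exists2 b, b0 - e <= b <= b0 & QmodD g k.*2 (f - b%:MP)) ->
  QmodD g k.*2 (f - b0%:MP).
Proof.
move=> hb.
pose W := maxn k.*2.+1 (maxn (msize f) 1).
have repr b := @QmodD_gram_sum (f - b%:MP).
(* Bounds the squared norm of [f - b] for all [b] with [|b - b0| <= 1]. *)
pose B : R := \sum_(nu : 'X_{1..n < k.*2.+1}) (`|f@_nu| + `|b0| + 1) ^+ 2.
have B0 : 0 <= B by apply: sumr_ge0 => nu _; rewrite sqr_ge0.
have [rho /(_ B B0) [rho0 hrho]] := gram_coercive.
pose dist v : R := \sum_(nu : 'X_{1..n < W}) ((f - b0%:MP)@_nu - (gram_sum v)@_nu) ^+ 2.
have pdist : polyfun dist.
  apply: polyfun_sum => nu; apply: polyfunX; apply: polyfunD; first exact: polyfun_cst.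
  exact: polyfunN (coef_polyfun_gram_sum _).
have [|v [_ vmin]] := @polyfun_min R V (fun=> - rho B) (fun=> rho B) _ _ pdist.
  by move=> _; rewrite ge0_cp.
have d0 : dist v <= 0.
  apply/ler_addgt0Pr => e e0; rewrite add0r.
  (* As [|b - b0| <= 1], the squared distance is at most [|b - b0| <= e]. *)
  pose e' := Num.min e 1.
  have e'0 : 0 < e' by rewrite lt_min e0 ltr01.
  have [b hbb /repr [u [u0 hu]]] := hb e' e'0.
  have be : `|b - b0| <= e' by rewrite ler_norml; lra.
  have be1 : `|b - b0| <= 1 by apply: le_trans be _; rewrite ge_min lexx orbT.
  apply: le_trans (vmin u _) _.
    move=> c; rewrite -ler_norml; apply: hrho => //.
    rewrite /gram_norm hu; apply: ler_sum => nu _.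
    rewrite -[leLHS]real_normK ?num_real // lerXn2r ?nnegrE ?addr_ge0 //.
    rewrite mcoeffB mcoeffC; apply: le_trans (ler_normB _ _) _.
    rewrite -addrA lerD2l normrM; case: (_ == _); last by rewrite normr0 mulr0 addr_ge0.
    rewrite normr1 mulr1; have := ler_normD (b - b0) b0; rewrite subrK; lra.
  have fb : f - b0%:MP - (f - b%:MP) = (b - b0)%:MP by rewrite mpolyCB; ring.
  rewrite /dist hu; under eq_bigr => nu _ do rewrite -mcoeffB fb mcoeffC.
  have W0 : (mdeg (0%MM : 'X_{1..n}) < W)%N by rewrite mdeg0 /W; lia.
  rewrite (bigD1 (BMultinom W0)) //= eqxx mulr1 big1 ?addr0 => [|nu hnu]; last first.
    rewrite (negPf (_ : (nu : 'X_{1..n}) != 0%MM)) ?mulr0 ?expr0n //.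
  rewrite -real_normK ?num_real //; apply: (@le_trans _ _ `|b - b0|); last first.
    by apply: le_trans be _; rewrite ge_min lexx.
  by rewrite expr2 ler_piMl.
have dz : dist v = 0.
  by apply/le_anti; rewrite d0 /=; apply: sumr_ge0 => nu _; rewrite sqr_ge0.
have -> : f - b0%:MP = gram_sum v.
  apply/eqP; rewrite -subr_eq0; apply/eqP.
  have hW : (msize (f - b0%:MP - gram_sum v) <= W)%N.
    apply: msizeD_bound.
      apply: msizeD_bound; first by rewrite /W !leq_max leqnn orbT.
      by rewrite msizeN (leq_trans (msizeC_le _ _)) // /W !leq_max leqnn !orbT.
    by rewrite msizeN (leq_trans (gram_sum_deg _)) // /W leq_max leqnn.
  rewrite (mpolywE hW) big1 // => nu _.
  have := psumr_eq0P (fun (i : 'X_{1..n < W}) _ =>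
    sqr_ge0 ((f - b0%:MP)@_i - (gram_sum v)@_i)) dz.
  by move=> /(_ nu isT) /eqP; rewrite sqrf_eq0 -mcoeffB => /eqP ->; rewrite scale0r.
exists (\sum_t square_root v ord0 t ^+ 2), (fun i => \sum_t square_root v (lift ord0 i) t ^+ 2).
have sos j : is_sos (\sum_t square_root v j t ^+ 2).
  by apply: sos_sum => t _; exact: sos_sqr.
split; first exact: sos.
split; first by move=> i; exact: sos.
have hdeg j : (msize ((\sum_t square_root v j t ^+ 2) * h j) <= k.*2.+1)%N.
  by rewrite mulr_suml; apply: msize_sum_bound => t _; exact: square_deg.
have h0 : h ord0 = 1 by rewrite /h unlift_none.
have hS i : h (lift ord0 i) = g i by rewrite /h liftK.
split; first by have := hdeg ord0; rewrite h0 mulr1.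
split; first by move=> i; have := hdeg (lift ord0 i); rewrite hS.
rewrite /gram_sum big_ord_recl h0 mulr1; congr (_ + _).
by apply: eq_bigr => i _; rewrite hS.
Qed.

End Closedness.

(** * Interior of the cone of sums of squares *)

Section Interior.
Variables (R : realType) (n : nat).
Implicit Types (p s : {mpoly R[n]}) (mu alpha beta : 'X_{1..n}).

Definition square_monomials r : {mpoly R[n]} :=
  \sum_(a : 'X_{1..n < r.+1}) 'X_[a] ^+ 2.

Lemma monomial_divisor mu e : (e <= mdeg mu)%N ->
  exists2 alpha, (alpha <= mu)%MM & mdeg alpha = e.
Proof.
elim: e => [|e IH] he; first by exists 0%MM; rewrite ?mdeg0 //; apply/mnm_lepP => i; rewrite mnm0E.
have [alpha /mnm_lepP ha hd] := IH (ltnW he).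
have [i hi] : exists i, (alpha i < mu i)%N.
  apply/existsP; apply: contraTT he => /existsPn h; rewrite -leqNgt -hd !mdegE.
  by apply: leq_sum => i _; rewrite leqNgt h.
exists (alpha + U_(i))%MM; last by rewrite mdegD mdeg1 hd addn1.
apply/mnm_lepP => j; rewrite mnmDE mnm1E; case: eqP => [<-|_]; first by rewrite addn1.
by rewrite addn0.
Qed.

Lemma monomial_half mu r : (mdeg mu <= 2 * r)%N ->
  exists alpha beta, [/\ mu = (alpha + beta)%MM, mdeg alpha <= r & mdeg beta <= r]%N.
Proof.
move=> hmu; have [alpha ha hd] := @monomial_divisor mu (minn r (mdeg mu)) (geq_minr _ _).
exists alpha, (mu - alpha)%MM; split; first by rewrite addmC submK.
  by rewrite hd geq_minl.
have : (mdeg (mu - alpha) + mdeg alpha = mdeg mu)%N by rewrite -mdegD submK.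
by rewrite hd; lia.
Qed.

Lemma sos_sub_square r alpha : (mdeg alpha <= r)%N ->
  is_sos (square_monomials r - 'X_[alpha] ^+ 2).
Proof.
move=> ha; rewrite /square_monomials (bigD1 (BMultinom (ha : (mdeg alpha < r.+1)%N))) //=.
by rewrite addrAC subrr add0r; apply: sos_sum => b _; exact: sos_sqr.
Qed.

(** The cross term is completed to the square of [A + sg * B], and the squares this needs are taken
    from [square_monomials]. *)
Lemma sos_square_monomials_monomial r mu (e a : R) : (mdeg mu <= 2 * r)%N ->
  `|a| <= e -> is_sos (e *: square_monomials r + a *: 'X_[mu]).
Proof.
move=> /monomial_half [alpha [beta [-> ha hb]]] hae.
have e0 : 0 <= e := le_trans (normr_ge0 a) hae.
rewrite mpolyXD; set A := 'X_[alpha]; set B := 'X_[beta]; set Th := square_monomials r.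
have [sg sg2 ha'] : exists2 sg : R, sg ^+ 2 = 1 & a = `|a| * sg.
  have [a0|a0] := leP 0 a; first by exists 1; rewrite ?expr1n // mulr1 ger0_norm.
  by exists (-1); rewrite ?sqrrN ?expr1n // mulrN1 ltr0_norm // opprK.
(* Each half of [Th] gives up one square, which also covers the case [A = B]. *)
have -> : e *: Th + a *: (A * B) = (e / 2) *: (Th - A ^+ 2) + (e / 2) *: (Th - B ^+ 2) +
    ((e - `|a|) / 2) *: (A ^+ 2 + B ^+ 2) + (`|a| / 2) *: (A + sg *: B) ^+ 2.
  apply: mpoly_eval_inj => x; rewrite {1}ha'.
  rewrite !expr2 !(mevalD, mevalN, mevalZ, mevalM).
  move: Th.@[x] A.@[x] B.@[x] => th u v.
  have -> : (u + sg * v) * (u + sg * v) = u * u + 2 * sg * u * v + 1 * (v * v).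
    by rewrite -[X in X * (v * v)]sg2; ring.
  by field.
apply: sosD; last first.
  by apply: sosZ; [rewrite divr_ge0 ?normr_ge0|exact: sos_sqr].
apply: sosD; last first.
  apply: sosZ; first by rewrite divr_ge0 ?subr_ge0.
  by apply: sosD; exact: sos_sqr.
by apply: sosD; apply: sosZ; rewrite ?divr_ge0 //; exact: sos_sub_square.
Qed.

Lemma msize_square_monomials r : (msize (square_monomials r) <= (2 * r).+1)%N.
Proof.
apply: msize_sum_bound => a _; apply: msizeX_bound.
by rewrite msizeX; exact: bmdeg.
Qed.

(** The multiple of [square_monomials] is shared equally among the [T] monomials, and each share
    absorbs a perturbation of one coefficient. *)
Lemma interior_square_monomials r s (c : R) : 0 < c -> is_sos s ->
  (msize s <= (2 * r).+1)%N -> sos_interior r (s + c *: square_monomials r).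
Proof.
move=> c0 ss sd; split.
  apply: msizeD_bound => //.
  exact: leq_trans (msizeZ_le _ _) (msize_square_monomials r).
pose T := #|{: 'X_{1..n < (2 * r).+1}}|.
have h0 : (mdeg (0%MM : 'X_{1..n}) < (2 * r).+1)%N by rewrite mdeg0.
have T0 : 0 < T%:R :> R by rewrite ltr0n; apply/card_gt0P; exists (BMultinom h0).
exists (c / T%:R); split; first by rewrite divr_gt0.
move=> p pd hp; rewrite -addrA; apply: sosD => //.
have -> : c *: square_monomials r + p = \sum_(mu : 'X_{1..n < (2 * r).+1})
    ((c / T%:R) *: square_monomials r + p@_mu *: 'X_[mu]).
  rewrite big_split /= -(mpolywE pd) sumr_const -scaler_nat scalerA; congr (_ *: _ + _).
  by rewrite mulrC divfK // gt_eqF.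
apply: sos_sum => mu _; apply: sos_square_monomials_monomial; last exact: ltW.
by rewrite -ltnS bmdeg.
Qed.

Lemma mcoeff_le_mnorm p mu : `|p@_mu| <= mnorm p.
Proof.
have [hmu|/memN_msupp_eq0 ->] := boolP (mu \in msupp p); last by rewrite normr0 mnorm_ge0.
rewrite /mnorm (big_rem mu) //= lerDl; exact: sumr_ge0.
Qed.

Lemma interior_perturb r s p : sos_interior r s -> (msize p <= (2 * r).+1)%N ->
  exists2 eta : R, 0 < eta & sos_interior r (s + eta *: p).
Proof.
move=> [sd [e [e0 he]]] pd; have p0 := mnorm_ge0 p.
pose eta := e / (2 * (mnorm p + 1)).
have eta0 : 0 < eta by rewrite divr_gt0 // mulr_gt0 //; lra.
exists eta => //; split.
  by apply: msizeD_bound => //; exact: leq_trans (msizeZ_le _ _) pd.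
exists (e / 2); split; first by rewrite divr_gt0.
move=> q qd hq; rewrite -addrA; apply: he.
  by apply: msizeD_bound => //; exact: leq_trans (msizeZ_le _ _) pd.
move=> mu; rewrite mcoeffD mcoeffZ; apply: le_lt_trans (ler_normD _ _) _.
have h1 : `|eta * p@_mu| <= e / 2.
  rewrite normrM (gtr0_norm eta0) /eta mulrAC ler_pdivrMr ?mulr_gt0 //; last by lra.
  have := mcoeff_le_mnorm p mu => h2.
  have -> : e / 2 * (2 * (mnorm p + 1)) = e * (mnorm p + 1) by field.
  by rewrite ler_pM2l //; lra.
have := hq mu; lra.
Qed.

End Interior.

(** * Attainment of the supremum, and representations using the constraints of the unit box *)

Section Representations.
Variables (R : realType) (n m : nat) (g : 'I_m -> {mpoly R[n]}).
Implicit Types (f : {mpoly R[n]}).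

Lemma QmodD_const D (c : R) : 0 <= c -> QmodD g D c%:MP.
Proof.
move=> c0; exists c%:MP, (fun=> 0); split; first exact: sosC.
split; first by move=> i; exact: sos0.
split; first by rewrite (leq_trans (msizeC_le _ _)).
split; first by move=> i; rewrite mul0r msize0.
by rewrite big1 ?addr0 // => i _; rewrite mul0r.
Qed.

Lemma QmodD_ge0 D f x : QmodD g D f -> inS g x -> 0 <= f.@[x].
Proof.
move=> [s0 [s [s0s [ss [_ [_ ->]]]]]] hx.
rewrite mevalD (raddf_sum (meval x)) /= addr_ge0 ?sos_ge0 //.
apply: sumr_ge0 => i _; rewrite mevalM; apply: mulr_ge0; last exact: hx.
exact: sos_ge0.
Qed.

(** The set of admissible [b] contains [c] and is bounded above by [f.@[x0]]; closedness of the
    module turns its supremum into a member. *)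
Lemma fstarD_attained k f (x0 : 'I_n -> R) (r c : R) : 0 < r ->
  (forall y : 'I_n -> R, (forall i, `|y i - x0 i| < r) -> inS g y) ->
  QmodD g k.*2 (f - c%:MP) ->
  c <= fstarD g k.*2 f /\ QmodD g k.*2 (f - (fstarD g k.*2 f)%:MP).
Proof.
move=> r0 hcube hc.
pose E : set R := fun b => QmodD g k.*2 (f - b%:MP).
have hx0 : inS g x0 by apply: hcube => i; rewrite subrr normr0.
have hub : ubound E f.@[x0].
  by move=> b /QmodD_ge0/(_ hx0); rewrite mevalB mevalC subr_ge0.
have hE : has_sup E by split; [exists c|exists f.@[x0]].
split; first exact: sup_upper_bound.
apply: (QmodD_closed r0 hcube) => e e0.
have [b Eb hb] := sup_adherent e0 hE.
exists b => //; apply/andP; split; first exact: ltW.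
by apply: sup_upper_bound.
Qed.

(** With [M] monomials, [f - e * sum X^2a] is [(f - c) + (c - e * M) + sum e * (1 - X^2a)]. *)
Lemma QmodD_unit_box k f (c e : R) : QmodD g k.*2 (f - c%:MP) -> 0 <= e ->
  e * #|{: 'X_{1..n < k.+1}}|%:R <= c ->
  QmodD' g k k.*2 (f - e *: \sum_(a : 'X_{1..n < k.+1}) 'X_[a] ^+ 2).
Proof.
move=> [s0 [s [s0s [ss [d0 [ds hf]]]]]] e0 hc.
set M := #|_| in hc.
exists (s0 + (c - e * M%:R)%:MP), s, (fun=> e%:MP).
split; first by apply: sosD => //; apply: sosC; rewrite subr_ge0.
split=> //; split; first by move=> a; exact: sosC.
split.
  by apply: msizeD_bound => //; rewrite (leq_trans (msizeC_le _ _)).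
split=> //; split.
  move=> a; apply: (@msizeM_bound _ _ 0 k.*2); first exact: msizeC_le.
  apply: msizeD_bound; first by rewrite msize1.
  rewrite msizeN -mul2n; apply: msizeX_bound; rewrite msizeX; exact: bmdeg.
rewrite -(subrK c%:MP f) hf.
under [\sum_(a : 'X_{1..n < k.+1}) e%:MP * _]eq_bigr => a _ do rewrite mulrBr mulr1.
rewrite big_split /= sumr_const -/M.
have -> : \sum_(a : 'X_{1..n < k.+1}) - (e%:MP * 'X_[a] ^+ 2) =
    - (e *: \sum_(a : 'X_{1..n < k.+1}) 'X_[a] ^+ 2) :> {mpoly R[n]}.
  rewrite scaler_sumr -sumrN; apply: eq_bigr => a _; by rewrite mul_mpolyC.
have -> : e%:MP *+ M = (e * M%:R)%:MP :> {mpoly R[n]}.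
  by rewrite mulr_natr mpolyCMn.
rewrite mpolyCB; set S := \sum_(a : _) _; set U := e *: _; ring.
Qed.

(** With [c = e * M], the constant [c] is [e * sum X^2a + sum e * (1 - X^2a)], and the first sum
    makes [s0] interior. Small multiples of [square_monomials] then make the other multipliers
    interior; [s0] compensates for them and stays interior by [interior_perturb]. *)
Lemma interior_representation k k' f (c : R) :
  (forall i, (pdeg (g i) <= k.*2)%N) -> (k' < k)%N -> 0 < c ->
  QmodD g k'.*2 (f - c%:MP) ->
  exists (s0 : {mpoly R[n]}) (s : 'I_m -> {mpoly R[n]})
         (e : 'X_{1..n < k.+1} -> R),
    sos_interior (k.*2)./2 s0 /\
    (forall i, sos_interior (k.*2 - pdeg (g i))./2 (s i)) /\
    (msize s0 <= k.*2.+1)%N /\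
    (forall i, (msize (s i * g i) <= k.*2.+1)%N) /\
    (forall a, 0 < e a) /\
    f = s0 + \sum_(i < m) s i * g i
          + \sum_(a : 'X_{1..n < k.+1}) e a *: (1 - 'X_[a] ^+ 2).
Proof.
move=> gd kk c0 [s0 [s [s0s [ss [d0 [ds hf]]]]]].
pose M := #|{: 'X_{1..n < k.+1}}|.
have h0 : (mdeg (0%MM : 'X_{1..n}) < k.+1)%N by rewrite mdeg0.
have M0 : 0 < M%:R :> R by rewrite ltr0n; apply/card_gt0P; exists (BMultinom h0).
pose e := c / M%:R; have e0 : 0 < e by rewrite divr_gt0.
pose rr i := (k.*2 - pdeg (g i))./2.
(* For [g i = 0] the bound on the product says nothing about the degree of [s i]. *)
pose s' i := if g i == 0 then 0 else s i.
have sg i : s' i * g i = s i * g i.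
  by rewrite /s'; case: eqP => // ->; rewrite !mulr0.
have s's i : is_sos (s' i) by rewrite /s'; case: ifP => // _; exact: sos0.
(* [k' < k] absorbs the rounding in [rr i] when [pdeg (g i)] is odd. *)
have s'd i : (msize (s' i) <= (2 * rr i).+1)%N.
  rewrite /s'; have [_|gi] := eqVneq; first by rewrite msize0.
  have [->|si] := eqVneq (s i) 0; first by rewrite msize0.
  have := ds i; rewrite msizeM // /rr; have := gd i; rewrite /pdeg.
  have : (0 < msize (g i))%N by rewrite lt0n msize_poly_eq0.
  by move: (msize (s i)) (msize (g i)) => a b; clear -kk; lia.
have rg i : (msize (square_monomials R n (rr i) * g i) <= (2 * k).+1)%N.
  have -> : (2 * k = (k.*2 - pdeg (g i)) + pdeg (g i))%N by rewrite subnK // mul2n.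
  apply: msizeM_bound; last by rewrite /pdeg; move: (msize _); lia.
  apply: leq_trans; first exact: msize_square_monomials.
  rewrite ltnS /rr.
  by move: (_ - _)%N => a; lia.
have int0 : sos_interior k (s0 + e *: square_monomials R n k).
  by apply: interior_square_monomials => //; apply: leq_trans d0 _; lia.
pose Q := \sum_i square_monomials R n (rr i) * g i.
have Qd : (msize (- Q) <= (2 * k).+1)%N.
  by rewrite msizeN; apply: msize_sum_bound => i _; exact: rg.
have [eta eta0 hint] := interior_perturb int0 Qd.
exists (s0 + e *: square_monomials R n k + eta *: (- Q)),
  (fun i => s' i + eta *: square_monomials R n (rr i)), (fun=> e).
rewrite doubleK; split=> //.
split; first by move=> i; exact: interior_square_monomials.
split; first by case: hint => h _; rewrite -mul2n.
split.
  move=> i; rewrite mulrDl sg; apply: msizeD_bound.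
    by apply: leq_trans (ds i) _; lia.
  by rewrite -scalerAl -mul2n; apply: leq_trans (msizeZ_le _ _) (rg i).
split=> //.
under eq_bigr => i _ do rewrite mulrDl sg -scalerAl.
rewrite big_split /= -scaler_sumr -/Q -(scaler_sumr e).
have -> : \sum_(a : 'X_{1..n < k.+1}) (1 - 'X_[a] ^+ 2) =
    M%:R - square_monomials R n k :> {mpoly R[n]}.
  by rewrite sumrB sumr_const.
rewrite scalerN scalerBr.
have -> : e *: (M%:R : {mpoly R[n]}) = c%:MP.
  by rewrite -mpolyC_nat -mul_mpolyC -mpolyCM /e divfK // gt_eqF.
rewrite -{1}(subrK c%:MP f) hf; set A := e *: _; set B := eta *: _; ring.
Qed.

End Representations.

(** * From the effective representation to the three statements *)

Lemma int_bits_gt0 (R : realType) n tau (f : {mpoly R[n]}) :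
  f != 0 -> int_coeffs_bits tau f -> (0 < tau)%N.
Proof.
move=> f0 hf; rewrite lt0n; apply: contraNneq f0 => t0; apply/eqP/mpolyP => mu.
have [fi] := hf mu; rewrite t0 expr0 mcoeff0 => f1; apply/eqP; apply: contraTT f1 => fn.
by rewrite -leNgt norm_intr_ge1.
Qed.

Theorem theorem20 (R : realType) (n m : nat) (g : 'I_m -> {mpoly R[n]}) :
  (* S has nonempty interior *)
  (exists (x0 : 'I_n -> R) (r : R), 0 < r /\
     forall y : 'I_n -> R, (forall i, `|y i - x0 i| < r) -> inS g y) ->
  (* S is included in [-1,1]^n *)
  (forall x : 'I_n -> R, inS g x -> forall i, -1 <= x i <= 1) ->
  (* Q(S) is archimedean *)
  archimedean g ->
  exists CS : R, 0 < CS /\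
  forall (d tau : nat) (f : {mpoly R[n]}),
    (forall i, (msize (g i) <= d)%N) ->
    (forall i, int_coeffs_bits tau (g i)) ->
    (msize f <= d)%N ->
    int_coeffs_bits tau f ->
    (* f^* = min_S f exists and is positive *)
    (exists fstar : R, 0 < fstar /\
       (exists x0, inS g x0 /\ f.@[x0] = fstar) /\
       (forall x, inS g x -> fstar <= f.@[x])) ->
    exists k : nat,
      (* (i) *)
      (QmodD g k.*2 f /\ 0 < fstarD g k.*2 f /\
       exists (s0 : {mpoly R[n]}) (s : 'I_m -> {mpoly R[n]}),
         is_sos s0 /\ (forall i, is_sos (s i)) /\
         (msize s0 <= k.*2.+1)%N /\
         (forall i, (msize (s i * g i) <= k.*2.+1)%N) /\
         f = (fstarD g k.*2 f)%:MP + s0 + \sum_(i < m) s i * g i)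
      /\
      (* (ii) *)
      (QmodD' g k k.*2 f /\
       exists (s0 : {mpoly R[n]}) (s : 'I_m -> {mpoly R[n]})
              (c : 'X_{1..n < k.+1} -> R),
         sos_interior (k.*2)./2 s0 /\
         (forall i, sos_interior (k.*2 - pdeg (g i))./2 (s i)) /\
         (msize s0 <= k.*2.+1)%N /\
         (forall i, (msize (s i * g i) <= k.*2.+1)%N) /\
         (forall a, 0 < c a) /\
         f = s0 + \sum_(i < m) s i * g i
               + \sum_(a : 'X_{1..n < k.+1}) c a *: (1 - 'X_[a] ^+ 2))
      /\
      (* (iii) *)
      (exists N : nat, (0 < N)%N /\
         QmodD' g k k.*2
           (f - (2%:R ^- N) *: \sum_(a : 'X_{1..n < k.+1}) 'X_[a] ^+ 2) /\
         N%:R <= 2%:R `^ (CS * tau%:R * d%:R ^+ (2 * n + 2))).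
Proof.
move=> [x0 [r [r0 hcube]]] _ [N0 [e0 [e [e0s [es he]]]]].
(* The successor makes [N] positive; the added 1 is a square. *)
pose N := N0.+1.
have hball : Qmod g (ball_poly R n N).
  exists (1 + e0), e; split; first by apply: sosD => //; rewrite -(expr1n _ 2); exact: sos_sqr.
  by split=> //; rewrite /ball_poly -natr1 [_ + 1]addrC -addrA he addrA.
have [D0 hD0] := preorder_sub_Qmod hball.
(* The growth constants depend on [n], [m], [N] and [D0] only, so they are fixed before [f], [d] and
   [tau]. *)
have [u hu hK] := dexp_putinar_degree n m N D0.
have [C hC] : exp_bounded n
    (fun d t => n * (u d t + 2) + pos_exponent n m N d t + 3)%N.
  apply: exp_add (exp_const _ _); apply: exp_add.
    by apply: exp_mul (exp_const _ _) _; exact: exp_add hu (exp_const _ _).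
  exact: linear_exp (linear_pos_exponent n m N).
exists C.+1%:R; split; first by rewrite ltr0n.
move=> d t f gd gb fd fb [fs [fs0 [[x1 [_ fx1]] fmin]]].
have f0 : f != 0.
  by apply: contraTneq fs0 => fz; rewrite -fx1 fz meval0 ltxx.
have t0 : (0 < t)%N := int_bits_gt0 f0 fb.
have d0 : (0 < d)%N by apply: leq_trans fd; rewrite lt0n msize_poly_eq0.
have fpos x : inS g x -> 0 < f.@[x] by move=> /fmin; exact: lt_le_trans.
have heff := effective_putinar (ltn0Sn N0 : (0 < N)%N) hD0 d0 gd gb fd fb fpos.
set K := putinar_degree _ _ _ _ _ _ in heff; set c := 2 ^- _ in heff.
have c0 : 0 < c by rewrite invr_gt0 exprn_gt0.
(* Strictly above [K], as [interior_representation] requires. *)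
pose k := K.+1; exists k.
have heff2 : QmodD g K.*2 (f - c%:MP) by apply: QmodD_le heff; lia.
have heffk : QmodD g k.*2 (f - c%:MP) by apply: QmodD_le heff; rewrite /k; lia.
have [cf hf] := fstarD_attained r0 hcube heffk.
have dK : (d <= K)%N by rewrite /K /putinar_degree leq_addl.
split; last split.
- split; last split; first 2 last.
  + have [s0 [s [? [? [? [? hfs]]]]]] := hf; exists s0, s; do 4!split=> //.
    by rewrite -addrA -hfs addrC subrK.
  + rewrite -(subrK c%:MP f); apply: QmodD_add => //; apply: QmodD_const; exact: ltW.
  + exact: lt_le_trans cf.
- split.
    (* Membership of [f] itself is the case [e = 0]. *)
    have := @QmodD_unit_box _ _ _ g k f c 0 heffk (lexx _).
    by rewrite mul0r scale0r subr0; apply; exact: ltW.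
  apply: (interior_representation _ (ltnSn K) c0 heff2) => i.
  by apply: leq_trans (leq_pred _) _; apply: leq_trans (gd i) _; rewrite /k; lia.
(* There are at most [(K + 2)^n <= 2^(n * (u + 2))] monomials and [c = 2^-(pos_exponent + 2)]; the
   last unit of the [3] is spare. *)
pose E := (n * (u d t + 2) + pos_exponent n m N d t + 3)%N.
exists E; split; first by rewrite /E addn_gt0 orbT.
split.
  apply: (QmodD_unit_box heffk); first by rewrite invr_ge0 exprn_ge0.
  have hcard : (#|{: 'X_{1..n < k.+1}}| <= 2 ^ (n * (u d t + 2)))%N.
    apply: leq_trans (card_bmultinom _ _) _.
    rewrite mulnC expnM; case: (n) => // n'; rewrite leq_exp2r // /k.
    have := hK d t d0 t0; rewrite -/K expnD.
    have : (0 < 2 ^ u d t)%N by rewrite expn_gt0.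
    by move: (2 ^ u d t)%N => a; lia.
  rewrite mulrC ler_pdivrMr ?exprn_gt0 // mulrC ler_pdivlMr ?exprn_gt0 //.
  rewrite -!natrX -natrM ler_nat; apply: leq_trans (leq_mul hcard (leqnn _)) _.
  by rewrite -expnD leq_pexp2l // /E; lia.
have hE := hC d t d0 t0; rewrite -/E in hE.
apply: (@le_trans _ _ (2 ^ (C.+1 * scale n d t))%:R).
  rewrite ler_nat; apply: leq_trans hE _.
  by rewrite leq_pexp2l // leq_mul2r leqnSn orbT.
by rewrite -[d%:R ^+ _]natrX -!natrM powR_mulrn // natrX /scale mulnA.
Qed.
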